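(* Let $\beta\in\mathcal{B}$ and let $\mu_\beta$ be a subsequential limit of $\{\mathcal{G}_{\beta,N}\}_{N\in\mathbb{N}}$ (in the sense of convergence of overlap arrays defined in the context). Then $$E\mu_\beta^{\times3}\big(R_{1,2}\ge R_{1,3}\wedge R_{2,3}\big)=1.$$ Since the replicas $\rho^l$ all have norm $\sqrt{x^{l_\beta-1}}$ almost surely in $\mathcal{H}$, this is equivalent to the ultrametric inequality $$E\mu_\beta^{\times3}\big(\|\rho^1-\rho^2\|\le\|\rho^1-\rho^3\|\vee\|\rho^2-\rho^3\|\big)=1.$$
   Context: **Field.** For a finite box $B\subseteq\mathbb{Z}^2$ let $\partial B=\{v\in B:\exists z\in\mathbb{Z}^2\setminus B,\ \|v-z\|_2=1\}$ and $B^o=B\setminus\partial B$. The Gaussian free field (GFF) on $B$ is the centered Gaussian field with covariance $G_B(v,v')=\frac{\pi}{2}\mathscr{E}_v\big[\sum_{k=0}^{\tau_{\partial B}-1}\mathbf{1}_{\{W_k=v'\}}\big]$, where $(W_k)$ is the simple random walk on $\mathbb{Z}^2$ started at $v$ and $\tau_{\partial B}$ is its first hitting time of $\partial B$ (empty sums are $0$). Let $V_N=\{0,1,\dots,N\}^2$ and let $\phi=\{\phi_v\}_{v\in V_N}$ be the GFF on $V_N$ (dependence on $N$ implicit). For $\lambda\in(0,1)$ and $v\in V_N$ let $[v]_\lambda=\big(v+[-\tfrac12N^{1-\lambda},\tfrac12N^{1-\lambda}]^2\big)\cap V_N$, and $[v]_0=V_N$, $[v]_1=\{v\}$. Let $\mathcal{F}_{v,\lambda}=\sigma(\phi_w:w\notin[v]_\lambda^o)$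 and $\phi_v(\lambda)=\mathbb{E}[\phi_v\mid\mathcal{F}_{v,\lambda}]$. Fix $M\in\mathbb{N}$, $\boldsymbol\sigma=(\sigma_1,\dots,\sigma_M)\in(0,\infty)^M$ and $\boldsymbol\lambda=(\lambda_1,\dots,\lambda_M)$ with $0=\lambda_0<\lambda_1<\dots<\lambda_M=1$. The $(\boldsymbol\sigma,\boldsymbol\lambda)$-GFF is $\psi_v=\sum_{i=1}^M\sigma_i(\phi_v(\lambda_i)-\phi_v(\lambda_{i-1}))$, $v\in V_N$. Also $\psi_v(\lambda)=\mathbb{E}[\psi_v\mid\mathcal{F}_{v,\lambda}]$ and $\psi_v(\lambda,\lambda')=\psi_v(\lambda')-\psi_v(\lambda)$. **Effective parameters.** Let $\sigma(s)=\sigma_1\mathbf 1_{\{0\}}(s)+\sum_{i=1}^M\sigma_i\mathbf{1}_{(\lambda_{i-1},\lambda_i]}(s)$, $s\in[0,1]$, $\mathcal{J}_{\sigma^2}(s)=\int_0^s\sigma^2(r)\,dr$ and $\mathcal{J}_{\sigma^2}(s_1,s_2)=\int_{s_1}^{s_2}\sigma^2(r)\,dr$. Let $\hat{\mathcal{J}}_{\sigma^2}$ be the concave hull (least concave majorant) of $\mathcal{J}_{\sigma^2}$ on $[0,1]$, and let $\bar\sigma$ be the unique non-increasing left-continuous positive step function with $\hat{\mathcal{J}}_{\sigma^2}(s)=\int_0^s\bar\sigma^2(r)\,dr$. The jump scales of $\bar\sigma$ are denoted $0=\lambda^0<\lambda^1<\dots<\lambda^m=1$ (superscripts are indices), $\bar\sigma_l=\bar\sigma(\lambda^l)$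 (so $\bar\sigma_1>\dots>\bar\sigma_m$), and $x^j=\mathcal{J}_{\sigma^2}(\lambda^j)/\mathcal{J}_{\sigma^2}(1)$, $0\le j\le m$. **Gibbs measure and overlaps.** For $\beta>0$, $\mathcal{G}_{\beta,N}(\{v\})=e^{\beta\psi_v}/\sum_{w\in V_N}e^{\beta\psi_w}$, $v\in V_N$. The overlap is $q^N(v,v')=\frac{\mathbb{E}[\psi_v\psi_{v'}]}{\mathcal{J}_{\sigma^2}(1)\log N+C_0}$, where $C_0=C_0(\boldsymbol\sigma)>0$ is a fixed constant such that for all $0\le\alpha<\alpha'\le1$ and all $N$ large enough (independently of $\alpha,\alpha'$), $\max_{v\in V_N}\mathbb{E}[\psi_v(\alpha,\alpha')^2]\le\mathcal{J}_{\sigma^2}(\alpha,\alpha')\log N+C_0$. **Inverse temperatures.** $\mathcal{B}=(0,\infty)\setminus\bigcup_{j=1}^m\{2/\bar\sigma_j\}$. $l_\beta=\min\{l\in\{1,\dots,m\}:\beta\le2/\bar\sigma_l\}$ if $\beta\le2/\bar\sigma_m$, and $l_\beta=m+1$ otherwise. **Subsequential limits.** Given the field, let $(v^l)_{l\in\mathbb{N}}$ be i.i.d. from $\mathcal{G}_{\beta,N}$ and $R^N_{l,l'}=q^N(v^l,v^{l'})$; $\mathbb{E}\mathcal{G}_{\beta,N}^{\times\infty}$ denotes the averaged law. A subsequential limit $\mu_\beta$ of $\{\mathcal{G}_{\beta,N}\}_N$ is a random probability measure, defined on some probability space with expectation $E$, concentrated a.s. on the sphere of radius $\sqrt{x^{l_\beta-1}}$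 of a separable Hilbert space $\mathcal{H}$ (with norm $\|\cdot\|$), with the following property: if, given $\mu_\beta$, $(\rho^l)_{l\in\mathbb{N}}$ (''replicas'') is i.i.d. from $\mu_\beta$ and $R_{l,l'}=(\rho^l,\rho^{l'})_{\mathcal{H}}+(1-x^{l_\beta-1})\mathbf{1}_{\{l=l'\}}$, then there is a subsequence $\{N_n\}$ such that for every $s\in\mathbb{N}$ and every continuous $h:[-1,1]^{s(s-1)/2}\to\mathbb{R}$, $\lim_{n\to\infty}\mathbb{E}\mathcal{G}_{\beta,N_n}^{\times\infty}[h((R^{N_n}_{l,l'})_{1\le l,l'\le s})]=E\mu_\beta^{\times\infty}[h((R_{l,l'})_{1\le l,l'\le s})]$. Here symmetric $s\times s$ arrays are identified, as arguments of $h$, with their $s(s-1)/2$ off-diagonal entries, and $E\mu_\beta^{\times s}$ denotes the averaged law of $s$ independent samples from $\mu_\beta$. *)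

(* Defs.v *)
From HB Require Import structures.
From mathcomp Require Import all_boot all_order all_algebra.
From mathcomp Require Import sesquilinear.
From mathcomp Require Import all_classical all_reals all_analysis.

Set Implicit Arguments.
Unset Strict Implicit.
Unset Printing Implicit Defensive.

Import Order.TTheory GRing.Theory Num.Theory.
Import numFieldNormedType.Exports.

Local Open Scope classical_set_scope.
Local Open Scope ring_scope.

Definition Z2 : Type := (int * int)%type.

(* [‖v - z‖_2 = 1] is written with the squared norm, which is an integer. *)
Definition neighbours (v z : Z2) : Prop :=
  (v.1 - z.1) ^+ 2 + (v.2 - z.2) ^+ 2 = 1.

Definition boundary (B : set Z2) : set Z2 :=
  [set v | B v /\ exists z : Z2, ~ B z /\ neighbours v z].

Definition box_interior (B : set Z2) : set Z2 := B `\` boundary B.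

Section random_walk.
Context {R : realType} {d : measure_display} {T : measurableType d}.

(* Finite-dimensional laws: each nearest-neighbour path of length n issued from
   v has probability 4^-n; these exhaust the total mass. *)
Definition simple_random_walk (P : probability T R) (W : nat -> T -> Z2)
    (v : Z2) : Prop :=
  (forall (k : nat) (z : Z2), measurable [set w | W k w = z]) /\
  (forall (n : nat) (z : nat -> Z2), z 0%N = v ->
     (forall k : nat, (k < n)%N -> neighbours (z k) (z k.+1)) ->
     P [set w | forall k : nat, (k <= n)%N -> W k w = z k] =
       ((4%:R : R) ^- n)%:E).

Definition hitting_time (W : nat -> T -> Z2) (S : set Z2) (w : T) : \bar R :=
  ereal_inf [set (k%:R : R)%:E | k in [set k : nat | S (W k w)]].

(* [PW v] is the law under which the walk [W] starts at [v]. *)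
Definition green (PW : Z2 -> probability T R) (W : nat -> T -> Z2)
    (B : set Z2) (v v' : Z2) : \bar R :=
  ((pi / 2)%:E *
   \int[PW v]_w \sum_(0 <= k <oo |
       ((k%:R : R)%:E < hitting_time W (boundary B) w)%E)
     ((W k w == v')%:R : R)%:E)%E.

End random_walk.

Section gaussian_condexp.
Context {R : realType} {d : measure_display} {T : measurableType d}.
Variable P : probability T R.

(* [normal_prob m 0] is by convention the uniform law on [0, 1]; the degenerate
   Gaussian law is the Dirac mass. *)
Definition gaussian (X : T -> R) : Prop :=
  exists m s : R, 0 <= s /\
    forall B : set R, measurable B ->
      P (X @^-1` B) = if s == 0 then (\d_m B)%E else normal_prob m s B.

Definition centered_gaussian_field (I : finType) (X : I -> {RV P >-> R})
    (C : I -> I -> \bar R) : Prop :=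
  [/\ (forall a : I -> R, gaussian (fun w => \sum_i a i * X i w)),
      (forall i, ('E_P[X i] = 0)%E) &
      (forall i j, covariance P (X i) (X j) = C i j)].

(* [Y] is a version of E[X | F], for a sub-sigma-algebra F. *)
Definition is_cond_exp (F : set (set T)) (X Y : T -> R) : Prop :=
  [/\ (forall B : set R, measurable B -> F (Y @^-1` B)),
      P.-integrable setT (EFin \o Y) &
      (forall A : set T, F A ->
         (\int[P]_(w in A) (Y w)%:E = \int[P]_(w in A) (X w)%:E)%E)].

Definition sigma_of (I : Type) (D : set I) (X : I -> {RV P >-> R}) :
    set (set T) :=
  <<s \bigcup_(i in D) preimage_set_system setT (X i) measurable >>.

End gaussian_condexp.

Section power.
Context {R : realType} {d : measure_display} {T : measurableType d}.

Definition tuple_cons n (p : T * n.-tuple T) : n.+1.-tuple T :=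
  [tuple of p.1 :: p.2].

Lemma measurable_tuple_cons n : measurable_fun setT (@tuple_cons n).
Proof. exact: measurable_cons. Qed.

HB.instance Definition _ n :=
  isMeasurableFun.Build _ _ _ _ (@tuple_cons n) (@measurable_tuple_cons n).

Fixpoint power (mu : probability T R) (n : nat) :
    probability (n.-tuple T) R :=
  if n is n'.+1 then distribution (mu \x power mu n')%E (@tuple_cons n')
  else dirac [tuple].

End power.

Section scales.
Context {R : realType}.

(* Values and scales are indexed as c_1, ..., c_n and t_0, ..., t_n; values of
   [c] and [t] at other indices are irrelevant. *)
Definition scales (n : nat) (t : nat -> R) : Prop :=
  [/\ t 0%N = 0, t n = 1 & forall i : nat, (i < n)%N -> t i < t i.+1].

Definition step_fun (n : nat) (c t : nat -> R) (s : R) : R :=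
  c 1%N * (s == 0)%R%:R +
  \sum_(1 <= i < n.+1) c i * (t i.-1 < s <= t i)%R%:R.

Definition J2 (sg : R -> R) (s1 s2 : R) : R :=
  \int[lebesgue_measure]_(r in `[s1, s2]) (sg r) ^+ 2.

Definition concave01 (f : R -> R) : Prop :=
  forall x y p : R, 0 <= x <= 1 -> 0 <= y <= 1 -> 0 <= p <= 1 ->
    p * f x + (1 - p) * f y <= f (p * x + (1 - p) * y).

Definition majorant01 (f g : R -> R) : Prop :=
  forall s : R, 0 <= s <= 1 -> f s <= g s.

Definition is_concave_hull (f fhat : R -> R) : Prop :=
  [/\ concave01 fhat, majorant01 f fhat &
      forall g : R -> R, concave01 g -> majorant01 f g -> majorant01 fhat g].

(* The step function with values [sbar] on the intervals of the jump scales
   [lbar] is the effective parameter of [sg]: strict monotonicity of [sbar]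
   says that the interior scales are exactly its jumps. *)
Definition effective (sg : R -> R) (m : nat) (sbar lbar : nat -> R) : Prop :=
  [/\ scales m lbar,
      (forall l : nat, (1 <= l <= m)%N -> 0 < sbar l),
      (forall l : nat, (1 <= l < m)%N -> sbar l.+1 < sbar l) &
      is_concave_hull (J2 sg 0) (J2 (step_fun m sbar lbar) 0)].

Definition effective_x (sg : R -> R) (lbar : nat -> R) (j : nat) : R :=
  J2 sg 0 (lbar j) / J2 sg 0 1.

Definition noncritical (m : nat) (sbar : nat -> R) (beta : R) : Prop :=
  0 < beta /\ forall j : nat, (1 <= j <= m)%N -> beta != 2 / sbar j.

(* [find] over 1, ..., m returns the 0-based position of the least index. *)
Definition l_beta (m : nat) (sbar : nat -> R) (beta : R) : nat :=
  if beta <= 2 / sbar m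
  then (find (fun l => beta <= 2 / sbar l) (iota 1 m)).+1
  else m.+1.

End scales.

Definition V (N : nat) : finType := ('I_N.+1 * 'I_N.+1)%type.

Definition site (N : nat) (v : V N) : Z2 :=
  ((v.1 : nat)%:Z, (v.2 : nat)%:Z).

Definition VN (N : nat) : set Z2 := range (@site N).

Section neighbourhood.
Context {R : realType}.

Definition nbox (N : nat) (v : Z2) (l : R) : set Z2 :=
  if l == 0 then VN N
  else if l == 1 then [set v]
  else VN N `&` [set w : Z2 |
         (`|(w.1 - v.1)%:~R| <= 2^-1 * N%:R `^ (1 - l)) /\
         (`|(w.2 - v.2)%:~R| <= 2^-1 * N%:R `^ (1 - l))].

End neighbourhood.

(* Arrays (R_{l,l'}) enter only through their s(s-1)/2 entries with l < l'. *)
Definition upper_pairs (s : nat) : pred ('I_s * 'I_s) :=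
  [pred p : 'I_s * 'I_s | (p.1 < p.2)%N].
Arguments upper_pairs : clear implicits.

Section arrays.
Context {R : realType}.

Definition offdiag (s : nat) (A : 'M[R]_s) : 'rV[R]_#|upper_pairs s| :=
  \row_k A (enum_val k).1 (enum_val k).2.

Definition cube (n : nat) : set 'rV[R]_n :=
  [set x : 'rV[R]_n | forall k : 'I_n, -1 <= x 0 k <= 1].

End arrays.

Section field.
Context {R : realType} (d : nat -> measure_display).
Variables (T : forall N : nat, measurableType (d N)).
Variables (P : forall N : nat, probability (T N) R).
Variables (phi : forall N : nat, V N -> {RV (P N) >-> R}).

Definition is_gff (dW : measure_display) (TW : measurableType dW)
    (PW : Z2 -> probability TW R) (W : nat -> TW -> Z2) : Prop :=
  forall N : nat, centered_gaussian_field (phi (N := N))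
    (fun v v' => green PW W (VN N) (site v) (site v')).

Definition sigma_alg (N : nat) (v : V N) (l : R) : set (set (T N)) :=
  sigma_of [set w : V N | ~ box_interior (nbox N (site v) l) (site w)]
           (phi (N := N)).

(* [cphi v l] stands for (a version of) phi_v(l) = E[phi_v | F_{v,l}]. *)
Variable (cphi : forall N : nat, V N -> R -> T N -> R).

Definition are_cond_exps : Prop :=
  forall (N : nat) (v : V N) (l : R), 0 <= l <= 1 ->
    is_cond_exp (P N) (sigma_alg v l) (phi v) (cphi v l).

Variables (M : nat) (sigma lambda : nat -> R).

Definition psi (N : nat) (v : V N) (w : T N) : R :=
  \sum_(1 <= i < M.+1)
    sigma i * (cphi v (lambda i) w - cphi v (lambda i.-1) w).

Let sg := step_fun M sigma lambda.

(* The versions Y, Y' of psi_v(a), psi_v(a') are arbitrary. *)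
Definition overlap_constant (C0 : R) : Prop :=
  0 < C0 /\
  exists N0 : nat, forall N : nat, (N0 <= N)%N ->
    forall a a' : R, 0 <= a -> a < a' -> a' <= 1 ->
    forall (v : V N) (Y Y' : T N -> R),
      is_cond_exp (P N) (sigma_alg v a) (psi v) Y ->
      is_cond_exp (P N) (sigma_alg v a') (psi v) Y' ->
      ('E_(P N)[fun w => ((Y' w - Y w) ^+ 2)%R]
         <= (J2 sg a a' * ln (N%:R) + C0)%:E)%E.

Variable C0 : R.

Definition overlap (N : nat) (v v' : V N) : R :=
  fine ('E_(P N)[fun w => (psi v w * psi v' w)%R])%E /
  (J2 sg 0 1 * ln (N%:R) + C0).

Variable beta : R.

Definition gibbs (N : nat) (w : T N) (v : V N) : R :=
  expR (beta * psi v w) / \sum_(u : V N) expR (beta * psi u w).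

Definition overlap_array (N s : nat) (v : s.-tuple (V N)) : 'M[R]_s :=
  \matrix_(l, l') overlap (tnth v l) (tnth v l').

(* E G_{beta,N}^{x s} [f] *)
Definition gibbs_average (N s : nat) (f : s.-tuple (V N) -> R) : \bar R :=
  ('E_(P N)[fun w => (\sum_(v : s.-tuple (V N))
               (\prod_(l < s) gibbs w (tnth v l)) * f v)%R])%E.

End field.

(* [ip] is an inner product inducing the norm of the Banach space [H]. *)
Definition is_separable_hilbert (R : realType) (H : completeNormedModType R)
    (ip : {dot H for idfun}) : Prop :=
  (forall x : H, `|x| ^+ 2 = ip x x) /\
  (exists D : set H, countable D /\ dense D).

Definition borel (R : realType) (H : completeNormedModType R) :=
  g_sigma_algebraType (@open H).

Section replicas.
Context {R : realType} {H : completeNormedModType R}.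
Context {dS : measure_display} {S : measurableType dS}.
Variables (PS : probability S R) (mu : {RV PS >-> pprobability (borel H) R}).

(* E mu^{x s} (A) and E mu^{x s} [f] *)
Definition replica_prob (s : nat) (A : set (s.-tuple (borel H))) : \bar R :=
  (\int[PS]_w power (mu w) s A)%E.

Definition replica_average (s : nat) (f : s.-tuple (borel H) -> R) : \bar R :=
  (\int[PS]_w \int[power (mu w) s]_rho (f rho)%:E)%E.

Definition replica_array (ip : {dot H for idfun}) (x : R) (s : nat)
    (rho : s.-tuple (borel H)) : 'M[R]_s :=
  \matrix_(l, l')
    (ip (tnth rho l : H) (tnth rho l' : H) + (1 - x) * (l == l')%:R).

End replicas.

Section subsequential_limits.
Context {R : realType} (d : nat -> measure_display).
Variables (T : forall N : nat, measurableType (d N)).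
Variables (P : forall N : nat, probability (T N) R).
Variable (cphi : forall N : nat, V N -> R -> T N -> R).
Variables (M : nat) (sigma lambda : nat -> R) (C0 beta : R).
Context {H : completeNormedModType R}.
Variables (ip : {dot H for idfun}) (x : R).
Context {dS : measure_display} {S : measurableType dS}.
Variables (PS : probability S R) (mu : {RV PS >-> pprobability (borel H) R}).

(* [x] is the value x^{l_beta - 1}. *)
Definition subsequential_limit : Prop :=
  {ae PS, forall w,
     mu w [set rho : borel H | `|(rho : H)| = Num.sqrt x] = 1%E} /\
  exists Nn : nat -> nat, {homo Nn : i j / (i < j)%N} /\
    forall (s : nat) (h : 'rV[R]_#|upper_pairs s| -> R),
      {within cube (n := _), continuous h} ->
      (fun n => gibbs_average P cphi M sigma lambda beta
         (fun v : s.-tuple (V (Nn n)) =>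
            h (offdiag (overlap_array P cphi M sigma lambda C0 v))))
        @ \oo -->
      replica_average mu
        (fun rho : s.-tuple (borel H) => h (offdiag (replica_array ip x rho))).

End subsequential_limits.

(* Main.v *)
Require Import Defs.
From HB Require Import structures.
From mathcomp Require Import all_boot all_order all_algebra.
From mathcomp Require Import sesquilinear.
From mathcomp Require Import all_classical all_reals all_analysis.
From mathcomp Require Import measurable_realfun zify ring lra.

(** The overlaps are normalised covariances of the field, hence deterministic,
    and they are ultrametric up to O(1/log N) uniformly over all triples of
    sites; no property of the Gibbs weights is needed.

    By Gaussianity phi_v(lambda) is almost surely the average of phi over the
    boundary of the box around v against the hitting distribution of the walk,
    since phi_v minus this average is uncorrelated with the values of phi outside
    the box.  Therefore E[psi_v psi_w] is a combination of averages over two boxes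
    of the Green function.  The Green function is replaced by the logarithm of
    the distance: their difference is, up to a bounded error, harmonic in one
    variable, so it does not contribute to the increments between two scales.
    What remains is, up to a constant independent of N and for v fixed, a
    non-increasing function of the sup-distance of v and w which changes by O(1)
    when the distance doubles, and the triangle inequality gives
    E[psi_1 psi_2] >= min(E[psi_1 psi_3], E[psi_2 psi_3]) - c.

    After division by J(1) log N + C_0 the continuous function
    max(0, min(R_13, R_23) - R_12) of the overlaps tends to 0 uniformly, so its
    average over the replicas of the limit measure vanishes. *)

Import Order.TTheory GRing.Theory Num.Theory.
Import numFieldNormedType.Exports.

Local Open Scope classical_set_scope.
Local Open Scope ring_scope.
Set Implicit Arguments.
Unset Strict Implicit.

(** * Discrete potential theory on the box *)

Section potential_theory.
Context {R : realFieldType} {N : nat}.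
Implicit Types (x y z w : V N) (D : pred (V N)) (b c h : V N -> R).

(** Instead of the potential kernel of the walk and its asymptotics, the proof uses the explicit
    function [lg]. Its discrete Laplacian [kappa] is non-negative and of order r^-4 at distance r,
    while a flow argument makes the Green function Lipschitz. In Dynkin's formula one may therefore
    replace gr x z by gr x y at the cost of a sum of terms r^-3 over the plane, bounded uniformly in
    N. The obstacle is the boundary of V_N: a box around a site near a side is cut off there, and
    the walk may leave it far from its centre. For the upper bound the logarithm is then taken with
    a pole behind that side. On the probabilistic side only the laws of linear combinations of phi
    are given. If U is uncorrelated with Y, then tU + Y and -tU + Y are centered Gaussian with the
    same variance, so sin(tU) has zero mean against cos Y and sin Y. Dividing by t, letting t tend
    to 0 and turning trigonometric functions into indicators gives E[U; A] = 0 on the conditioning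
    sigma-algebra. The numerical constants are crude; what matters is that they do not depend on
    N. *)

Definition adj x y : bool :=
  ((x.1 == y.1 :> nat) && ((x.2.+1 == y.2) || (y.2.+1 == x.2))) ||
  ((x.2 == y.2 :> nat) && ((x.1.+1 == y.1) || (y.1.+1 == x.1))).

Definition inner x : bool :=
  [&& (0 < x.1)%N, (x.1 < N)%N, (0 < x.2)%N & (x.2 < N)%N].

Definition pt (i j : nat) : V N := (inord i, inord j).

Lemma adjC x y : adj x y = adj y x.
Proof. by rewrite /adj; lia. Qed.

Lemma sum_adj x (F : V N -> R) : inner x ->
  \sum_(y | adj x y) F y =
  F (pt x.1.+1 x.2) + F (pt x.1.-1 x.2) +
  F (pt x.1 x.2.+1) + F (pt x.1 x.2.-1).
Proof.
case: x => -[i hi] [j hj]; rewrite /inner /= => /and4P[i0 iN j0 jN].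
have E p q y : (p < N.+1)%N -> (q < N.+1)%N ->
    (y == pt p q) = ((y.1 == p :> nat) && (y.2 == q :> nat)).
  move=> ha hb; rewrite /pt; case: y => y1 y2.
  by rewrite xpair_eqE -!val_eqE /= !inordK.
have mem p q : (p < N.+1)%N -> (q < N.+1)%N ->
    ((pt p q).1 = p :> nat) * ((pt p q).2 = q :> nat).
  by move=> ha hb; split; rewrite inordK.
rewrite (bigD1 (pt i.+1 j)) /=; last by rewrite /adj !mem /=; lia.
rewrite (bigD1 (pt i.-1 j)) /=; last by rewrite E /adj ?mem /=; lia.
rewrite (bigD1 (pt i j.+1)) /=; last by rewrite !E /adj ?mem /=; lia.
rewrite (big_pred1 (pt i j.-1)) ?addrA// => y /=.
by rewrite !E /adj /=; lia.
Qed.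

Definition avg b x : R := 4^-1 * \sum_(y | adj x y) b y.

Lemma sum_adj_inner x : inner x -> \sum_(y | adj x y) (1 : R) = 4.
Proof. by move=> xi; rewrite sum_adj//; ring. Qed.

Lemma avg_sub b b' x : avg (fun y => b y - b' y) x = avg b x - avg b' x.
Proof. by rewrite /avg sumrB mulrBr. Qed.

Lemma avg_sum (I : finType) (F : I -> V N -> R) x :
  avg (fun y => \sum_i F i y) x = \sum_i avg (F i) x.
Proof. by rewrite /avg exchange_big/= mulr_sumr. Qed.

Lemma avg_cst k x : inner x -> avg (fun=> k) x = k.
Proof.
move=> xi; rewrite /avg -[X in \sum_(_ | _) X]mulr1 -mulr_sumr sum_adj_inner//.
by field.
Qed.

Lemma ler_avg b b' x : (forall y, adj x y -> b y <= b' y) -> avg b x <= avg b' x.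
Proof.
by move=> bb; rewrite /avg ler_wpM2l ?invr_ge0 ?ler0n// ler_sum.
Qed.

Section domain.
Variable D : pred (V N).
Hypothesis Dinner : forall x, D x -> inner x.

(** A negative minimum lies in D, so it is at least the average over its neighbours and is attained
    at each of them; moving left from it reaches the column 0, which D does not meet. *)
Lemma min_principle h :
  (forall x, D x -> avg h x <= h x) -> (forall x, ~~ D x -> 0 <= h x) ->
  forall x, 0 <= h x.
Proof.
move=> sup off x.
have [x0 _ x0min] : exists2 x0, true & forall y, h x0 <= h y.
  have [x0 _ x0m] := @arg_minP _ R (V N) x xpredT h isT.
  by exists x0 => // y; exact: x0m.
apply: le_trans (x0min x); rewrite leNgt; apply/negP => neg.
suff H n : forall z, z.1 = n :> nat -> h z = h x0 -> False by exact: (H _ x0).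
elim: n => [|n IH] z zn hz.
  have Dz : ~~ D z by apply/negP => /Dinner; rewrite /inner zn.
  by move: (off _ Dz); rewrite hz leNgt neg.
have [Dz|Dz] := boolP (D z); last by move: (off _ Dz); rewrite hz leNgt neg.
have zi := Dinner Dz.
apply: (IH (pt z.1.-1 z.2)); first by rewrite /= inordK ?zn//; case/and4P: zi; lia.
have := sup _ Dz; rewrite /avg sum_adj// hz.
have := x0min (pt z.1.+1 z.2); have := x0min (pt z.1.-1 z.2).
have := x0min (pt z.1 z.2.+1); have := x0min (pt z.1 z.2.-1).
lra.
Qed.

Lemma unique_dirichlet h h' :
  (forall x, ~~ D x -> h x = h' x) ->
  (forall x, D x -> h x - avg h x = h' x - avg h' x) -> h =1 h'.
Proof.
move=> off on x; apply/eqP; rewrite eq_le; apply/andP; split; rewrite -subr_ge0.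
- apply: (min_principle (h := fun x => h' x - h x)) => y Dy.
    by rewrite avg_sub; have := on _ Dy; lra.
  by rewrite off// subrr.
- apply: (min_principle (h := fun x => h x - h' x)) => y Dy.
    by rewrite avg_sub; have := on _ Dy; lra.
  by rewrite off// subrr.
Qed.

(** The equations form a square linear system in the values of h, and [unique_dirichlet] says that
    its kernel is trivial. *)
Lemma exists_dirichlet b c : exists h,
  (forall x, ~~ D x -> h x = b x) /\ (forall x, D x -> h x - avg h x = c x).
Proof.
pose n := #|V N|.
pose A : 'M[R]_n := \matrix_(i, j)
  ((enum_val i == enum_val j)%:R -
   (if D (enum_val i) then 4^-1 * (adj (enum_val i) (enum_val j))%:R else 0)).
have AE (u : 'cV[R]_n) i :
    let h y := u (enum_rank y) 0 in let x := enum_val i in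
    (A *m u) i 0 = h x - (if D x then avg h x else 0).
  move=> h x; rewrite mxE.
  under eq_bigr => j _ do rewrite mxE mulrBl.
  rewrite sumrB; congr (_ - _).
    rewrite (bigD1 i)//= eqxx mul1r big1 ?addr0; first by rewrite /h /x enum_valK.
    by move=> j ji; rewrite (inj_eq enum_val_inj) eq_sym (negbTE ji) mul0r.
  rewrite -/x; case: ifP => _; last by rewrite big1// => j _; rewrite mul0r.
  rewrite /avg mulr_sumr [RHS]big_mkcond/= (reindex (@enum_val _ (V N)))/=; last first.
    by exists enum_rank => ? _; rewrite ?enum_valK ?enum_rankK.
  apply: eq_bigr => j _; rewrite /h enum_valK.
  by case: ifP => _; rewrite ?mulr1 ?mulr0 ?mul0r.
have Au : A \in unitmx.
  rewrite -unitmx_tr -row_free_unit.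
  apply: inj_row_free => v vA.
  pose u := v^T.
  have Au0 : A *m u = 0 by rewrite /u -[A]trmxK -trmx_mul vA trmx0.
  pose h y := u (enum_rank y) 0.
  have h0 : h =1 fun=> 0.
    have hE y : h y - (if D y then avg h y else 0) = 0.
      by have := AE u (enum_rank y); rewrite Au0 mxE /= enum_rankK => <-.
    apply: unique_dirichlet => y Dy; have := hE y.
      by rewrite (negbTE Dy) subr0.
    rewrite Dy => ->.
    by rewrite /avg big1 ?mulr0 ?subrr.
  apply/rowP => j; have := h0 (enum_val j).
  by rewrite /h enum_valK !mxE.
pose rhs : 'cV[R]_n := \col_i (if D (enum_val i) then c (enum_val i) else b (enum_val i)).
have [u uE] : exists u, A *m u = rhs.
  by exists (invmx A *m rhs); rewrite mulmxA mulmxV// mul1mx.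
exists (fun y => u (enum_rank y) 0).
by split => x Dx; have := AE u (enum_rank x); rewrite uE mxE /= enum_rankK
  ?Dx ?(negbTE Dx) ?subr0 => ->.
Qed.


(** By [exists_dirichlet] the default value 0 is never taken. *)
Definition solve b c : V N -> R := xget (fun=> 0)
  [set h | (forall x, ~~ D x -> h x = b x) /\
           (forall x, D x -> h x - avg h x = c x)].

Lemma solveP b c :
  (forall x, ~~ D x -> solve b c x = b x) /\
  (forall x, D x -> solve b c x - avg (solve b c) x = c x).
Proof.
rewrite /solve; case: xgetP => [h _ //|nh].
by have [h hP] := exists_dirichlet b c; case: (nh h).
Qed.

Lemma solve_unique b c h : (forall x, ~~ D x -> h x = b x) ->
  (forall x, D x -> h x - avg h x = c x) -> solve b c =1 h.
Proof.
move=> off on; have [off' on'] := solveP b c.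
by apply: unique_dirichlet => x Dx; [rewrite off'// off|rewrite on'// on].
Qed.

(* Green function of the walk killed on leaving D, and its exit distribution. *)
Definition gr x y : R := solve (fun=> 0) (fun z => (z == y)%:R) x.
Definition harm x w : R := solve (fun z => (z == w)%:R) (fun=> 0) x.
Definition ext b x : R := \sum_w harm x w * b w.

Lemma gr_out x y : ~~ D x -> gr x y = 0.
Proof. exact: (solveP (fun=> 0) (fun z => (z == y)%:R)).1. Qed.

Lemma gr_pole x y : D x -> gr x y - avg (gr^~ y) x = (x == y)%:R.
Proof. exact: (solveP (fun=> 0) (fun z => (z == y)%:R)).2. Qed.

Lemma gr_ge0 x y : 0 <= gr x y.
Proof.
apply: (min_principle (h := gr^~ y)) => z Dz; last by rewrite gr_out.
by rewrite -subr_ge0 gr_pole// ler0n.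
Qed.

Lemma avg_self_adjoint h h' : \sum_x h x * avg h' x = \sum_x avg h x * h' x.
Proof.
under eq_bigr => x _ do rewrite /avg mulrCA mulr_sumr.
under [RHS]eq_bigr => x _ do rewrite /avg -mulrA mulr_suml.
rewrite -!mulr_sumr; congr (_ * _).
under eq_bigr => x _ do rewrite big_mkcond/=.
under [RHS]eq_bigr => x _ do rewrite big_mkcond/=.
rewrite exchange_big/=; apply: eq_bigr => x _; apply: eq_bigr => y _.
by rewrite adjC.
Qed.

Lemma gr_outr x y : ~~ D y -> gr x y = 0.
Proof.
move=> Dy; apply: (solve_unique (h := fun=> 0)) => z Dz //.
rewrite /avg big1 ?mulr0 ?subrr//; case: eqP => // zy.
by move: Dy; rewrite -zy Dz.
Qed.

(** Green's identity: pairing gr(., p) with the Laplacian of gr(., q) evaluates it at q, and [avg]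
    is self-adjoint. *)
Lemma gr_sym x y : gr x y = gr y x.
Proof.
have [Dx|Dx] := boolP (D x); last by rewrite gr_out// gr_outr.
have [Dy|Dy] := boolP (D y); last by rewrite gr_outr// gr_out.
have E p q : D q -> \sum_z gr z p * (gr z q - avg (gr^~ q) z) = gr q p.
  move=> Dq; rewrite (bigD1 q)//= gr_pole// eqxx mulr1 big1 ?addr0// => z zb.
  have [Dz|Dz] := boolP (D z); last by rewrite gr_out ?mul0r.
  by rewrite gr_pole// (negbTE zb) mulr0.
rewrite -(E y x)// -(E x y)//.
under eq_bigr do rewrite mulrBr.
under [RHS]eq_bigr do rewrite mulrBr.
rewrite !sumrB avg_self_adjoint; congr (_ - _).
  by apply: eq_bigr => z _; rewrite mulrC.
by apply: eq_bigr => z _; rewrite mulrC.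
Qed.

Lemma harm_off x w : ~~ D x -> harm x w = (x == w)%:R.
Proof. exact: (solveP (fun z => (z == w)%:R) (fun=> 0)).1. Qed.

Lemma harm_avg x w : D x -> avg (harm^~ w) x = harm x w.
Proof.
move=> Dx; have /eqP := (solveP (fun z => (z == w)%:R) (fun=> 0)).2 x Dx.
by rewrite subr_eq0 => /eqP.
Qed.

Lemma harm_ge0 x w : 0 <= harm x w.
Proof.
apply: (min_principle (h := harm^~ w)) => z Dz; first by rewrite harm_avg.
by rewrite harm_off// ler0n.
Qed.

Lemma ext_off b x : ~~ D x -> ext b x = b x.
Proof.
move=> Dx; rewrite /ext (bigD1 x)//= harm_off// eqxx mul1r big1 ?addr0// => w wx.
by rewrite harm_off// eq_sym (negbTE wx) mul0r.
Qed.

Lemma ext_avg b x : D x -> avg (ext b) x = ext b x.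
Proof.
move=> Dx; rewrite avg_sum; apply: eq_bigr => w _.
by rewrite -(harm_avg _ Dx) /avg -mulrA mulr_suml.
Qed.

Lemma ext_unique b h : (forall x, ~~ D x -> h x = b x) ->
  (forall x, D x -> avg h x = h x) -> ext b =1 h.
Proof.
move=> off on; apply: unique_dirichlet => x Dx; first by rewrite ext_off ?off.
by rewrite ext_avg// on// !subrr.
Qed.

Lemma ext_cst k x : ext (fun=> k) x = k.
Proof. by apply: (ext_unique (h := fun=> k)) => // z Dz; rewrite avg_cst// Dinner. Qed.

Lemma harm_in x w : D w -> harm x w = 0.
Proof.
move=> Dw; apply: (solve_unique (h := fun=> 0)) => z Dz.
  by case: eqP => // zw; move: Dz; rewrite zw Dw.
by rewrite /avg big1 ?mulr0 ?subrr.
Qed.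

(* The walk stopped on leaving D stops next to D, unless it starts outside. *)
Lemma harm_support x w : x != w -> (forall z, D z -> ~~ adj z w) ->
  harm x w = 0.
Proof.
move=> xw far; have [/harm_in ->//|Dw] := boolP (D w).
rewrite (_ : harm x w = (x == w)%:R); first by rewrite (negbTE xw).
apply: (solve_unique (h := fun z => (z == w)%:R)) => // z Dz.
have -> : (z == w) = false by apply/eqP => zw; move: Dw; rewrite -zw Dz.
rewrite /avg big1 ?mulr0 ?subr0// => y zy; case: eqP => // yw.
by have := far z Dz; rewrite -yw zy.
Qed.

Lemma ler_ext b b' x :
  (forall w, harm x w != 0 -> b w <= b' w) -> ext b x <= ext b' x.
Proof.
move=> bb; apply: ler_sum => w _; have [->|/bb] := eqVneq (harm x w) 0.
  by rewrite !mul0r.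
exact/ler_wpM2l/harm_ge0.
Qed.

Lemma extD b b' x : ext (fun w => b w + b' w) x = ext b x + ext b' x.
Proof. by rewrite /ext -big_split/=; under eq_bigr do rewrite mulrDr. Qed.

Lemma extB b b' x : ext (fun w => b w - b' w) x = ext b x - ext b' x.
Proof. by rewrite /ext -sumrB; under eq_bigr do rewrite mulrBr. Qed.

Lemma extZ k b x : ext (fun w => k * b w) x = k * ext b x.
Proof. by rewrite /ext mulr_sumr; under eq_bigr do rewrite mulrCA. Qed.

(** Both sides solve the same Dirichlet problem: the Green potential vanishes off D, and inside D it
    cancels the Laplacian of b. *)
Lemma dynkin_formula b x : ext b x = b x + \sum_z gr x z * (avg b z - b z).
Proof.
apply: (ext_unique (h := fun x => b x + \sum_z gr x z * (avg b z - b z))) => y Dy.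
  by rewrite big1 ?addr0// => z _; rewrite gr_out ?mul0r.
have -> : avg (fun x => b x + \sum_z gr x z * (avg b z - b z)) y =
    avg b y + \sum_z avg (gr^~ z) y * (avg b z - b z).
  rewrite /avg big_split/= mulrDr; congr (_ + _).
  rewrite exchange_big/= mulr_sumr; apply: eq_bigr => z _.
  by rewrite -mulr_suml mulrA.
apply/eqP; rewrite -subr_eq0 opprD addrACA -sumrB.
rewrite (bigD1 y)//= big1 => [|z zy].
  have := gr_pole y Dy; rewrite eqxx => e.
  by rewrite addr0 -mulrBl -[X in _ + X * _]opprB e mulN1r subrr.
have := gr_pole z Dy; rewrite eq_sym (negbTE zy) => /eqP.
by rewrite subr_eq0 => /eqP <-; rewrite subrr.
Qed.

(** Let each edge carry the difference of the values of gr(., x0) at its ends. The superlevel set S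
    of y lies in D, and the net flow out of it is at most 4, the pole having strength 1 after
    division by the degree. All edges leaving S carry a non-negative flow, and the edge from y to z
    is one of them. *)
Lemma flow x0 y z : adj y z -> gr y x0 - gr z x0 <= 4.
Proof.
move=> yz; have [le|lt] := leP (gr y x0) (gr z x0).
  by rewrite (@le_trans _ _ 0)// subr_le0.
pose S w := gr y x0 <= gr w x0.
have SD w : S w -> D w.
  rewrite /S; apply: contraLR => Dw; rewrite (gr_out x0 Dw) -ltNge.
  exact: le_lt_trans (gr_ge0 z x0) lt.
have le1 : \sum_(w | S w) (gr w x0 - avg (gr^~ x0) w) <= 1.
  under eq_bigr => w Sw do rewrite gr_pole ?SD//.
  have [Sx|Sx] := boolP (S x0).
    by rewrite (bigD1 x0)//= eqxx big1 ?addr0// => w /andP[_ /negbTE ->].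
  by rewrite big1 ?ler01// => w Sw; case: eqP => // e; move: Sx; rewrite -e Sw.
have E w : S w -> gr w x0 - avg (gr^~ x0) w =
    4^-1 * (\sum_(u | adj w u) (gr w x0 - gr u x0)).
  move=> Sw; rewrite sumrB mulrBr; congr (_ - _).
  by have := avg_cst (gr w x0) (Dinner (SD _ Sw)); rewrite /avg => ->.
have {le1} : \sum_(w | S w) \sum_(u | adj w u) (gr w x0 - gr u x0) <= 4.
  move: le1; rewrite (eq_bigr _ E) -mulr_sumr; lra.
apply: le_trans.
have -> : \sum_(w | S w) \sum_(u | adj w u) (gr w x0 - gr u x0) =
  \sum_(w | S w) \sum_(u | adj w u && S u) (gr w x0 - gr u x0) +
  \sum_(w | S w) \sum_(u | adj w u && ~~ S u) (gr w x0 - gr u x0).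
  by rewrite -big_split/=; apply: eq_bigr => w _; rewrite (bigID S).
have -> : \sum_(w | S w) \sum_(u | adj w u && S u) (gr w x0 - gr u x0) = 0.
  (* Edges inside S are counted in both directions, with opposite signs. *)
  set T := LHS; suff : T = - T by lra.
  rewrite {1}/T (exchange_big_dep S)/=; last by move=> ? ? _ /andP[].
  rewrite /T -sumrN; apply: eq_bigr => w Sw; rewrite -sumrN.
  apply: eq_big => [u|u _]; last by rewrite opprB.
  by rewrite adjC Sw andbT andbC.
have pos w u : S w -> ~~ S u -> 0 <= gr w x0 - gr u x0.
  by rewrite /S -ltNge => h1 h2; rewrite subr_ge0 ltW// (lt_le_trans h2).
rewrite add0r (bigD1 y)/=; last exact: lexx.
rewrite (bigD1 z)/=; last by rewrite yz /S -ltNge lt.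
rewrite -addrA lerDl addr_ge0// ?sumr_ge0//.
  by move=> u /andP[/andP[_ Su] _]; rewrite pos// /S.
move=> w /andP[Sw _]; rewrite sumr_ge0// => u /andP[_ Su]; exact: pos.
Qed.

Lemma abs_flow x0 y z : adj y z -> `|gr x0 y - gr x0 z| <= 4.
Proof.
move=> yz; rewrite (gr_sym x0 y) (gr_sym x0 z) ler_norml.
by have := flow x0 yz; have := @flow x0 z y; rewrite adjC yz => /(_ isT); lra.
Qed.

End domain.

(** The strong Markov property in analytic form: [ext D' b] is harmonic in the smaller domain D. *)
Lemma ext_ext D D' b x : (forall x, D x -> D' x) -> (forall x, D' x -> inner x) ->
  ext D (ext D' b) x = ext D' b x.
Proof.
move=> DD' D'i; apply: ext_unique => //.
  by move=> y Dy; exact/D'i/DD'.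
by move=> y Dy; rewrite ext_avg//; exact: DD'.
Qed.

End potential_theory.

(** * The logarithm as an approximate Green function *)

Section logarithmic_kernel.
Context {R : realType}.
Implicit Types a b : R.

Definition lg a b : R := ln (1 + a ^+ 2 + b ^+ 2).

(* The discrete Laplacian of [lg] is nonnegative and summable over the lattice, so
   that [- lg] is a potential kernel up to the factor [mass] and a bounded error. *)
Definition kappa a b : R :=
  4^-1 * (lg (a + 1) b + lg (a - 1) b + lg a (b + 1) + lg a (b - 1)) - lg a b.

Let q a b := 1 + a ^+ 2 + b ^+ 2.

Lemma q_ge1 a b : 1 <= q a b.
Proof. by rewrite /q; have := sqr_ge0 a; have := sqr_ge0 b; lra. Qed.

(** The neighbouring values of q are q + 1 +- 2a and q + 1 +- 2b, so their product is ((q+1)^2 -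
    4a^2)((q+1)^2 - 4b^2). The cubic terms in q cancel, since the logarithm is harmonic in the
    plane; the excess over q^4 is positive and quadratic in q, which gives both the sign and the
    decay of [kappa]. *)
Lemma kappaE a b : kappa a b = 4^-1 * ln (1 +
  (2 * q a b ^+ 2 + 8 * q a b + 5 + 16 * a ^+ 2 * b ^+ 2) / q a b ^+ 4).
Proof.
have qp x y : 0 < q x y by apply: lt_le_trans (q_ge1 x y).
have -> : 1 + (2 * q a b ^+ 2 + 8 * q a b + 5 + 16 * a ^+ 2 * b ^+ 2) / q a b ^+ 4
  = q (a + 1) b * q (a - 1) b * q a (b + 1) * q a (b - 1) / q a b ^+ 4.
  have q0 : q a b ^+ 4 != 0 by rewrite expf_neq0// gt_eqF.
  apply: (mulIf q0); rewrite mulfVK// mulrDl mul1r mulfVK// /q; ring.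
rewrite ln_div ?posrE ?exprn_gt0// ?mulr_gt0// lnXn//.
rewrite !lnM ?posrE ?mulr_gt0// /kappa /lg -/(q _ _) -!/(q _ _).
by rewrite mulrBr -[ln (q a b) *+ 4]mulr_natr; field.
Qed.

Lemma kappa_ge0 a b : 0 <= kappa a b.
Proof.
rewrite kappaE mulr_ge0 ?invr_ge0// ln_ge0// lerDl divr_ge0//.
  have := q_ge1 a b; have := sqr_ge0 (a * b); nra.
by rewrite exprn_ge0// (le_trans _ (q_ge1 a b)).
Qed.

Lemma kappa_le a b : kappa a b <= 5 / q a b ^+ 2.
Proof.
have q1 := q_ge1 a b; rewrite kappaE.
set t := (X in ln (1 + X)).
(* As 4 a^2 b^2 <= q^2 and q >= 1, the numerator is at most (2 + 8 + 5 + 4) q^2. *)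
have tle : t <= 20 / q a b ^+ 2.
  rewrite /t ler_pdivrMr ?exprn_gt0//; last lra.
  have -> : 20 / q a b ^+ 2 * q a b ^+ 4 = 20 * q a b ^+ 2.
    by field; rewrite gt_eqF//; lra.
  have ab : a ^+ 2 * b ^+ 2 * 4 <= q a b ^+ 2.
    by rewrite /q; have := sqr_ge0 (a ^+ 2 - b ^+ 2); have := sqr_ge0 a; have := sqr_ge0 b; nra.
  nra.
have t0 : 0 <= t.
  rewrite /t divr_ge0 ?exprn_ge0//; last lra.
  have := sqr_ge0 (a * b); nra.
have : ln (1 + t) <= t by apply: le_ln1Dx; lra.
by rewrite -[5 / _]/(5 * _) -[20 / _]/(20 * _) in tle *; lra.
Qed.

Lemma kappa00_gt0 : 0 < kappa 0 0.
Proof.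
rewrite kappaE mulr_gt0 ?invr_gt0// ln_gt0// ltrDl.
by rewrite /q expr0n/= !addr0 !expr1n divr1; lra.
Qed.

(* [1 + s + t <= sqrt 3 * |(1, s, t)|] for the Euclidean norm. *)
Lemma kappa_decay a b (s t : nat) : s%:R <= `|a| -> t%:R <= `|b| ->
  kappa a b <= 45 / (1 + s + t)%:R ^+ 4.
Proof.
move=> sa tb; apply: le_trans (kappa_le a b) _.
rewrite !natrD; set u := 1 + s%:R + t%:R.
have u1 : 1 <= u by rewrite /u -addrA lerDl addr_ge0.
have uq : u ^+ 2 <= 3 * q a b.
  have sa2 : s%:R ^+ 2 <= a ^+ 2 :> R by rewrite -(real_normK (num_real a)) lerXn2r ?nnegrE.
  have tb2 : t%:R ^+ 2 <= b ^+ 2 :> R by rewrite -(real_normK (num_real b)) lerXn2r ?nnegrE.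
  rewrite /u /q; move: (s%:R) (t%:R) sa2 tb2 => x y.
  have := sqr_ge0 (x - y); have := sqr_ge0 (x - 1); have := sqr_ge0 (y - 1); nra.
have q1 := q_ge1 a b.
rewrite ler_pdivlMr ?exprn_gt0//; last lra.
rewrite mulrAC ler_pdivrMr ?exprn_gt0//; last lra.
rewrite -[u ^+ 4]/(u ^+ (2 * 2)) exprM.
have : (u ^+ 2) ^+ 2 <= (3 * q a b) ^+ 2 by rewrite lerXn2r ?nnegrE ?sqr_ge0//; lra.
rewrite exprMn; lra.
Qed.

Lemma sum_inv_cube (n a : nat) : (0 < a)%N ->
  \sum_(j < n) ((a + j)%:R ^+ 3)^-1 <= 2 / a%:R ^+ 2 :> R.
Proof.
move=> a0.
suff H : \sum_(j < n) ((a + j)%:R ^+ 3)^-1 <= 2 / a%:R ^+ 2 - 2 / (a + n)%:R ^+ 2 :> R.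
  by apply: le_trans H _; rewrite lerBlDr lerDl divr_ge0 ?exprn_ge0.
elim: n => [|n IH]; first by rewrite big_ord0 addn0 subrr.
rewrite big_ord_recr/=; apply: le_trans (lerD IH (lexx _)) _.
have : 1 <= (a + n)%:R :> R by rewrite ler1n addn_gt0 a0.
rewrite addnS -[(a + n).+1%:R]natr1; set s := (a + n)%:R => s1.
have : s ^-3 <= 2 / s ^+ 2 - 2 / (s + 1) ^+ 2.
  rewrite -subr_ge0.
  have -> : 2 / s ^+ 2 - 2 / (s + 1) ^+ 2 - s ^-3 =
     (s * (2 * s + 1) * 2 - (s + 1) ^+ 2) / (s ^+ 3 * (s + 1) ^+ 2).
    by field; rewrite !gt_eqF//; lra.
  by rewrite divr_ge0// ?mulr_ge0 ?exprn_ge0//; nra.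
lra.
Qed.

Lemma sum_inv_square (n : nat) : \sum_(k < n) 2 / k.+1%:R ^+ 2 <= 4 :> R.
Proof.
suff H : \sum_(k < n) 2 / k.+1%:R ^+ 2 <= 4 - 4 / n.+1%:R :> R.
  by apply: le_trans H _; rewrite lerBlDr lerDl divr_ge0.
elim: n => [|n IH]; first by rewrite big_ord0 divr1; lra.
rewrite big_ord_recr/=; apply: le_trans (lerD IH (lexx _)) _.
have : 1 <= n.+1%:R :> R by rewrite ler1n.
rewrite -[n.+2%:R]natr1; set s := n.+1%:R => s1.
rewrite -subr_ge0.
have -> : 4 - 4 / (s + 1) - (4 - 4 / s + 2 / s ^+ 2) =
    2 * (s - 1) / (s ^+ 2 * (s + 1)).
  by field; rewrite !gt_eqF//; lra.
by rewrite divr_ge0// ?mulr_ge0 ?exprn_ge0//; lra.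
Qed.

End logarithmic_kernel.

Definition dn (i j : nat) : nat := (i - j) + (j - i).

Section green_log.
Context {R : realType} {N : nat}.
Implicit Types (x y z w : V N).

Definition l1 y z : nat := dn y.1 z.1 + dn y.2 z.2.

Lemma ptE (i j : nat) : (i <= N)%N -> (j <= N)%N ->
  ((pt i j : V N).1 = i :> nat) * ((pt i j : V N).2 = j :> nat).
Proof. by move=> hi hj; split; rewrite inordK. Qed.

Lemma eq_site y z : y.1 = z.1 :> nat -> y.2 = z.2 :> nat -> y = z.
Proof. by case: y z => ? ? [? ?] /= /val_inj -> /val_inj ->. Qed.

Variable D : pred (V N).
Hypothesis Dinner : forall x, D x -> inner x.
Local Notation gr := (@gr R N D).
Local Notation ext := (@ext R N D).

Lemma gr_lipschitz x y z : `|gr x y - gr x z| <= 4 * (l1 y z)%:R.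
Proof.
move nE : (l1 y z) => n; elim: n => [|n IH] in y z nE *.
  rewrite (@eq_site y z) ?subrr ?normr0 ?mulr0//; move: nE; rewrite /l1 /dn; lia.
have [y' yy' y'z] : exists2 y', adj y y' & l1 y' z = n.
  have := ltn_ord y.1; have := ltn_ord y.2; have := ltn_ord z.1; have := ltn_ord z.2.
  move: nE; rewrite /l1 /dn => nE h1 h2 h3 h4.
  have [lt1|ge1] := ltnP y.1 z.1.
    by exists (pt y.1.+1 y.2); rewrite /adj /l1 /dn ?ptE//; lia.
  have [lt2|ge2] := ltnP z.1 y.1.
    by exists (pt y.1.-1 y.2); rewrite /adj /l1 /dn ?ptE//; lia.
  have [lt3|ge3] := ltnP y.2 z.2.
    by exists (pt y.1 y.2.+1); rewrite /adj /l1 /dn ?ptE//; lia.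
  by exists (pt y.1 y.2.-1); rewrite /adj /l1 /dn ?ptE//; lia.
have -> : gr x y - gr x z = (gr x y - gr x y') + (gr x y' - gr x z) by ring.
apply: le_trans (ler_normD _ _) _.
have := @abs_flow R _ _ Dinner x _ _ yy'; have := IH _ _ y'z.
by rewrite -[n.+1%:R]natr1; lra.
Qed.

Lemma gr_le_boundary x y z : ~~ inner z -> gr x y <= 4 * (l1 y z)%:R.
Proof.
move=> zN; have := gr_lipschitz x y z.
rewrite (gr_outr Dinner x (y := z)) ?subr0; last first.
  by apply: contraNN zN => /Dinner.
exact/le_trans/ler_norm.
Qed.

Lemma lg_drop (a b : int) x : inner x ->
  let f z := lg ((z.1 : nat)%:R - a%:~R) ((z.2 : nat)%:R - b%:~R) in
  avg f x - f x = kappa ((x.1 : nat)%:R - a%:~R) ((x.2 : nat)%:R - b%:~R) :> R.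
Proof.
move=> xi f; rewrite /avg sum_adj// /kappa -/(f x); congr (4^-1 * _ - _).
have [h1 h2] := (ltn_ord x.1, ltn_ord x.2).
move/and4P: xi => [x1 x1N x2 x2N].
rewrite /f !ptE; [|lia..].
have S (n : nat) (c : R) : n.+1%:R - c = n%:R - c + 1 by rewrite -natr1; ring.
have P (n : nat) (c : R) : (0 < n)%N -> n.-1%:R - c = n%:R - c - 1.
  by case: n => //= n _; rewrite S; ring.
by rewrite !S !P.
Qed.

Definition lgat (a b : int) z : R :=
  lg ((z.1 : nat)%:R - a%:~R) ((z.2 : nat)%:R - b%:~R).

Lemma dynkin_lg a b x : ext (lgat a b) x = lgat a b x + \sum_z gr x z *
  kappa ((z.1 : nat)%:R - a%:~R) ((z.2 : nat)%:R - b%:~R).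
Proof.
rewrite (dynkin_formula Dinner); congr (_ + _); apply: eq_bigr => z _.
have [Dz|Dz] := boolP (D z); last by rewrite gr_outr// !mul0r.
by rewrite (lg_drop a b)// Dinner.
Qed.

(** The window contains the difference of any two sites. The value depends on N but stays above
    [kappa 0 0]. *)
Definition mass : R := \sum_(k < N.*2.+1) \sum_(l < N.*2.+1)
  kappa ((k : nat)%:R - N%:R) ((l : nat)%:R - N%:R).

Lemma mass_ge : kappa 0 0 <= mass.
Proof.
have hN : (N < N.*2.+1)%N by lia.
rewrite /mass (bigD1 (Ordinal hN))//= (bigD1 (Ordinal hN))//= !subrr -addrA lerDl.
by rewrite addr_ge0// sumr_ge0// => k _; rewrite ?sumr_ge0// => *; exact: kappa_ge0.
Qed.

Lemma sum_dist_le (F : nat -> R) : (forall k, 0 <= F k) ->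
  \sum_(k < N.*2.+1) F (dn k N) <= 2 * \sum_(k < N.+1) F k.
Proof.
move=> F0.
rewrite -(big_mkord xpredT (fun k => F (dn k N))) (@big_cat_nat _ _ _ N)//=; last by lia.
have -> : \sum_(0 <= i < N) F (dn i N) = \sum_(0 <= i < N) F i.+1.
  rewrite big_nat_rev/= !big_nat; apply: eq_bigr => i /andP[_ iN].
  by congr F; rewrite /dn; lia.
have -> : \sum_(N <= i < N.*2.+1) F (dn i N) = \sum_(0 <= i < N.+1) F i.
  rewrite -[X in \sum_(X <= _ < _) _]add0n big_addn.
  have -> : (N.*2.+1 - N = N.+1)%N by lia.
  by apply: eq_bigr => i _; congr F; rewrite /dn; lia.
rewrite -(big_mkord xpredT F) big_nat_recl// mulr_natl mulr2n lerD2r lerDr//.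
Qed.

(** 2880 = 45 * 4 * 16: the decay of [kappa], the Lipschitz constant of the Green function, and a
    bound for the sum of (1 + |k| + |l|)^-3. *)
Lemma sum_decay : \sum_(k < N.*2.+1) \sum_(l < N.*2.+1)
   45 / (1 + dn k N + dn l N)%:R ^+ 4 * (4 * (dn k N + dn l N)%:R) <= 2880 :> R.
Proof.
have -> : (2880 : R) = 180 * 16 by ring.
apply: (@le_trans _ _ (\sum_(k < N.*2.+1) \sum_(l < N.*2.+1)
   180 * ((1 + dn k N + dn l N)%:R ^+ 3)^-1)).
  apply: ler_sum => k _; apply: ler_sum => l _.
  rewrite -[(1 + _ + _)%N]addnA [(1 + (_ + _))%N]addnC natrD; set s := (dn k N + dn l N)%:R.
  have s0 : 0 <= s by exact: ler0n.
  have -> : 45 / (s + 1) ^+ 4 * (4 * s) = 180 * (s + 1) ^- 3 * (s / (s + 1)).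
    by field; rewrite gt_eqF//; lra.
  rewrite ler_piMr ?mulr_ge0 ?invr_ge0 ?exprn_ge0//; [lra|].
  rewrite ler_pdivrMr; lra.
under eq_bigr do rewrite -mulr_sumr.
rewrite -mulr_sumr ler_pM2l//.
apply: (@le_trans _ _ (\sum_(k < N.*2.+1) 4 / (1 + dn k N)%:R ^+ 2)).
  apply: ler_sum => k _.
  apply: le_trans (sum_dist_le (F := fun l => ((1 + dn k N + l)%:R ^+ 3)^-1) _) _.
    by move=> j; rewrite invr_ge0 exprn_ge0.
  have := @sum_inv_cube R N.+1 (1 + dn k N)%N isT; lra.
apply: le_trans (sum_dist_le (F := fun l => 4 / (1 + l)%:R ^+ 2) _) _.
  by move=> j; rewrite divr_ge0 ?exprn_ge0.
have -> : (16 : R) = 2 * (2 * 4) by ring.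
rewrite ler_pM2l//.
have -> : \sum_(k < N.+1) 4 / (1 + k)%:R ^+ 2 =
    2 * \sum_(k < N.+1) 2 / k.+1%:R ^+ 2 :> R.
  by rewrite mulr_sumr; apply: eq_bigr => k _; rewrite mulrA -natrM.
by rewrite ler_pM2l// sum_inv_square.
Qed.

(** Recentring at y puts the pole in the middle of a window that does not depend on y, so that the
    sum can be compared with [mass] term by term. *)
Lemma sum_box y (G : V N -> R) : \sum_z G z =
  \sum_(k < N.*2.+1) \sum_(l < N.*2.+1)
   if [&& (N <= k + y.1)%N, (k + y.1 <= N.*2)%N, (N <= l + y.2)%N & (l + y.2 <= N.*2)%N]
   then G (pt (k + y.1 - N) (l + y.2 - N)) else 0.
Proof.
case: y => -[y1 hy1] [y2 hy2] /=.
rewrite pair_big/= -big_mkcond/=.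
rewrite (reindex_onto (fun p : 'I_N.*2.+1 * 'I_N.*2.+1 =>
      pt (p.1 + y1 - N) (p.2 + y2 - N) : V N)
   (fun z : V N => (inord (z.1 + N - y1), inord (z.2 + N - y2)))) /=; last first.
  case=> -[z1 h1] [z2 h2] _ /=; rewrite !inordK; [|lia..].
  by apply: eq_site; rewrite ptE /=; lia.
apply: eq_bigl => -[[k hk] [l hl]] /=.
rewrite xpair_eqE -!val_eqE /=.
have E (i u : nat) : (i < N.+1)%N -> (u < N.*2.+1)%N ->
   ((inord ((inord (u + i - N) : 'I_N.+1) + N - i) : 'I_N.*2.+1) == u :> nat) =
   (N <= u + i)%N && (u + i <= N.*2)%N.
  move=> hi hu.
  have [h|h] := ltnP (u + i - N) N.+1.
    by rewrite !(@inordK N)// inordK; lia.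
  (* Out of range, [inord] returns 0; the round trip then gives N - i, which differs from u. *)
  rewrite [inord (u + i - N)]/inord /insubd insubN -?leqNgt//=.
  by rewrite inordK; lia.
by rewrite !E// -andbA.
Qed.

(** In Dynkin's formula the Laplacian of the logarithm is concentrated near its pole y, and the
    Lipschitz bound pays for replacing gr x z by gr x y. A displacement of y that leaves V_N is
    longer than the distance from y to a side, where gr x vanishes, so the same bound controls gr x
    y itself. *)
Lemma green_log x y : `|ext (lgat (Posz y.1) (Posz y.2)) x -
  lgat (Posz y.1) (Posz y.2) x - mass * gr x y| <= 2880.
Proof.
set a := Posz y.1; set b := Posz y.2; rewrite dynkin_lg [_ + _ - lgat a b x]addrAC subrr add0r.
rewrite (sum_box y) /mass mulr_suml -sumrB.
under eq_bigr => k _ do rewrite mulr_suml -sumrB.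
apply: le_trans (ler_norm_sum _ _ _) _.
apply: le_trans _ sum_decay; apply: ler_sum => k _.
apply: le_trans (ler_norm_sum _ _ _) _; apply: ler_sum => l _.
have [y1 y2 hk hl] := And4 (ltn_ord y.1) (ltn_ord y.2) (ltn_ord k) (ltn_ord l).
have dE (u : nat) : (u%:R - N%:R : R) = 
    if (N <= u)%N then (dn u N)%:R else - (dn u N)%:R.
  case: leqP => h; first by rewrite -natrB//; congr _%:R; rewrite /dn; lia.
  by rewrite -opprB -natrB ?(ltnW h)//; congr (- _%:R); rewrite /dn; lia.
have kap : kappa ((k : nat)%:R - N%:R) ((l : nat)%:R - N%:R) <=
    45 / (1 + dn k N + dn l N)%:R ^+ 4 :> R.
  by apply: kappa_decay; rewrite dE; case: ifP; rewrite ?normrN normr_nat.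
have kap0 := kappa_ge0 ((k : nat)%:R - N%:R : R) ((l : nat)%:R - N%:R).
case: ifPn => [/and4P[k1 k2 l1' l2]|out].
  rewrite !ptE; [|lia..].
  have -> : (k + y.1 - N)%:R - a%:~R = k%:R - N%:R :> R.
    by rewrite natrB ?natrD//; rewrite /a /=; ring.
  have -> : (l + y.2 - N)%:R - b%:~R = l%:R - N%:R :> R.
    by rewrite natrB ?natrD//; rewrite /b /=; ring.
  rewrite mulrC -mulrBr normrM ger0_norm// ler_pM//.
  apply: le_trans (gr_lipschitz _ _ _) _; rewrite ler_pM2l// ler_nat.
  by rewrite /l1 !ptE; [rewrite /dn; lia|lia..].
rewrite sub0r normrN normrM ger0_norm// ler_pM//.
rewrite ger0_norm ?gr_ge0//.
have B z : ~~ inner z -> (l1 y z <= dn k N + dn l N)%N ->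
    gr x y <= 4 * (dn k N + dn l N)%:R.
  move=> zi le; apply: le_trans (gr_le_boundary x y zi) _.
  by rewrite ler_pM2l// ler_nat.
have [h|h1] := ltnP (k + y.1) N.
  by apply: (B (pt 0 y.2)); rewrite /inner /l1 ?ptE ?ltnS//; rewrite /dn; lia.
have [h|h2] := ltnP (N.*2) (k + y.1).
  by apply: (B (pt N y.2)); rewrite /inner /l1 ?ptE ?ltnS//; rewrite /dn; lia.
have [h|h3] := ltnP (l + y.2) N.
  by apply: (B (pt y.1 0)); rewrite /inner /l1 ?ptE ?ltnS//; rewrite /dn; lia.
by apply: (B (pt y.1 N)); rewrite /inner /l1 ?ptE ?ltnS//; rewrite /dn; lia.
Qed.

(* The pole (a, b) lies behind the boundary point y, so it is not seen by the
   Green function and the logarithm is nearly harmonic. *)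
Lemma green_log_outside x (a b : int) y : ~~ inner y ->
  (forall z, (dn z.1 y.1)%:R <= `|(z.1 : nat)%:R - a%:~R : R| ) ->
  (forall z, (dn z.2 y.2)%:R <= `|(z.2 : nat)%:R - b%:~R : R| ) ->
  ext (lgat a b) x <= lgat a b x + 2880.
Proof.
move=> yi ya yb; rewrite dynkin_lg lerD2l.
rewrite (sum_box y); apply: le_trans _ sum_decay.
have [y1 y2] := (ltn_ord y.1, ltn_ord y.2).
apply: ler_sum => k _; apply: ler_sum => l _.
have [hk hl] := (ltn_ord k, ltn_ord l).
case: ifPn => [/and4P[k1 k2 l1' l2]|_]; last first.
  by rewrite mulr_ge0// divr_ge0// exprn_ge0.
rewrite mulrC ler_pM ?kappa_ge0 ?gr_ge0//.
  set z := pt _ _.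
  apply: le_trans (kappa_decay (s := dn z.1 y.1) (t := dn z.2 y.2) _ _) _ => //.
  by rewrite /z !ptE; [rewrite /dn|lia..]; rewrite le_eqVlt; apply/orP; left; apply/eqP;
    congr (45 / _ %:R ^+ 4); lia.
apply: le_trans (gr_le_boundary x _ yi) _; rewrite ler_pM2l// ler_nat.
by rewrite /l1 !ptE; [rewrite /dn; lia|lia..].
Qed.

End green_log.

Arguments mass : clear implicits.

(** * Harmonic averages of the logarithm over boxes *)

Section log_distance.
Context {R : realType}.

(** The factor 2 matches [lg], the logarithm of a squared distance. *)
Definition ell (n : nat) : R := 2 * ln n%:R.

Lemma ler_ell m n : (0 < m)%N -> (m <= n)%N -> ell m <= ell n.
Proof.
move=> m0 mn; have n0 : (0 < n)%N by lia.
by rewrite /ell ler_pM2l// ler_ln ?posrE ?ltr0n// ler_nat.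
Qed.

Lemma ellM m n : (0 < m)%N -> (0 < n)%N -> ell (m * n) = ell m + ell n.
Proof. by move=> *; rewrite /ell natrM lnM ?posrE ?ltr0n// mulrDr. Qed.

Lemma ell_le_lin n : ell n <= 2 * n%:R.
Proof.
case: n => [|n]; first by rewrite /ell ln0// mulr0.
have : ln (1 + n%:R) <= n%:R :> R by apply: le_ln1Dx; have := ler0n R n; lra.
by rewrite /ell [1 + _]addrC natr1; have : n%:R <= n.+1%:R :> R by [rewrite ler_nat]; lra.
Qed.

(** Lengths comparable up to a factor k have [ell] equal up to a constant; [ell k] is bounded
    crudely by 2k. *)
Lemma ler_ellM k m n : (0 < k)%N -> (0 < m)%N -> (0 < n)%N -> (m <= k * n)%N ->
  ell m <= ell n + 2 * k%:R.
Proof.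
move=> k0 m0 n0 mn; apply: le_trans (ler_ell m0 mn) _.
by rewrite ellM// addrC lerD2l ell_le_lin.
Qed.

Lemma ell_le_lg n (a b : R) : (0 < n)%N -> n%:R <= `|a| \/ n%:R <= `|b| ->
  ell n <= lg a b.
Proof.
move=> n0 H; rewrite /ell /lg.
have n1 : 0 < n%:R :> R by rewrite ltr0n.
rewrite mulr_natl -lnXn// ler_ln ?posrE ?exprn_gt0//; last first.
  by have := sqr_ge0 a; have := sqr_ge0 b; lra.
have := sqr_ge0 a; have := sqr_ge0 b.
have sq (x : R) : n%:R <= `|x| -> n%:R ^+ 2 <= x ^+ 2.
  by move=> h; rewrite -(real_normK (num_real x)) lerXn2r ?nnegrE.
by case: H => /sq; lra.
Qed.

Lemma lg_le_ell n (a b : R) : (0 < n)%N -> `|a| <= n%:R -> `|b| <= n%:R ->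
  lg a b <= ell n + 2.
Proof.
move=> n0 ha hb; have n1 : 1 <= n%:R :> R by rewrite ler1n.
have -> : ell n = ln (n%:R ^+ 2) by rewrite /ell mulr_natl -lnXn//; lra.
have ln3 : ln (3 : R) <= 2.
  by have : ln (1 + 2) <= 2 :> R by [apply: le_ln1Dx; lra]; rewrite (_ : 1 + 2 = 3 :> R)//; ring.
apply: le_trans (_ : ln (n%:R ^+ 2 * 3) <= _); last first.
  by rewrite lnM ?posrE ?exprn_gt0// ?lerD2l//; lra.
have H (x : R) : `|x| <= n%:R -> x ^+ 2 <= n%:R ^+ 2.
  by move=> hx; rewrite -(real_normK (num_real x)) lerXn2r ?nnegrE.
have := H _ ha; have := H _ hb; have n2 : 1 <= n%:R ^+ 2 :> R by rewrite exprn_ege1.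
rewrite /lg => h1 h2.
have q0 : 0 < 1 + a ^+ 2 + b ^+ 2 by have := sqr_ge0 a; have := sqr_ge0 b; lra.
by rewrite ler_ln ?posrE//; lra.
Qed.

End log_distance.

Lemma dnE (i j : nat) : dn i j = absz (Posz i - Posz j).
Proof. by rewrite /dn; lia. Qed.

(** The coordinates -r and n + r, at distance r beyond the ends of [0, n], will carry the poles
    behind the sides of the box: they are at distance at least r from every site, and at most 2r
    from a site within r of that end. *)
Lemma dn_left (i j r : nat) : (j <= r)%N -> (dn i j <= absz (Posz i - (- Posz r)))%N.
Proof. by rewrite /dn; lia. Qed.

Lemma dn_right (n i j r : nat) : (i < n.+1)%N -> (j <= n)%N -> (n - j <= r)%N ->
  (dn i j <= absz (Posz i - Posz (n + r)))%N.
Proof. by rewrite /dn; lia. Qed.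

Lemma far_left (i r : nat) : (r <= absz (Posz i - (- Posz r)))%N.
Proof. by lia. Qed.

Lemma far_right (n i r : nat) : (i < n.+1)%N -> (r <= absz (Posz i - Posz (n + r)))%N.
Proof. by lia. Qed.

Lemma close_left (i r : nat) : (i <= r)%N -> (absz (Posz i - (- Posz r)) <= 2 * r)%N.
Proof. by lia. Qed.

Lemma close_right (n i r : nat) : (i <= n)%N -> (n - i <= r)%N ->
  (absz (Posz i - Posz (n + r)) <= 2 * r)%N.
Proof. by lia. Qed.

Section geometry.
Context {R : realType} {N : nat}.
Implicit Types (v x y z w : V N) (s r : nat).

Definition linf x y : nat := maxn (dn x.1 y.1) (dn x.2 y.2).

Definition depth x : nat := minn (minn x.1 (N - x.1)) (minn x.2 (N - x.2)).

(** The interior of the box of radius s around v cut off by V_N. It is empty for s = 0, where [ext]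
    is evaluation. *)
Definition dom v (s : nat) x : bool := inner x && (linf x v < s)%N.

(** The distance from v to the sites outside [dom v s], raised to at least 1 for the logarithm. *)
Definition rad v (s : nat) : nat := maxn 1 (minn s (depth v)).

Lemma dom_inner v s x : dom v s x -> inner x. Proof. by case/andP. Qed.

Lemma linfC x y : linf x y = linf y x.
Proof. by rewrite /linf /dn; congr maxn; rewrite addnC. Qed.

Lemma linf_triangle x y z : (linf x z <= linf x y + linf y z)%N.
Proof.
rewrite /linf geq_max; apply/andP; split.
  by apply: leq_trans (leq_add (leq_maxl _ _) (leq_maxl _ _)); rewrite /dn; lia.
by apply: leq_trans (leq_add (leq_maxr _ _) (leq_maxr _ _)); rewrite /dn; lia.
Qed.

Lemma depth_lipschitz x y : (depth x <= depth y + linf x y)%N.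
Proof.
have H a b c d e : (a <= c + e -> b <= d + e -> minn a b <= minn c d + e)%N by lia.
rewrite /depth; apply: (H) => //; apply: (H) => //.
- by apply: leq_trans (leq_add (leqnn _) (leq_maxl _ _)); rewrite /dn; lia.
- by apply: leq_trans (leq_add (leqnn _) (leq_maxl _ _)); rewrite /dn; lia.
- by apply: leq_trans (leq_add (leqnn _) (leq_maxr _ _)); rewrite /dn; lia.
- by apply: leq_trans (leq_add (leqnn _) (leq_maxr _ _)); rewrite /dn; lia.
Qed.

Lemma depth_not_inner x y : ~~ inner y -> (depth x <= linf x y)%N.
Proof.
have [y1 y2] := (ltn_ord y.1, ltn_ord y.2).
rewrite /depth /linf /inner leq_max !geq_min !negb_and -!leqNgt.
by case/or4P => h; apply/orP; [left|left|right|right]; rewrite -!orbA; apply/or4P;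
  [apply: Or41|apply: Or42|apply: Or43|apply: Or44]; rewrite /dn; lia.
Qed.

Definition lgd x y : R := lgat (Posz y.1) (Posz y.2) x.

Lemma abs_coord (n : nat) (a : int) : `|n%:R - a%:~R : R| = (absz (Posz n - a))%:R.
Proof. by rewrite -[n%:R]/((Posz n)%:~R) -rmorphB /= -intr_norm -abszE. Qed.

Lemma lgdC x y : lgd x y = lgd y x.
Proof.
by rewrite /lgd /lgat /lg /= -(sqrrN (_ - _)) opprB -(sqrrN (x.2%:R - _)) opprB.
Qed.

Lemma lgd_ge x y : ell (maxn 1 (linf x y)) <= lgd x y.
Proof.
have [xy|] := leqP (linf x y) 0.
  have -> : maxn 1 (linf x y) = 1%N by lia.
  rewrite /ell ln1 mulr0 ln_ge0// -addrA lerDl addr_ge0// sqr_ge0//.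
move=> l0; rewrite (maxn_idPr l0); apply: ell_le_lg => //.
by rewrite !abs_coord !ler_nat -!dnE; apply/orP; rewrite -leq_max.
Qed.

Lemma lgd_le x y : lgd x y <= ell (maxn 1 (linf x y)) + 2.
Proof.
by apply: lg_le_ell; rewrite ?abs_coord ?ler_nat -?dnE !leq_max leqnn ?orbT.
Qed.

(** If y is at distance at least half of [rad v s] from v, the logarithm is already large at v and
    averaging loses at most 2880, the Green term having the right sign. Otherwise all exit sites are
    at distance of order [rad v s] from y. The constant covers 2880 + 4 in the first case and 8 in
    the second. *)
Lemma lgd_lower v s y :
  ell (maxn (linf v y) (rad v s)) - 2888 <= ext (dom v s) (lgd^~ y) v.
Proof.
have Di := @dom_inner v s.
have [h|h] := leqP (rad v s) (2 * linf v y).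
  have := green_log (R := R) Di v y; rewrite -/(lgd v y) ler_norml => /andP[+ _].
  have := @mass_ge R N; have := @kappa00_gt0 R => k0 m0.
  have : 0 <= mass R N * gr (dom v s) v y :> R.
    by rewrite mulr_ge0 ?gr_ge0//; lra.
  have := lgd_ge v y.
  have : ell (maxn (linf v y) (rad v s)) <= ell (maxn 1 (linf v y)) + 2 * 2%:R :> R.
    by apply: ler_ellM; rewrite /rad in h *; lia.
  rewrite -/(lgd^~ y); lra.
have -> : maxn (linf v y) (rad v s) = rad v s by lia.
rewrite -[leLHS](ext_cst Di _ v); apply: ler_ext => // w hw.
have Dw : ~~ dom v s w by apply: contraNN hw => Dw; rewrite harm_in.
apply: le_trans (lgd_ge w y).
suff : ell (rad v s) <= ell (maxn 1 (linf w y)) + 2 * 4%:R :> R by lra.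
apply: ler_ellM => //; [by rewrite /rad; lia|by lia|].
move: Dw; rewrite /dom negb_and -leqNgt => /orP[/(depth_not_inner v) Dw|Dw].
  by have := linf_triangle v y w; rewrite (linfC y w); rewrite /rad in h *; lia.
by have := linf_triangle w y v; rewrite (linfC y v); rewrite /rad in h *; lia.
Qed.

(** The logarithm with pole (a, b) behind the side through y dominates [ell (maxn r (linf w v))] up
    to 4 and is nearly harmonic in V_N, so its average is controlled by its value at v', at most ell
    r + 6. Hence 2890 = 2880 + 6 + 4. *)
Lemma log_upper_outside v' v s (a b : int) y (r : nat) : ~~ inner y ->
  (0 < r)%N -> (linf v' v <= r)%N ->
  (forall z, (dn z.1 y.1 <= absz (Posz z.1 - a))%N) ->
  (forall z, (dn z.2 y.2 <= absz (Posz z.2 - b))%N) ->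
  (absz (Posz v'.1 - a) <= 2 * r)%N -> (absz (Posz v'.2 - b) <= 2 * r)%N ->
  (forall w, (dn w.1 v'.1 <= absz (Posz w.1 - a))%N) ->
  (forall w, (dn w.2 v'.2 <= absz (Posz w.2 - b))%N) ->
  (forall w, (r <= absz (Posz w.1 - a))%N || (r <= absz (Posz w.2 - b))%N) ->
  ext (dom v' s) (fun w => ell (maxn r (linf w v))) v' <= ell r + 2890 :> R.
Proof.
move=> yi r0 rv ya yb va vb wa wb far; have Di := @dom_inner v' s.
have H : ext (dom v' s) (lgat a b) v' <= lgat a b v' + 2880 :> R.
  by apply: (@green_log_outside R N _ Di v' a b y) => // z; rewrite abs_coord ler_nat.
have lv : lgat a b v' <= ell r + 6 :> R.
  have : lgat a b v' <= ell (2 * r) + 2 :> R.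
    by apply: lg_le_ell; rewrite ?abs_coord ?ler_nat//; lia.
  by rewrite ellM//; have := ell_le_lin (R := R) 2; lra.
suff : ext (dom v' s) (fun w => ell (maxn r (linf w v))) v' <=
       ext (dom v' s) (fun w => lgat a b w + 4) v' :> R.
  by rewrite extD (ext_cst Di); lra.
apply: ler_ext => // w _; set m := maxn (absz (Posz w.1 - a)) (absz (Posz w.2 - b)).
have rm : (r <= m)%N by rewrite leq_max far.
have wm : (linf w v' <= m)%N.
  by rewrite geq_max !leq_max wa wb orbT.
have fw : (maxn r (linf w v) <= 2 * m)%N.
  by have := linf_triangle w v' v; lia.
have m0 : (0 < m)%N by lia.
have : ell m <= lgat a b w :> R.
  apply: ell_le_lg => //; rewrite !abs_coord !ler_nat.
  by apply/orP; rewrite -leq_max.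
have := ler_ellM (R := R) (k := 2) isT (leq_trans r0 (leq_maxl _ _)) m0 fw.
lra.
Qed.

(** If v' is within r of one of the four sides, the walk may stop far away along that side, and the
    pole is put at distance r behind it. Otherwise s <= r, the walk stops within r of v' by
    [harm_support], and the integrand is bounded at all exit sites. *)
Lemma log_upper v' v s (r : nat) : (rad v' s <= r)%N -> (linf v' v <= r)%N ->
  ext (dom v' s) (fun w => ell (maxn r (linf w v))) v' <= ell r + 2890 :> R.
Proof.
move=> rr rv; have r0 : (0 < r)%N by rewrite /rad in rr; lia.
have Di := @dom_inner v' s.
have [dr|dr] := leqP (depth v') r.
  move: dr; rewrite /depth !geq_min -!orbA => /or4P[] h.
  - apply: (@log_upper_outside v' v s (- Posz r) (Posz v'.2) (pt 0 v'.2) r).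
    + by rewrite /inner ptE ?leq_ord.
    + exact: r0.
    + exact: rv.
    + by move=> z; rewrite ptE ?leq_ord //; exact: dn_left.
    + by move=> z; rewrite ptE ?leq_ord // dnE.
    + exact: close_left.
    + by rewrite subrr.
    + by move=> w; exact: dn_left.
    + by move=> w; rewrite dnE.
    + by move=> w; rewrite far_left.
  - apply: (@log_upper_outside v' v s (Posz (N + r)) (Posz v'.2) (pt N v'.2) r).
    + by rewrite /inner ptE ?leq_ord // ltnn andbF.
    + exact: r0.
    + exact: rv.
    + by move=> z; rewrite ptE ?leq_ord //; apply: dn_right; rewrite ?subnn.
    + by move=> z; rewrite ptE ?leq_ord // dnE.
    + by apply: close_right; rewrite ?leq_ord.
    + by rewrite subrr.
    + by move=> w; apply: dn_right; rewrite ?leq_ord.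
    + by move=> w; rewrite dnE.
    + by move=> w; rewrite far_right.
  - apply: (@log_upper_outside v' v s (Posz v'.1) (- Posz r) (pt v'.1 0) r).
    + by rewrite /inner !ptE ?leq_ord //= ?andbF.
    + exact: r0.
    + exact: rv.
    + by move=> z; rewrite ptE ?leq_ord // dnE.
    + by move=> z; rewrite ptE ?leq_ord //; exact: dn_left.
    + by rewrite subrr.
    + exact: close_left.
    + by move=> w; rewrite dnE.
    + by move=> w; exact: dn_left.
    + by move=> w; rewrite far_left orbT.
  - apply: (@log_upper_outside v' v s (Posz v'.1) (Posz (N + r)) (pt v'.1 N) r).
    + by rewrite /inner !ptE ?leq_ord // ltnn !andbF.
    + exact: r0.
    + exact: rv.
    + by move=> z; rewrite ptE ?leq_ord // dnE.
    + by move=> z; rewrite ptE ?leq_ord //; apply: dn_right; rewrite ?subnn.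
    + by rewrite subrr.
    + by apply: close_right; rewrite ?leq_ord.
    + by move=> w; rewrite dnE.
    + by move=> w; apply: dn_right; rewrite ?leq_ord.
    + by move=> w; rewrite far_right ?orbT.
have sr : (s <= r)%N by rewrite /rad in rr; lia.
rewrite -[leRHS](ext_cst Di _ v'); apply: ler_ext => // w hw.
have ws : (linf w v' <= r)%N.
  have [->|vw] := eqVneq w v'; first by rewrite /linf /dn !subnn.
  rewrite leqNgt; apply: contraNN hw => ws; apply/eqP/(harm_support Di).
    by rewrite eq_sym.
  move=> z /andP[_ zs]; apply/negP => zw.
  have : (linf w z <= 1)%N.
    rewrite geq_max /dn; move: zw; rewrite /adj.
    by move: (nat_of_ord _) (nat_of_ord _) (nat_of_ord _) (nat_of_ord _) => *; lia.
  by have := linf_triangle w z v'; lia.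
have wv : (linf w v <= 2 * r)%N by have := linf_triangle w v' v; lia.
apply: le_trans (ler_ellM (k := 2) (n := r) _ _ _ _) _ => //; [by lia|by lia|].
by rewrite lerD2l; lra.
Qed.

End geometry.

(** * Approximate ultrametricity of the field covariances *)

Section covariances.
Context {R : realType} {N : nat}.
Implicit Types (v x y z w : V N) (D : pred (V N)) (s : nat).

Lemma ext_exchange D D' (F : V N -> V N -> R) v v' :
  ext D (fun x => ext D' (F x) v') v = ext D' (fun y => ext D (F^~ y) v) v'.
Proof.
rewrite /ext.
under eq_bigr do rewrite mulr_sumr.
rewrite exchange_big/=; apply: eq_bigr => y _.
by rewrite mulr_sumr; apply: eq_bigr => x _; rewrite mulrCA.
Qed.

Lemma eq_ext D (b b' : V N -> R) x : b =1 b' -> ext D b x = ext D b' x.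
Proof. by move=> bb; apply: eq_bigr => w _; rewrite bb. Qed.

Definition lgcov v s v' s' : R := ext (dom v s) (fun x => ext (dom v' s') (lgd x) v') v.

(** The only length that the logarithm sees, up to a constant, once it is averaged over both exit
    distributions. *)
Definition cscale v s v' s' : nat := maxn (linf v v') (maxn (rad v s) (rad v' s')).

(** [lgd_lower] is used once for each variable; 5780 covers 2888 + 2888 and the 2 lost between [lgd]
    and [ell]. *)
Lemma lgcov_lower v s v' s' : ell (cscale v s v' s') - 5780 <= lgcov v s v' s'.
Proof.
have Di := @dom_inner N v s.
have r0 : (0 < rad v s)%N by rewrite /rad; lia.
have r0' : (0 < rad v' s')%N by rewrite /rad; lia.
have low : ext (dom v s) (fun x => ell (maxn (linf v' x) (rad v' s')) - 2888) v
    <= lgcov v s v' s'.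
  apply: ler_ext => // x _; apply: le_trans (lgd_lower v' s' x) _.
  by rewrite le_eqVlt (eq_ext _ _ (b' := lgd x)) ?eqxx// => y; exact: lgdC.
apply: le_trans low; rewrite extB (ext_cst Di).
have [le|lt] := leqP (rad v' s') (maxn (linf v v') (rad v s)); last first.
  have -> : cscale v s v' s' = rad v' s' by rewrite /cscale; lia.
  suff : ell (rad v' s') <= ext (dom v s) (fun x => ell (maxn (linf v' x) (rad v' s'))) v :> R by lra.
  rewrite -[leLHS](ext_cst Di _ v); apply: ler_ext => // x _.
  by apply: ler_ell; lia.
have -> : cscale v s v' s' = maxn (linf v v') (rad v s) by rewrite /cscale; lia.
have := lgd_lower (R := R) v s v'.
suff : ext (dom v s) (fun x => lgd x v' - 2) v <=
    ext (dom v s) (fun x => ell (maxn (linf v' x) (rad v' s'))) v :> R.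
  by rewrite extB (ext_cst Di); lra.
apply: ler_ext => // x _; have := lgd_le (R := R) x v'.
have : ell (maxn 1 (linf x v')) <= ell (maxn (linf v' x) (rad v' s')) :> R.
  by apply: ler_ell; rewrite ?(linfC v'); lia.
lra.
Qed.

(** [log_upper] is used once for each variable, first with the scale seen from x; 5782 = 2890 + 2890
    + 2. *)
Lemma lgcov_upper v s v' s' : lgcov v s v' s' <= ell (cscale v s v' s') + 5782.
Proof.
have Di := @dom_inner N v s; have Di' := @dom_inner N v' s'.
have r0 : (0 < rad v s)%N by rewrite /rad; lia.
have r0' : (0 < rad v' s')%N by rewrite /rad; lia.
apply: (@le_trans _ _ (ext (dom v s) (fun x => ell (maxn (linf v' x) (rad v' s')) + 2892) v)).
  apply: ler_ext => // x _.
  have := @log_upper R N v' x s' (maxn (linf v' x) (rad v' s')) (leq_maxr _ _) (leq_maxl _ _).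
  suff : ext (dom v' s') (lgd x) v' <= ext (dom v' s')
     (fun y => ell (maxn (maxn (linf v' x) (rad v' s')) (linf y x)) + 2) v' :> R.
    by rewrite extD (ext_cst Di'); lra.
  apply: ler_ext => // y _; rewrite lgdC; apply: le_trans (lgd_le _ _) _.
  by rewrite lerD2r; apply: ler_ell; lia.
rewrite extD (ext_cst Di).
have h1 : (rad v s <= cscale v s v' s')%N by rewrite /cscale; lia.
have h2 : (linf v v' <= cscale v s v' s')%N by rewrite /cscale; lia.
have := @log_upper R N v v' s (cscale v s v' s') h1 h2.
suff : ext (dom v s) (fun x => ell (maxn (linf v' x) (rad v' s'))) v <=
   ext (dom v s) (fun x => ell (maxn (cscale v s v' s') (linf x v'))) v :> R by lra.
by apply: ler_ext => // x _; apply: ler_ell; rewrite ?(linfC v') /cscale; lia.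
Qed.

Definition cov v s v' s' : R :=
  ext (dom v s) (fun x => ext (dom v' s') (gr (@inner N) x) v') v.

Lemma covC v s v' s' : cov v s v' s' = cov v' s' v s.
Proof.
rewrite /cov ext_exchange; apply: eq_ext => y; apply: eq_ext => x.
by rewrite gr_sym.
Qed.

(* [covbase] does not depend on the first cscale, so it cancels in increments. *)
Definition covbase v v' s' : R :=
  ext (dom v' s') (fun y => ext (@inner N) (lgd^~ y) v) v'.

(** Average [green_log] over both exit distributions. The part that is harmonic in x on the whole
    box is unchanged by the first average, by [ext_ext], and becomes [covbase]; the rest is [lgcov].
    Hence 8662 = 2880 + 5782. *)
Lemma cov_estimate v s v' s' :
  `|mass R N * cov v s v' s' + ell (cscale v s v' s') - covbase v v' s'| <= 8662.
Proof.
have Di := @dom_inner N v s; have Di' := @dom_inner N v' s'.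
pose e x y : R := ext (@inner N) (lgd^~ y) x - lgd x y - mass R N * gr (@inner N) x y.
have eb x y : `|e x y| <= 2880 by exact: (@green_log R N (@inner N) (fun x h => h) x y).
have lin : ext (dom v s) (fun x => ext (dom v' s') (e x) v') v =
    covbase v v' s' - lgcov v s v' s' - mass R N * cov v s v' s'.
  rewrite /cov -extZ /lgcov.
  rewrite (eq_ext _ _ (b' := fun x => ext (dom v' s') (fun y => ext (@inner N) (lgd^~ y) x) v'
     - ext (dom v' s') (lgd x) v' - mass R N * ext (dom v' s') (gr (@inner N) x) v')).
    rewrite !extB; congr (_ - _ - _).
    rewrite ext_exchange; apply: eq_ext => y.
    by apply: (@ext_ext R N _ (@inner N)).
  by move=> x; rewrite -extZ -!extB.
have : `|ext (dom v s) (fun x => ext (dom v' s') (e x) v') v| <= 2880.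
  rewrite ler_norml; apply/andP; split.
    rewrite -[leLHS](ext_cst Di _ v); apply: ler_ext => // x _.
    rewrite -[leLHS](ext_cst Di' _ v'); apply: ler_ext => // y _.
    by have := eb x y; rewrite ler_norml => /andP[].
  rewrite -[leRHS](ext_cst Di _ v); apply: ler_ext => // x _.
  rewrite -[leRHS](ext_cst Di' _ v'); apply: ler_ext => // y _.
  by have := eb x y; rewrite ler_norml => /andP[].
rewrite lin !ler_norml.
by have := lgcov_lower v s v' s'; have := lgcov_upper v s v' s'; lra.
Qed.

End covariances.

(** * Covariances of increments between scales, and the ultrametric inequality *)

Section increments.
Context {R : realType} {N : nat}.
Variables (M : nat) (sigma : nat -> R) (s : nat -> nat).
Hypothesis sigma_gt0 : forall i, (i < M)%N -> 0 < sigma i.+1.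
Hypothesis s_noninc : forall i, (i < M)%N -> (s i.+1 <= s i)%N.
Implicit Types (v w : V N).

(** Applied to the covariances of the box averages, this is the covariance of an increment at one
    site with an increment at another. *)
Definition incr2 (F : nat -> nat -> R) i j : R :=
  F i.+1 j.+1 - F i j.+1 - F i.+1 j + F i j.

Definition fieldcov v w : R := \sum_(i < M) \sum_(j < M)
  sigma i.+1 * sigma j.+1 * incr2 (fun i j => cov v (s i) w (s j)) i j.

Let level v (t i : nat) : R := ell (maxn t (rad v (s i))).

(** The approximate value of [mass] times the covariance of v with a site at distance t. A scale
    contributes only if its radius exceeds t; the base point v enters through the truncation of the
    radii at the sides of V_N. *)
Definition profile v (t : nat) : R :=
  \sum_(i < M) sigma i.+1 ^+ 2 * (level v t i - level v t i.+1).

Lemma rad_gt0 v k : (0 < rad v k)%N. Proof. by rewrite /rad; lia. Qed.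

Lemma rad_noninc v i j : (i <= j)%N -> (j <= M)%N -> (rad v (s j) <= rad v (s i))%N.
Proof.
move=> ij jM; suff : (s j <= s i)%N by rewrite /rad; lia.
elim: j ij jM => [|j IH] ij jM; first by have -> : i = 0%N by lia.
have [->//|ne] := eqVneq i j.+1.
by apply: leq_trans (s_noninc jM) _; apply: IH; lia.
Qed.

(** Radii decrease along the scales, so for i <> j the larger radius is always that of the smaller
    index and the second difference vanishes: increments on different scales are nearly
    uncorrelated. The 4 in 8666 = 8662 + 4 pays for measuring both radii from v: the depth is
    Lipschitz, so the scale changes at most by a factor 2. *)
Lemma incr2_estimate v w i j : (i < M)%N -> (j < M)%N ->
  `|mass R N * incr2 (fun i j => cov v (s i) w (s j)) i j -
    (i == j)%:R * (level v (linf v w) i - level v (linf v w) i.+1)| <= 4 * 8666.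
Proof.
move=> iM jM.
pose t := linf v w.
pose F i j : R := ell (maxn t (maxn (rad v (s i)) (rad v (s j)))).
have near a b : `|F a b - ell (cscale v (s a) w (s b))| <= 4.
  have d1 := depth_lipschitz v w; have d2 := depth_lipschitz w v.
  rewrite (linfC w) -/t in d1 d2.
  have va := rad_gt0 v (s a); have vb := rad_gt0 v (s b); have wb := rad_gt0 w (s b).
  have h1 : F a b <= ell (cscale v (s a) w (s b)) + 2 * 2%:R.
    by apply: ler_ellM; rewrite /cscale -?/t; rewrite /rad in va vb wb *; lia.
  have h2 : ell (cscale v (s a) w (s b)) <= F a b + 2 * 2%:R.
    by apply: ler_ellM; rewrite /cscale -?/t; rewrite /rad in va vb wb *; lia.
  by rewrite ler_norml; lra.
have FE : incr2 F i j = - ((i == j)%:R * (level v t i - level v t i.+1)).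
  have hi := rad_noninc v (leqnSn i) iM; have hj := rad_noninc v (leqnSn j) jM.
  have Fl a b : (rad v (s b) <= rad v (s a))%N -> F a b = level v t a.
    by move=> h; rewrite /F /level; congr ell; lia.
  have Fr a b : (rad v (s a) <= rad v (s b))%N -> F a b = level v t b.
    by move=> h; rewrite /F /level; congr ell; lia.
  rewrite /incr2; case: (ltngtP i j) => ij /=.
  - have h := rad_noninc v ij (ltnW jM).
    rewrite !Fl ?mul0r//; [ring|lia..].
  - have h := rad_noninc v ij (ltnW iM).
    rewrite !Fr ?mul0r//; [ring|lia..].
  - rewrite -ij (Fl i.+1 i.+1)// (Fl i i.+1)// (Fr i.+1 i)// (Fl i i)//.
    by rewrite mul1r; ring.
rewrite -/t -[X in _ - X]opprK -FE opprK /incr2.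
have H a b := cov_estimate (R := R) v (s a) w (s b).
have := H i j; have := H i.+1 j; have := H i j.+1; have := H i.+1 j.+1.
have := near i j; have := near i.+1 j; have := near i j.+1; have := near i.+1 j.+1.
rewrite !ler_norml; lra.
Qed.

Definition error : R := 4 * 8666 * (\sum_(i < M) sigma i.+1) ^+ 2.

Lemma fieldcov_estimate v w :
  `|mass R N * fieldcov v w - profile v (linf v w)| <= error.
Proof.
have -> : profile v (linf v w) = \sum_(i < M) \sum_(j < M) sigma i.+1 * sigma j.+1 *
    ((i == j)%:R * (level v (linf v w) i - level v (linf v w) i.+1)).
  apply: eq_bigr => i _; rewrite (bigD1 i)//= eqxx mul1r -expr2.
  by rewrite big1 ?addr0// => j ji; rewrite eq_sym (negbTE ji) mul0r mulr0.
rewrite /fieldcov mulr_sumr -sumrB /error expr2 mulr_suml mulr_sumr.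
apply: le_trans (ler_norm_sum _ _ _) _; apply: ler_sum => i _.
rewrite mulr_sumr -sumrB !mulr_sumr.
apply: le_trans (ler_norm_sum _ _ _) _; apply: ler_sum => j _.
have ss : 0 <= sigma i.+1 * sigma j.+1 by rewrite mulr_ge0// ltW// sigma_gt0.
rewrite mulrCA -mulrBr normrM ger0_norm// mulrC.
exact/ler_wpM2r/incr2_estimate.
Qed.

(** For b <= a the quotient max(t, a) / max(t, b) decreases in t. *)
Lemma profile_noninc v t t' : (t <= t')%N -> profile v t' <= profile v t.
Proof.
move=> tt'; apply: ler_sum => i _; apply: ler_wpM2l; first exact: sqr_ge0.
have h := rad_noninc v (leqnSn i) (ltn_ord i).
have r1 := rad_gt0 v (s i.+1); have r0 := rad_gt0 v (s i).
rewrite /level; have [le|] := boolP (rad v (s i) <= t')%N; last rewrite -ltnNge => lt.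
  have -> : maxn t' (rad v (s i)) = t' by lia.
  have -> : maxn t' (rad v (s i.+1)) = t' by lia.
  by rewrite subrr subr_ge0; apply: ler_ell; lia.
have -> : maxn t' (rad v (s i)) = rad v (s i) by lia.
have -> : maxn t (rad v (s i)) = rad v (s i) by lia.
by rewrite lerD2l lerN2; apply: ler_ell; lia.
Qed.

Lemma profile_double v t : profile v t <=
  profile v (2 * t) + 4 * (\sum_(i < M) sigma i.+1 ^+ 2).
Proof.
rewrite mulr_sumr -big_split/=; apply: ler_sum => i _.
rewrite [4 * _]mulrC -mulrDr; apply: ler_wpM2l; first exact: sqr_ge0.
have r1 := rad_gt0 v (s i.+1); have r0 := rad_gt0 v (s i).
have : level v t i <= level v (2 * t) i by apply: ler_ell; lia.
have : level v (2 * t) i.+1 <= level v t i.+1 + 2 * 2%:R by apply: ler_ellM; lia.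
lra.
Qed.

Lemma fieldcovC v w : fieldcov v w = fieldcov w v.
Proof.
rewrite /fieldcov exchange_big/=; apply: eq_bigr => i _; apply: eq_bigr => j _.
rewrite [sigma j.+1 * _]mulrC /incr2 !(covC v); congr (_ * _); ring.
Qed.

(** Dividing by the lower bound [kappa 0 0] of [mass] makes the constant independent of N. *)
Definition defect : R :=
  (2 * error + 4 * (\sum_(i < M) sigma i.+1 ^+ 2)) / kappa 0 0.

Lemma fieldcov_ultrametric v1 v2 v3 :
  Num.min (fieldcov v1 v3) (fieldcov v2 v3) - fieldcov v1 v2 <= defect.
Proof.
have k0 := @kappa00_gt0 R; have mk := @mass_ge R N.
have m0 : 0 < mass R N by lra.
set c := 2 * error + 4 * (\sum_(i < M) sigma i.+1 ^+ 2).
have c0 : 0 <= c.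
  have := sqr_ge0 (\sum_(i < M) sigma i.+1).
  have : 0 <= \sum_(i < M) sigma i.+1 ^+ 2 by rewrite sumr_ge0// => *; exact: sqr_ge0.
  by rewrite /c /error; lra.
(* Profiles are compared from a common base point only. By the triangle inequality v1 v3 or v2 v3 is
   at least half as long as v1 v2, and that side is compared with v1 v2 at their common end. *)
have H v w w' : (linf v w <= 2 * linf v w')%N ->
    fieldcov v w' - fieldcov v w <= defect.
  move=> ww'; apply: (@le_trans _ _ (c / mass R N)); last first.
    by rewrite ler_wpM2l// lef_pV2 ?posrE.
  rewrite ler_pdivlMr// mulrC mulrBr.
  have := fieldcov_estimate v w; have := fieldcov_estimate v w'.
  have := profile_noninc v ww'; have := profile_double v (linf v w').
  by rewrite /c !ler_norml; lra.
have tri := linf_triangle v1 v3 v2; rewrite (linfC v3) in tri.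
rewrite lerBlDr ge_min; have [le|lt] := leqP (linf v1 v2) (2 * linf v1 v3).
  by have := H _ _ _ le; lra.
have le : (linf v2 v1 <= 2 * linf v2 v3)%N by rewrite (linfC v2 v1); lia.
by have := H _ _ _ le; rewrite (fieldcovC v2 v1); lra.
Qed.

End increments.

(** * The Green function of the killed walk *)

Section lattice_boxes.
Context {N : nat}.
Implicit Types (v w x y : V N) (z : Z2) (B : set Z2).

Lemma site_inj : injective (@site N).
Proof. by move=> x y; rewrite /site => -[h1 h2]; exact: eq_site. Qed.

Lemma neighboursP (a b c e : int) : neighbours (a, b) (c, e) <->
  (a = c /\ (b - e = 1 \/ b - e = -1)) \/ (b = e /\ (a - c = 1 \/ a - c = -1)).
Proof.
rewrite /neighbours /=; split.
  have [p pE] : exists p, p = a - c by exists (a - c).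
  have [q qE] : exists q, q = b - e by exists (b - e).
  rewrite -pE -qE !expr2 => h.
  have p1 : -1 <= p <= 1 by nia.
  have q1 : -1 <= q <= 1 by nia.
  have [p0|p0] : p = 0 \/ p <> 0 by lia.
    by left; split; nia.
  right; split; nia.
by case=> -[-> [] ->]; rewrite subrr ?expr0n ?sqrrN expr1n.
Qed.

Lemma VN_P (a b : int) : VN N (a, b) <-> (0 <= a <= Posz N) /\ (0 <= b <= Posz N).
Proof.
split=> [[[[x1 h1] [x2 h2]] _ [<- <-]]|[ha hb]] /=; first by lia.
exists (pt `|a|%N `|b|%N) => //.
have h1 : (`|a|%N <= N)%N by lia.
have h2 : (`|b|%N <= N)%N by lia.
by rewrite /site !ptE//; congr (_, _); lia.
Qed.

Lemma adj_neighbours x y : adj x y -> neighbours (site x) (site y).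
Proof.
case: x y => [[x1 ?] [x2 ?]] [[y1 ?] [y2 ?]]; rewrite /adj /= => h.
by apply/neighboursP => /=; lia.
Qed.

Lemma box_interiorP B z :
  box_interior B z <-> B z /\ forall z', neighbours z z' -> B z'.
Proof.
split=> [[Bz nb]|[Bz nb]].
  by split=> // z' zz'; apply: contrapT => nB; apply: nb; split=> //; exists z'.
by split=> // -[_ [z' [nB zz']]]; exact/nB/nb.
Qed.

Lemma box_interior_dom B v w (s : nat) :
  (forall x, B (site x) <-> (linf x v <= s)%N) -> B `<=` VN N ->
  box_interior B (site w) <-> dom v s w.
Proof.
move=> BE BV; have BP a b : B (a, b) <-> VN N (a, b) /\
    (`|a - Posz v.1| <= s)%N /\ (`|b - Posz v.2| <= s)%N.
  split=> [Bab|[Vab [ha hb]]].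
    have [x _ xE] := BV _ Bab; split; first by exists x.
    move: Bab; rewrite -xE => /BE; rewrite geq_max !dnE => /andP[h1 h2].
    by move: xE => [<- <-].
  have [x _ xE] := Vab; rewrite -xE; apply/BE; rewrite geq_max !dnE.
  by move: xE ha hb => [<- <-] -> ->.
rewrite box_interiorP /dom /linf.
case: w => [[w1 hw1] [w2 hw2]]; rewrite /site /inner /= gtn_max !dnE.
move: (nat_of_ord v.1) (nat_of_ord v.2) BP => v1 v2 BP.
split=> [[Bw nb]|].
  have /BP[/VN_P + +] : B (w1%:Z + 1, w2%:Z).
    by apply: nb; apply/neighboursP; lia.
  have /BP[/VN_P + +] : B (w1%:Z - 1, w2%:Z).
    by apply: nb; apply/neighboursP; lia.
  have /BP[/VN_P + +] : B (w1%:Z, w2%:Z + 1).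
    by apply: nb; apply/neighboursP; lia.
  have /BP[/VN_P + +] : B (w1%:Z, w2%:Z - 1).
    by apply: nb; apply/neighboursP; lia.
  by move=> *; lia.
move=> h; split; first by apply/BP; rewrite VN_P; lia.
by move=> [a b] /neighboursP nb; apply/BP; rewrite VN_P; lia.
Qed.

Lemma site_boundary x : boundary (VN N) (site x) <-> ~~ inner x.
Proof.
(* V_N is the box of radius N around any of its sites, here x itself. *)
have E : dom x N x = inner x.
  rewrite /dom; case: (boolP (inner x)) => //= xi.
  by move: xi; rewrite /inner /linf /dn !subnn !addn0 maxnn; lia.
have box : box_interior (VN N) (site x) <-> inner x.
  rewrite -E; apply: box_interior_dom => // y; split=> _; last by exists y.
  rewrite geq_max /dn; case: x y {E} => [[x1 h1] [x2 h2]] [[y1 g1] [y2 g2]] /=; lia.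
split=> [bx|/negP xi].
  by apply/negP => /box[_]; apply.
apply: contrapT => nb; apply: xi; apply/box; split=> //; by exists x.
Qed.

End lattice_boxes.

Section walk_green.
Context {R : realType} {N : nat}.
Implicit Types (x y z : V N).

Lemma measure_fin_partition d (T : measurableType d) (mu : {measure set T -> \bar R})
    (I : finType) (Q : pred I) (F : I -> set T) :
  (forall i, measurable (F i)) -> trivIset [set` Q] F ->
  mu (\bigcup_(i in [set` Q]) F i) = (\sum_(i | Q i) mu (F i))%E.
Proof.
move=> mF tF; rewrite measure_fin_bigcup//.
rewrite -(@bigfs _ _ _ _ (index_enum I) Q (fun i => mu (F i))) ?index_enum_uniq//.
by move=> i _; rewrite mem_index_enum.
Qed.

End walk_green.

Section killed_walk.
Context {R : realType} {N : nat}.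
Implicit Types (x y z : V N).

(** The probability that the walk from x is at y at time k without having met the boundary, by
    conditioning on the first step. *)
Fixpoint occ y (k : nat) x : R :=
  if k is k'.+1 then (if inner x then avg (occ y k') x else 0)
  else (inner x && (x == y))%:R.

Lemma occ_ge0 y k x : 0 <= occ y k x.
Proof.
elim: k x => [|k IH] x /=; first exact: ler0n.
by case: ifP => // _; rewrite mulr_ge0 ?invr_ge0 ?sumr_ge0.
Qed.

Lemma occ_sumS y n x : \sum_(k < n.+1) occ y k x =
  if inner x then (x == y)%:R + avg (fun z => \sum_(k < n) occ y k z) x else 0.
Proof.
rewrite big_ord_recl/=; have [xi|xi] := boolP (inner x); last by rewrite big1 ?addr0.
by congr (_ + _); rewrite avg_sum.
Qed.

Lemma occ_sum_le y n x : \sum_(k < n) occ y k x <= gr (@inner N) x y.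
Proof.
elim: n x => [|n IH] x; first by rewrite big_ord0 gr_ge0.
rewrite occ_sumS; case: ifP => xi; last by rewrite gr_ge0.
have := gr_pole (R := R) (D := @inner N) (fun x h => h) y xi.
have : avg (fun z => \sum_(k < n) occ y k z) x <= avg (fun z => gr (@inner N) z y) x.
  by apply: ler_avg => z _.
lra.
Qed.

(** The partial sums increase and are bounded by the Green function; passing to the limit in
    [occ_sumS] shows that the limit solves the Dirichlet problem defining it. *)
Lemma cvg_occ_sum y x : (fun n => \sum_(k < n) occ y k x) @ \oo --> gr (@inner N) x y.
Proof.
have cv z : cvgn (fun n => \sum_(k < n) occ y k z).
  apply: nondecreasing_is_cvgn.
    apply/nondecreasing_seqP => n; rewrite big_ord_recr/= lerDl; exact: occ_ge0.
  by exists (gr (@inner N) z y) => _ [n _ <-]; exact: occ_sum_le.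
pose l z := limn (fun n => \sum_(k < n) occ y k z).
suff -> : gr (@inner N) x y = l x by [].
apply: (@solve_unique R N (@inner N) (fun x h => h) _ _ l) => z zi.
  apply: cvg_lim => //; rewrite (_ : (fun _ => _) = fun=> 0); first exact: cvg_cst.
  by apply/funext => -[|n]; rewrite ?big_ord0// occ_sumS (negbTE zi).
have : (fun n => \sum_(k < n.+1) occ y k z) @ \oo --> l z.
  by rewrite (cvg_shiftS (fun n => \sum_(k < n) occ y k z)); exact: cv.
under eq_fun do rewrite occ_sumS zi.
have : (fun n => (z == y)%:R + avg (fun z => \sum_(k < n) occ y k z) z) @ \oo -->
    (z == y)%:R + avg l z.
  apply: cvgD; first exact: cvg_cst.
  rewrite /avg; under eq_fun do rewrite sum_adj//.
  rewrite sum_adj//; apply: cvgM; first exact: cvg_cst.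
  by apply: cvgD; [apply: cvgD; [apply: cvgD|]|]; exact: cv.
move=> /cvg_lim H1 /cvg_lim H2; rewrite -[l z]H2// H1//; ring.
Qed.

End killed_walk.

Section walk_green.
Context {R : realType} {N : nat}.
Context {d : measure_display} {T : measurableType d}.
Variables (P : probability T R) (W : nat -> T -> Z2) (v : V N).
Hypothesis hW : simple_random_walk P W (site v).
Implicit Types (x y : V N).

Let mW k z : measurable [set w | W k w = z]. Proof. exact: hW.1. Qed.

Definition alive n j : set T :=
  [set w | forall i, (n <= i <= n + j)%N -> ~ boundary (VN N) (W i w)].

Definition cyl n (z : nat -> Z2) : set T :=
  [set w | forall k, (k <= n)%N -> W k w = z k].

Lemma measurable_cyl n z : measurable (cyl n z).
Proof.
rewrite (_ : cyl n z = \bigcap_(k in [set k | (k <= n)%N]) [set w | W k w = z k]).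
  exact: bigcap_measurableType.
by apply/seteqP; split => w /= h k kn; exact: h.
Qed.

Lemma measurable_alive n j : measurable (alive n j).
Proof.
rewrite (_ : alive n j = \bigcap_(i in [set i | (n <= i <= n + j)%N])
    ~` \bigcup_(x in [set` [pred x : V N | ~~ inner x]]) [set w | W i w = site x]).
  apply: bigcap_measurableType => i _; apply: measurableC.
  by apply: fin_bigcup_measurable.
apply/seteqP; split => w /= h i hi.
  by move=> [x xi Wx]; apply: (h i hi); rewrite Wx; apply/site_boundary.
move=> bd; apply: (h i hi); have [[x _ xE] _] := bd.
by exists x => //=; apply/site_boundary; rewrite xE.
Qed.

(* The nearest-neighbour continuations of a path exhaust its probability. *)
Lemma total_step n (z : nat -> Z2) x (A : set T) : z 0%N = site v ->
  (forall k, (k < n)%N -> neighbours (z k) (z k.+1)) -> z n = site x -> inner x ->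
  measurable A -> A `<=` cyl n z ->
  P A = (\sum_(y | adj x y) P (A `&` [set w | W n.+1 w = site y]))%E.
Proof.
move=> z0 zn znx xi mA Az.
have part B : measurable B -> P (B `&` \bigcup_(y in [set` adj x]) [set w | W n.+1 w = site y]) =
    (\sum_(y | adj x y) P (B `&` [set w | W n.+1 w = site y]))%E.
  move=> mB; rewrite setI_bigcupr measure_fin_partition//.
    by move=> y; apply: measurableI.
  by move=> y y' _ _ [w [[_ /= ->] [_ /= /site_inj]]].
rewrite -part//.
set U := \bigcup_(_ in _) _.
have mU : measurable U by exact: fin_bigcup_measurable.
have full : P (cyl n z `&` U) = P (cyl n z).
  rewrite part; last exact: measurable_cyl.
  rewrite (hW.2 n z z0 zn).
  transitivity (\sum_(y | adj x y) ((4%:R : R) ^- n.+1)%:E)%E.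
    apply: eq_bigr => y xy.
    pose z' k := if (k <= n)%N then z k else site y.
    rewrite -(hW.2 n.+1 z').
    - congr (P _); apply/seteqP; split=> w /=.
        move=> [h1 h2] k; rewrite leq_eqVlt /z' => /orP[/eqP->|kn].
          by rewrite ltnn.
        by rewrite -ltnS kn; exact: h1.
      move=> h; split; last by rewrite /= h// /z' ltnn.
      by move=> k kn; rewrite h ?leqW// /z' kn.
    - by rewrite /z' leq0n.
    - move=> k; rewrite ltnS leq_eqVlt /z' => /orP[/eqP->|kn].
        by rewrite leqnn ltnn znx; exact: adj_neighbours.
      by rewrite (ltnW kn) kn; exact: zn.
  rewrite sumEFin; congr (_%:E).
  rewrite -[X in \sum_(_ | _) X]mulr1 -mulr_sumr (sum_adj_inner xi).
  by rewrite exprS; field; rewrite expf_neq0.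
have null : P (cyl n z `\` U) = 0.
  have mc := measurable_cyl n z.
  have fin : P (cyl n z) \is a fin_num by exact: fin_num_measure.
  rewrite measureD//; last by rewrite ltey_eq fin.
  by transitivity (P (cyl n z) - P (cyl n z))%E; [congr (_ - _)%E; exact: full|exact: subee].
have {null} : P (A `\` U) = 0.
  apply: (subset_measure0 _ _ _ null); [exact: measurableD|by apply: measurableD => //; exact: measurable_cyl|].
  by move=> w [Aw Uw]; split=> //; exact: Az.
by move=> nul; rewrite (measureDI P mA mU) -[RHS]add0e; congr (_ + _)%E.
Qed.

(** The walk is known only through the probabilities of finite paths. Prescribing the path up to
    time n and extending it step by step takes the place of the Markov property. *)
Lemma prob_alive n (z : nat -> Z2) j x y : z 0%N = site v ->
  (forall k, (k < n)%N -> neighbours (z k) (z k.+1)) -> z n = site x ->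
  P (cyl n z `&` (alive n j `&` [set w | W (n + j)%N w = site y])) =
    ((4%:R : R) ^- n * occ y j x)%:E.
Proof.
elim: j n z x => [|j IH] n z x z0 zn znx.
  rewrite addn0 /=; case: (boolP (inner x && _)) => [/andP[xi /eqP <-]|xy].
    rewrite mulr1 -(hW.2 n z z0 zn); congr (P _); apply/seteqP; split=> w /=.
      by case.
    move=> h; split=> //; split=> /=; last by rewrite h.
    move=> i; rewrite addn0 -eqn_leq => /eqP <-; rewrite h// znx.
    by move=> /site_boundary; rewrite xi.
  rewrite mulr0 (_ : _ `&` _ = set0) ?measure0//; apply/seteqP; split=> // w.
  move=> [/= h1 [h2 h3]]; move: xy; rewrite negb_and => /orP[xi|/eqP].
    by apply: (h2 n); rewrite ?addn0 ?leqnn// h1// znx; apply/site_boundary.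
  by apply; apply: site_inj; rewrite -znx -h3 h1.
have [xi|xi] := boolP (inner x); last first.
  rewrite /= (negbTE xi) mulr0 (_ : _ `&` _ = set0) ?measure0//; apply/seteqP.
  split=> // w [/= h1 [h2 h3]].
  by apply: (h2 n); rewrite ?leqnn ?leq_addr// h1// znx; apply/site_boundary.
rewrite (total_step z0 zn znx xi); [|by apply: measurableI; [exact: measurable_cyl|
   apply: measurableI; [exact: measurable_alive|exact: mW]]|by move=> w []].
rewrite /= xi /avg mulrA mulr_sumr -sumEFin.
apply: eq_bigr => u xu.
pose z' k := if (k <= n)%N then z k else site u.
have -> : (4 ^- n * 4^-1 : R) = 4 ^- n.+1 by rewrite exprSr invfM mulrC.
have z'0 : z' 0%N = site v by rewrite /z' leq0n.
have z'n : z' n.+1 = site u by rewrite /z' ltnn.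
have z'p k : (k < n.+1)%N -> neighbours (z' k) (z' k.+1).
  rewrite ltnS leq_eqVlt /z' => /orP[/eqP->|kn].
    by rewrite leqnn ltnn znx; exact: adj_neighbours.
  by rewrite (ltnW kn) kn; exact: zn.
rewrite -(IH n.+1 z' u z'0 z'p z'n) /z'.
rewrite addSnnS; congr (P _); apply/seteqP; split=> w /=.
  move=> [[h1 [h2 h3]] h4]; split.
    move=> k; rewrite leq_eqVlt => /orP[/eqP->|kn]; first by rewrite ltnn.
    by rewrite -ltnS kn; exact: h1.
  split=> // i /andP[ni inj]; apply: h2; rewrite (ltnW ni) /=.
  by rewrite -addSnnS.
move=> [h1 [h2 h3]].
have h1' k : (k <= n)%N -> W k w = z k by move=> kn; rewrite h1 ?leqW// kn.
split; last by rewrite h1// ltnn.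
split=> //; split=> // i /andP[ni inj]; have [ni'|in'] := ltnP n i.
  by apply: h2; rewrite ni' addSnnS.
have -> : i = n by apply/eqP; rewrite eqn_leq in' ni.
by rewrite h1'// znx => /site_boundary; rewrite xi.
Qed.

Lemma lt_hitting_time k w :
  ((k%:R : R)%:E < hitting_time W (boundary (VN N)) w)%E <-> alive 0 k w.
Proof.
rewrite /hitting_time; split=> [h i /= ik bd|al].
  have : (hitting_time W (boundary (VN N)) w <= (i%:R : R)%:E)%E.
    by apply: ereal_inf_lbound; exists i.
  by move=> /(lt_le_trans h); rewrite lte_fin ltr_nat ltnNge ik.
apply: (@lt_le_trans _ _ (k.+1%:R : R)%:E); first by rewrite lte_fin ltr_nat.
apply: le_ereal_inf_tmp => _ [i /= bd <-]; rewrite lee_fin ler_nat ltnNge.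
by apply/negP => ik; exact: (al i).
Qed.

Lemma expected_visits y :
  (\int[P]_w \sum_(0 <= k <oo |
       ((k%:R : R)%:E < hitting_time W (boundary (VN N)) w)%E)
     ((W k w == site y)%:R : R)%:E)%E = (gr (@inner N) v y)%:E.
Proof.
pose E k := alive 0 k `&` [set w | W k w = site y].
have mE k : measurable (E k) by apply: measurableI; [exact: measurable_alive|exact: mW].
transitivity (\int[P]_w \sum_(k <oo) (\1_(E k) w : R)%:E)%E.
  apply: eq_integral => w _; rewrite eseries_mkcond; apply: eq_eseriesr => k _.
  rewrite indicE /E in_setI; case: ifPn => [/lt_hitting_time h|h].
    rewrite (mem_set h) /=.
    suff -> : (w \in [set w | W k w = site y]) = (W k w == site y) by [].
    by apply/idP/eqP; rewrite inE.
  by rewrite memNset//= => /lt_hitting_time; exact/negP.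
rewrite integral_nneseries//=; last by move=> k; exact/measurable_EFinP/measurable_indic.
have start : P (cyl 0 (fun=> site v)) = 1%E.
  by rewrite (hW.2 0%N (fun=> site v))// expr0 invr1.
have PE k : P (E k) = (occ y k v)%:E.
  have := @prob_alive 0 (fun=> site v) k v y erefl (fun k h => False_ind _ (Bool.diff_false_true h)) erefl.
  rewrite add0n expr0 invr1 mul1r -/(E k) => <-.
  have mc := measurable_cyl 0 (fun=> site v).
  rewrite (measureDI P (mE k) mc) -[RHS]add0e (setIC (cyl _ _)).
  have nC : P (~` cyl 0 (fun=> site v)) = 0 by rewrite probability_setC// start subee.
  have nE : P (E k `\` cyl 0 (fun=> site v)) = 0.
    apply: (subset_measure0 _ _ _ nC); [exact: measurableD|exact: measurableC|].
    by move=> w [].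
  by congr (_ + _)%E.
transitivity (\sum_(k <oo) (occ y k v : R)%:E)%E.
  by apply: eq_eseriesr => k _; rewrite integral_indic// setIT; exact: PE.
apply: cvg_lim => //.
rewrite (_ : (fun _ => _) = EFin \o (fun n => \sum_(k < n) occ y k v : R)).
  by apply: (cvg_comp _ _ (@cvg_occ_sum R N y v)).
by apply/funext => n /=; rewrite sumEFin big_mkord.
Qed.

End walk_green.

Lemma green_gr (R : realType) (N : nat) d (T : measurableType d)
  (PW : Z2 -> probability T R) (W : nat -> T -> Z2) (v w : V N) :
  (forall z, simple_random_walk (PW z) W z) ->
  green PW W (VN N) (site v) (site w) = (pi / 2 * gr (@inner N) v w)%:E.
Proof. by move=> hW; rewrite /green (expected_visits (hW _)) -EFinM. Qed.

(** * Gaussian projections are conditional expectations *)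

Section null_mean.
Context {R : realType} {d : measure_display} {T : measurableType d}.
Variable P : probability T R.
Implicit Types (f g k y z : T -> R).

Definition intble f : Prop := P.-integrable setT (EFin \o f).
Definition null_mean f : Prop := (\int[P]_w (f w)%:E = 0)%E.

Lemma intble_measurable f : intble f -> measurable_fun setT f.
Proof. by move=> /integrableP[/measurable_EFinP]. Qed.

Lemma intble_le f g : measurable_fun setT f -> (forall w, `|f w| <= g w) ->
  intble g -> intble f.
Proof.
move=> mf fg; apply: le_integrable => //; first exact/measurable_EFinP.
by move=> w _; rewrite /= lee_fin (le_trans (fg w))// ler_norm.
Qed.

Lemma intbleZ (a : R) f : intble f -> intble (fun w => a * f w).
Proof. by move=> hf; apply: (integrableZl measurableT a hf). Qed.

Lemma intbleD f g : intble f -> intble g -> intble (fun w => f w + g w).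
Proof. by move=> hf hg; apply: (integrableD measurableT hf hg). Qed.

Lemma intbleB f g : intble f -> intble g -> intble (fun w => f w - g w).
Proof. by move=> hf hg; apply: (integrableB measurableT hf hg). Qed.

Lemma intble_sum (I : Type) (r : seq I) (F : I -> T -> R) :
  (forall i, intble (F i)) -> intble (fun w => \sum_(i <- r) F i w).
Proof.
move=> hF; rewrite /intble (_ : EFin \o _ = fun w => (\sum_(i <- r) (F i w)%:E)%E).
  by apply: integrable_sum => // i _; exact: hF.
by apply/funext => w; rewrite /= sumEFin.
Qed.

Lemma intble_bounded_mul k f (c : R) : intble k -> measurable_fun setT f ->
  (forall w, `|f w| <= c) -> intble (fun w => k w * f w).
Proof.
move=> hk mf fc; have mk := intble_measurable hk.
apply: (@intble_le _ (fun w => c * `|k w|)).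
- exact: measurable_funM.
- by move=> w; rewrite normrM mulrC ler_wpM2r.
apply: intbleZ; rewrite /intble (_ : EFin \o _ = fun w => `|(EFin \o k) w|%E)//.
exact: integrable_abse.
Qed.

Lemma null_meanZ (a : R) f : intble f -> null_mean f -> null_mean (fun w => a * f w).
Proof.
move=> hf f0; rewrite /null_mean.
under eq_integral do rewrite EFinM.
by rewrite (integralZl measurableT hf) f0 mule0.
Qed.

Lemma null_meanD f g : intble f -> intble g -> null_mean f -> null_mean g ->
  null_mean (fun w => f w + g w).
Proof.
move=> hf hg f0 g0; rewrite /null_mean.
under eq_integral do rewrite EFinD.
by rewrite (integralD_EFin measurableT hf hg) f0 g0 adde0.
Qed.

Lemma null_meanB f g : intble f -> intble g -> null_mean f -> null_mean g ->
  null_mean (fun w => f w - g w).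
Proof.
move=> hf hg f0 g0; rewrite /null_mean.
under eq_integral do rewrite EFinB.
by rewrite (integralB_EFin measurableT hf hg) f0 g0 sube0.
Qed.

Lemma null_mean_sum (I : Type) (r : seq I) (F : I -> T -> R) :
  (forall i, intble (F i)) -> (forall i, null_mean (F i)) ->
  null_mean (fun w => \sum_(i <- r) F i w).
Proof.
move=> hF F0; elim: r => [|i r IH].
  by rewrite /null_mean; under eq_integral do rewrite big_nil; rewrite integral0.
rewrite /null_mean; under eq_integral do rewrite big_cons.
by apply: null_meanD => //; exact: intble_sum.
Qed.

Lemma null_mean_limit (f_ : nat -> T -> R) f g :
  (forall n, measurable_fun setT (f_ n)) -> measurable_fun setT f ->
  (forall w, f_ ^~ w @ \oo --> f w) ->
  (forall n w, `|f_ n w| <= g w) -> intble g ->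
  (forall n, null_mean (f_ n)) -> null_mean f.
Proof.
move=> mf_ mf cf fg ig f0.
have [_ _ cv] := @dominated_convergence _ _ _ P _ measurableT
  (fun n => EFin \o f_ n) (EFin \o f) (EFin \o g)
  (fun n => (measurable_EFinP _ _).2 (mf_ n)) ((measurable_EFinP _ _).2 mf)
  (aeW _ (fun w _ => cvg_comp _ _ (cf w) (fun A h => h))) ig
  (aeW _ (fun w n _ => fg n w)).
apply: (cvg_unique (@ereal_hausdorff R) cv).
suff -> : [sequence (\int[P]_w (EFin \o f_ n) w)%E]_n = (fun=> 0%E) by exact: cvg_cst.
by apply/funext => n; exact: f0.
Qed.

(* All moments of a bounded z vanish against k, hence so does its exponential. *)
Lemma null_mean_expR k z (c : R) : intble k -> measurable_fun setT z ->
  (forall w, `|z w| <= c) -> (forall j, null_mean (fun w => k w * z w ^+ j)) ->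
  null_mean (fun w => k w * expR (z w)).
Proof.
move=> hk mz zc k0; have mk := intble_measurable hk.
have iz j : intble (fun w => k w * z w ^+ j).
  apply: (@intble_bounded_mul _ _ (c ^+ j)) => //; first exact: measurable_funX.
  by move=> w; rewrite normrX lerXn2r ?nnegrE// (le_trans _ (zc w)).
pose f_ n w := \sum_(j <- index_iota 0 n) (j`!%:R)^-1 * (k w * z w ^+ j).
apply: (@null_mean_limit f_ _ (fun w => expR c * `|k w|)).
- by move=> n; apply: measurable_sum => j; apply: measurable_funM => //; exact: intble_measurable.
- by apply: measurable_funM => //; apply: measurableT_comp.
- move=> w; rewrite (_ : f_ ^~ w = fun n => k w * series (exp_coeff (z w)) n).
    by apply: cvgM; [exact: cvg_cst|exact: is_cvg_series_exp_coeff].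
  apply/funext => n; rewrite /f_ /series /= mulr_sumr; apply: eq_bigr => j _.
  by rewrite /exp_coeff /=; ring.
- move=> n w; rewrite (_ : f_ n w = k w * series (exp_coeff (z w)) n); last first.
    rewrite /f_ /series /= mulr_sumr; apply: eq_bigr => j _.
    by rewrite /exp_coeff /=; ring.
  rewrite normrM mulrC ler_wpM2r//.
  apply: (@le_trans _ _ (series (exp_coeff c) n)).
    apply: le_trans (ler_norm_sum _ _ _) _; apply: ler_sum => j _.
    rewrite /exp_coeff /= normrM normrX [X in _ * X]ger0_norm ?invr_ge0//.
    by rewrite ler_wpM2r ?invr_ge0// lerXn2r ?nnegrE// (le_trans _ (zc w)).
  have c0 : 0 <= c by apply: le_trans (zc w); exact: normr_ge0.
  apply: nondecreasing_cvgn_le; last exact: is_cvg_series_exp_coeff.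
  by apply: nondecreasing_series => j _ _; exact: exp_coeff_ge0.
- apply: intbleZ; rewrite /intble (_ : EFin \o _ = fun w => `|(EFin \o k) w|%E)//.
  exact: integrable_abse.
- move=> n; apply: null_mean_sum => j; first exact: intbleZ.
  by apply: null_meanZ.
Qed.

End null_mean.

(** Lets bounded trigonometric functions stand in for a variable that has no exponential moments at
    hand. *)
Lemma cvg_scaled_sin {R : realType} (x : R) :
  (fun n : nat => n.+1%:R * sin (x / n.+1%:R)) @ \oo --> x.
Proof.
have der : is_derive (0 : R) 1 (fun h => sin (x * h)) x.
  have : is_derive (0 : R) 1 (fun h => sin (x * h)) (cos (x * 0) * x).
    apply: is_derive_eq; rewrite /GRing.scale /= mulr1 ?mulr0; ring.
  by rewrite mulr0 cos0 mul1r.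
have := @ex_derive _ _ _ _ _ _ _ der; rewrite /derivable => cv.
have E := @derive_val _ _ _ _ _ _ _ der; rewrite /derive in E.
pose g (h : R) := h^-1 *: (((fun h => sin (x * h)) \o shift 0) (h *: 1) - sin (x * 0)).
have gx : g h @[h --> 0^'] --> x by rewrite -[X in _ --> X]E; exact: cv.
have inv : (forall n : nat, n.+1%:R^-1 != 0 :> R) /\
    (fun n : nat => n.+1%:R^-1 : R) @ \oo --> (0 : R).
  by split; [move=> n; rewrite invr_eq0 pnatr_eq0|exact: cvg_harmonic].
have := (cvgr_dnbhsP g 0 x).1 gx _ inv.
apply: cvg_trans; apply: near_eq_cvg; apply: nearW => n /=.
by rewrite /g /= invrK mulr0 sin0 subr0 addr0 /GRing.scale /= mulr1.
Qed.

(** * Uniqueness for Fourier transforms *)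

Section trigonometric_uniqueness.
Context {R : realType} {d : measure_display} {T : measurableType d}.
Variable P : probability T R.
Implicit Types (f g k y z : T -> R).

Lemma measurable_sin_fun y : measurable_fun setT y ->
  measurable_fun setT (fun w => sin (y w)).
Proof.
move=> my; apply: (measurableT_comp _ my); apply: continuous_measurable_fun.
exact: continuous_sin.
Qed.

Lemma measurable_cos_fun y : measurable_fun setT y ->
  measurable_fun setT (fun w => cos (y w)).
Proof.
move=> my; apply: (measurableT_comp _ my); apply: continuous_measurable_fun.
exact: continuous_cos.
Qed.

(** In real form: the image under y of the signed measure with density k has zero Fourier
    transform. *)
Definition trig_null k y : Prop := forall a : R,
  null_mean P (fun w => k w * cos (a * y w)) /\
  null_mean P (fun w => k w * sin (a * y w)).

Section fixed.
Variable y : T -> R.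
Hypothesis my : measurable_fun setT y.

Let may (a : R) : measurable_fun setT (fun w => a * y w).
Proof. exact: measurable_funM. Qed.

Lemma intble_cos k a : intble P k -> intble P (fun w => k w * cos (a * y w)).
Proof.
move=> hk; apply: (@intble_bounded_mul _ _ _ _ _ _ 1) => //.
  exact: measurable_cos_fun.
by move=> w; exact: cos_max.
Qed.

Lemma intble_sin k a : intble P k -> intble P (fun w => k w * sin (a * y w)).
Proof.
move=> hk; apply: (@intble_bounded_mul _ _ _ _ _ _ 1) => //.
  exact: measurable_sin_fun.
by move=> w; exact: sin_max.
Qed.

Lemma trig_null_sin k b : intble P k -> trig_null k y ->
  trig_null (fun w => k w * sin (b * y w)) y.
Proof.
move=> hk k0 a; have h2 f : intble P f -> intble P (fun w => 2^-1 * f w) by exact: intbleZ.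
split.
  rewrite (_ : (fun w => _) = (fun w => 2^-1 * (k w * sin ((a + b) * y w)) -
      2^-1 * (k w * sin ((a - b) * y w)))); last first.
    apply/funext => w; have -> : (a + b) * y w = a * y w + b * y w by ring.
    have -> : (a - b) * y w = a * y w - b * y w by ring.
    by rewrite sinD sinB; field.
  by apply: null_meanB; [apply/h2/intble_sin|apply/h2/intble_sin|
    apply: null_meanZ; [exact: intble_sin|exact: (k0 _).2]..].
rewrite (_ : (fun w => _) = (fun w => 2^-1 * (k w * cos ((a - b) * y w)) -
    2^-1 * (k w * cos ((a + b) * y w)))); last first.
  apply/funext => w; have -> : (a + b) * y w = a * y w + b * y w by ring.
  have -> : (a - b) * y w = a * y w - b * y w by ring.
  by rewrite cosB cosD; field.
by apply: null_meanB; [apply/h2/intble_cos|apply/h2/intble_cos|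
  apply: null_meanZ; [exact: intble_cos|exact: (k0 _).1]..].
Qed.

Lemma trig_null_sinX k b j : intble P k -> trig_null k y ->
  null_mean P (fun w => k w * sin (b * y w) ^+ j).
Proof.
elim: j k => [|j IH] k hk k0.
  rewrite (_ : (fun w => _) = (fun w => k w * cos (0 * y w))); first exact: (k0 0).1.
  by apply/funext => w; rewrite mul0r cos0.
rewrite (_ : (fun w => _) = (fun w => (k w * sin (b * y w)) * sin (b * y w) ^+ j)).
  by apply: IH; [exact: intble_sin|exact: trig_null_sin].
by apply/funext => w; rewrite exprS mulrA.
Qed.

(** [null_mean_expR] is used twice. The inner exponential is bounded because y appears through a
    sine, and its powers are again, up to a constant, exponentials of a multiple of that sine, whose
    moments vanish by [trig_null_sinX]. *)
Let truncated k c t m n : intble P k -> trig_null k y ->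
  null_mean P (fun w => k w * expR (- expR (c * (n.+1%:R * sin (y w / n.+1%:R) - t) - m))).
Proof.
move=> hk k0; set L := n.+1%:R; have L0 : 0 < L by rewrite ltr0n.
pose s w := sin (L^-1 * y w).
have ms : measurable_fun setT s by exact: measurable_sin_fun.
have sE w : sin (y w / L) = s w by rewrite /s mulrC.
have s1 w : `|s w| <= 1 by exact: sin_max.
pose z w := - expR (c * (L * s w - t) - m).
have mz : measurable_fun setT z.
  apply: measurableT_comp => //; apply: measurableT_comp => //.
  apply: measurable_funB => //; apply: measurable_funM => //.
  by apply: measurable_funB => //; apply: measurable_funM.
rewrite (_ : (fun w => _) = (fun w => k w * expR (z w))); last first.
  by apply/funext => w; rewrite sE.
apply: (@null_mean_expR _ _ _ _ _ _ (expR (`|c| * (L + `|t|) + `|m|))) => //.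
  move=> w; rewrite normrN ger0_norm ?expR_ge0// ler_expR.
  apply: le_trans (ler_norm _) _; apply: le_trans (ler_normB _ _) _.
  rewrite lerD2r normrM ler_wpM2l//; apply: le_trans (ler_normB _ _) _.
  by rewrite lerD2r normrM gtr0_norm// ler_piMr// ltW.
move=> j.
pose C := (- 1) ^+ j * expR (- (j%:R * (c * t + m))).
rewrite (_ : (fun w => _) = (fun w => C * (k w * expR ((j%:R * c * L) * s w)))); last first.
  apply/funext => w; rewrite /z -mulN1r exprMn -expRM_natl /C.
  have -> : j%:R * (c * (L * s w - t) - m) =
     - (j%:R * (c * t + m)) + j%:R * c * L * s w by ring.
  rewrite expRD; ring.
have bd w : `|j%:R * c * L * s w| <= `|j%:R * c * L|.
  by rewrite normrM ler_piMr.
have mz' : measurable_fun setT (fun w => j%:R * c * L * s w) by exact: measurable_funM.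
apply: null_meanZ.
  apply: (@intble_bounded_mul _ _ _ _ _ _ (expR `|j%:R * c * L|)) => //.
    exact: measurableT_comp.
  by move=> w; rewrite ger0_norm ?expR_ge0// ler_expR (le_trans (ler_norm _)).
apply: (@null_mean_expR _ _ _ _ _ _ `|j%:R * c * L|) => // i.
rewrite (_ : (fun w => _) = (fun w => (j%:R * c * L) ^+ i * (k w * s w ^+ i))); last first.
  by apply/funext => w; rewrite exprMn; ring.
apply: null_meanZ; last exact: trig_null_sinX.
apply: (@intble_bounded_mul _ _ _ _ _ _ 1) => //; first exact: measurable_funX.
by move=> w; rewrite normrX exprn_ile1.
Qed.

Let expN_le1 (x : R) : `|expR (- expR x)| <= 1.
Proof. by rewrite ger0_norm ?expR_ge0// -expR0 ler_expR oppr_le0 expR_ge0. Qed.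

Lemma intble_abs k : intble P k -> intble P (fun w => `|k w|).
Proof.
move=> hk; rewrite /intble (_ : EFin \o _ = fun w => `|(EFin \o k) w|%E)//.
exact: integrable_abse.
Qed.

Let gompertz k c t m : intble P k -> trig_null k y ->
  null_mean P (fun w => k w * expR (- expR (c * (y w - t) - m))).
Proof.
move=> hk k0; have mk := intble_measurable hk.
have mg z : measurable_fun setT z ->
    measurable_fun setT (fun w => k w * expR (- expR (c * (z w - t) - m))).
  move=> mz; apply: measurable_funM => //; apply: measurableT_comp => //.
  apply: measurableT_comp => //; apply: measurableT_comp => //.
  apply: measurable_funB => //; apply: measurable_funM => //.
  exact: measurable_funB.
apply: (@null_mean_limit _ _ _ _ (fun n w => k w *
   expR (- expR (c * (n.+1%:R * sin (y w / n.+1%:R) - t) - m))) _ (fun w => `|k w|)).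
- move=> n; apply: mg; apply: measurable_funM => //; apply: measurable_sin_fun.
  exact: measurable_funM.
- exact: mg.
- move=> w; apply: cvgMl_tmp; apply: continuous_cvg; first exact: continuous_expR.
  apply: cvgN; apply: continuous_cvg; first exact: continuous_expR.
  apply: cvgB; last exact: cvg_cst.
  apply: cvgMl_tmp; apply: cvgB; last exact: cvg_cst.
  exact: cvg_scaled_sin.
- by move=> n w; rewrite normrM ler_piMr.
- exact: intble_abs.
- by move=> n; exact: truncated.
Qed.

(* The functions exp(-exp(n^2(y - t) - n)) tend to the indicator of (-oo, t],
   also at y = t. *)
Let cvg_gompertz (x : R) :
  (fun n : nat => expR (- expR (n%:R ^+ 2 * x - n%:R))) @ \oo --> ((x <= 0)%R%:R : R).
Proof.
have inv0 : (fun n : nat => (n.+1%:R : R)^-1) @ \oo --> (0 : R) by exact: cvg_harmonic.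
have [x0|x0] := leP x 0.
  apply: (@squeeze_cvgr _ _ _ _ (fun n : nat => 1 - n.+1%:R^-1) (fun=> 1)); last 2 first.
  - by rewrite -[X in _ --> X]subr0; apply: cvgB => //; exact: cvg_cst.
  - exact: cvg_cst.
  apply: nearW => n; have := expN_le1 (n%:R ^+ 2 * x - n%:R).
  rewrite ger0_norm ?expR_ge0// => ->; rewrite andbT.
  apply: le_trans (expR_ge1Dx _); rewrite lerD2l lerN2.
  apply: (@le_trans _ _ (expR (- n%:R))).
    by rewrite ler_expR gerDr mulr_ge0_le0 ?exprn_ge0.
  rewrite expRN lef_pV2 ?posrE ?expR_gt0 ?ltr0n//.
  by apply: le_trans (expR_ge1Dx _); rewrite -natr1 addrC.
apply: (@squeeze_cvgr _ _ _ _ (fun=> 0) (fun n : nat => n.+1%:R^-1)); last 2 first.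
- exact: cvg_cst.
- exact: inv0.
near=> n; rewrite expR_ge0 /=.
have nx : 2 <= n%:R * x.
  rewrite -ler_pdivrMr//; near: n; exact: nbhs_infty_ger.
rewrite expRN lef_pV2 ?posrE ?expR_gt0 ?ltr0n//.
apply: le_trans (expR_ge1Dx _); rewrite -natr1 addrC lerD2l.
apply: le_trans (expR_ge1Dx _).
have n0 : 0 <= n%:R :> R by [].
rewrite expr2; nra.
Unshelve. all: by end_near.
Qed.

(** Inversion without Fourier integrals: the indicator is a bounded pointwise limit of double
    exponentials of y, themselves limits of double exponentials of sines. *)
Lemma trig_null_halfline k t : intble P k -> trig_null k y ->
  null_mean P (fun w => k w * (y w <= t)%R%:R).
Proof.
move=> hk k0; have mk := intble_measurable hk.
apply: (@null_mean_limit _ _ _ _ (fun n w => k w *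
   expR (- expR (n%:R ^+ 2 * (y w - t) - n%:R))) _ (fun w => `|k w|)).
- move=> n; apply: measurable_funM => //; apply: measurableT_comp => //.
  apply: measurableT_comp => //; apply: measurableT_comp => //.
  apply: measurable_funB => //; apply: measurable_funM => //.
  exact: measurable_funB.
- apply: measurable_funM => //.
  rewrite (_ : (fun w => _) = \1_[set w | y w <= t]).
    apply: measurable_indic; rewrite -[X in measurable X]setTI.
    exact: measurable_fun_le.
  apply/funext => w; rewrite indicE.
  suff -> : (w \in [set w | y w <= t]) = (y w <= t) by [].
  by apply/idP/idP; rewrite inE.
- move=> w; apply: cvgMl_tmp; rewrite -subr_le0; exact: cvg_gompertz.
- by move=> n w; rewrite normrM ler_piMr.
- exact: intble_abs.
- by move=> n; exact: gompertz.
Qed.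

End fixed.
End trigonometric_uniqueness.

(** * The standard Gaussian law and its affine images *)

Section standard_gaussian.
Context {R : realType}.
Notation mu := lebesgue_measure.

Lemma eq_probability_rays (p q : probability (measurableTypeR R) R) :
  (forall b : R, p `]-oo, b]%classic = q `]-oo, b]%classic) ->
  forall A, measurable A -> p A = q A.
Proof.
move=> pq A mA.
apply: (@measure_unique _ R (measurableTypeR R) (@RGenOInfty.G R)
  (fun k : nat => `](- k%:R), +oo[%classic) _ _ _ _ p q) => //.
- exact: RGenOInfty.measurableE.
- move=> _ _ [x ->] [y ->]; exists (Num.max x y).
  by apply/seteqP; split => z /=; rewrite !in_itv/= !andbT gt_max => /andP.
- by move=> i; exists (- i%:R).
- apply/seteqP; split=> // x _.
  exists (Num.bound `|x|) => //=; rewrite in_itv/= andbT ltrNl.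
  by apply: le_lt_trans (archi_boundP (normr_ge0 x)); rewrite -normrN ler_norm.
- move=> _ [x ->]; rewrite -[`]x, +oo[%classic]setCK setCitvr.
  apply: etrans; first exact: probability_setC.
  by rewrite pq; apply: esym; exact: probability_setC.
- by move=> k; apply: le_lt_trans (probability_le1 _ _) (ltry 1).
Qed.

Definition nu : probability (measurableTypeR R) R := normal_prob 0 1.

Lemma normal_pdf_affine (m s x : R) : 0 < s ->
  normal_pdf m s (m + s * x) * s = normal_pdf 0 1 x.
Proof.
move=> s0; rewrite !normal_pdfE ?gt_eqF// /normal_fun /normal_peak.
have -> : m + s * x - m = s * x by ring.
rewrite subr0 expr1n mul1r mulrAC; congr (_ * _); last first.
  congr expR; rewrite exprMn -[s ^+ 2 *+ 2]mulr_natr -[1 *+ 2]/(2%:R) invfM mulrA.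
  by rewrite -mulNr mulrAC; field; rewrite gt_eqF.
rewrite -mulrnAr sqrtrM ?sqr_ge0// sqrtr_sqr gtr0_norm// invfM mulrAC.
by rewrite mulVf ?mul1r// gt_eqF.
Qed.

(** Gaussian laws become images of the single measure [nu], which also lets the degenerate case be
    treated as s = 0. *)
Lemma normal_prob_affine (m s : R) : 0 < s -> forall A, measurable A ->
  normal_prob m s A = nu ((fun x => m + s * x) @^-1` A).
Proof.
move=> s0.
have mF : measurable_fun setT (fun x : measurableTypeR R => m + s * x : measurableTypeR R).
  by apply: measurable_funD => //; exact: measurable_funM.
pose F : {RV nu >-> measurableTypeR R} :=
  @mfun_Sub _ _ (measurableTypeR R) (measurableTypeR R) _ (mem_set mF).
have dF (x : R) : is_derive x 1 (fun x : R => m + s * x) s.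
  by apply: is_derive_eq; rewrite /GRing.scale /=; ring.
move=> A mA; apply: (@eq_probability_rays (normal_prob m s) (distribution nu F)) => // b.
rewrite /distribution /pushforward /=.
pose b' := (b - m) / s.
have bE : b = m + s * b' by rewrite /b'; field; rewrite gt_eqF.
have -> : (fun x => m + s * x) @^-1` `]-oo, b]%classic = `]-oo, b']%classic.
  by apply/seteqP; split => x /=; rewrite !in_itv/= bE lerD2l ler_pM2l.
rewrite /normal_prob bE.
have dE : ((fun x : R => m + s * x)^`())%classic = cst s.
  by apply/funext => x; rewrite derive1E; exact: derive_val.
rewrite (@increasing_ge0_integration_by_substitutionNy _ (fun x => m + s * x)).
- apply: eq_integral => x _; congr EFin; rewrite dE /=.
  exact: normal_pdf_affine.
- by move=> x y _ _ xy; rewrite ltrD2l ltr_pM2l.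
- by rewrite dE => x _; exact: cst_continuous.
- by rewrite dE; exact: is_cvg_cst.
- by rewrite dE; exact: cvg_cst.
- split; first by move=> x _; apply: ex_derive.
  apply: cvg_at_left_filter.
  apply: cvgD; first exact: cvg_cst.
  by apply: cvgMl_tmp; exact: cvg_id.
- apply: (cvg_comp (fun x : R => s * x) (fun y : R => m + y)); last exact: cvg_addrl_Ny.
  by apply: gt0_cvgMrNy => //; exact: cvg_id.
- by apply: continuous_subspaceT; apply: continuous_normal_pdf; rewrite gt_eqF.
- by move=> *; exact: normal_pdf_ge0.
Qed.

Lemma nu_opp A : measurable A -> nu A = nu (-%R @^-1` A).
Proof.
move=> mA.
have mF : measurable_fun setT (fun x : measurableTypeR R => - x : measurableTypeR R).
  exact: measurableT_comp.
pose F : {RV nu >-> measurableTypeR R} :=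
  @mfun_Sub _ _ (measurableTypeR R) (measurableTypeR R) _ (mem_set mF).
apply: (@eq_probability_rays nu (distribution nu F)) => // b.
rewrite /distribution /pushforward /=.
have -> : -%R @^-1` `]-oo, b]%classic = `[- b, +oo[%classic.
  by apply/seteqP; split => x /=; rewrite !in_itv/= andbT lerNl.
rewrite /nu /= /normal_prob -[b in LHS]opprK ge0_integration_by_substitutionNy.
- apply: eq_integral => x _; congr EFin => /=.
  by rewrite !normal_pdfE ?oner_neq0// /normal_fun !subr0 sqrrN.
- by apply: continuous_subspaceT; apply: continuous_normal_pdf; exact: oner_neq0.
- by move=> *; exact: normal_pdf_ge0.
Qed.

End standard_gaussian.

Section equal_laws.
Context {R : realType} {d1 d2 : measure_display}.
Context {T1 : measurableType d1} {T2 : measurableType d2}.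
Variables (P1 : {measure set T1 -> \bar R}) (P2 : {measure set T2 -> \bar R}).
Variables (X1 : T1 -> R) (X2 : T2 -> R).
Hypotheses (mX1 : measurable_fun setT X1) (mX2 : measurable_fun setT X2).
Hypothesis law : forall A : set R, measurable A -> P1 (X1 @^-1` A) = P2 (X2 @^-1` A).

Lemma eq_law_ge0 (f : R -> \bar R) : measurable_fun setT f -> (forall x, 0 <= f x)%E ->
  (\int[P1]_w f (X1 w) = \int[P2]_w f (X2 w))%E.
Proof.
move=> mf f0.
have := @ge0_integral_pushforward _ _ _ _ _ X1 mX1 P1 setT f measurableT mf (fun x _ => f0 x).
have := @ge0_integral_pushforward _ _ _ _ _ X2 mX2 P2 setT f measurableT mf (fun x _ => f0 x).
rewrite !preimage_setT => <- <-.
by apply: eq_measure_integral => A mA _; exact: law.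
Qed.

Lemma eq_law_integrable (f : R -> \bar R) : measurable_fun setT f ->
  P1.-integrable setT (f \o X1) -> P2.-integrable setT (f \o X2).
Proof.
move=> mf /integrableP[_ fin]; apply/integrableP; split; first exact: measurableT_comp.
rewrite -(@eq_law_ge0 (fun x => `|f x|%E))//; exact: measurableT_comp.
Qed.

Lemma eq_law_integral (f : R -> \bar R) : measurable_fun setT f ->
  P1.-integrable setT (f \o X1) ->
  (\int[P1]_w f (X1 w) = \int[P2]_w f (X2 w))%E.
Proof.
move=> mf if1; rewrite integralE [RHS]integralE; congr (_ - _)%E.
  have := @eq_law_ge0 (f^\+)%E (measurable_funepos mf) (fun x => funepos_ge0 f x).
  by rewrite (funepos_comp f X1) (funepos_comp f X2).
have := @eq_law_ge0 (f^\-)%E (measurable_funeneg mf) (fun x => funeneg_ge0 f x).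
by rewrite (funeneg_comp f X1) (funeneg_comp f X2).
Qed.

End equal_laws.

Section gaussian_law.
Context {R : realType}.

Let mid : measurable_fun setT (fun x : measurableTypeR R => x : R).
Proof. exact: measurable_id. Qed.

Lemma nu_mean0 : (@nu R).-integrable setT EFin -> (\int[@nu R]_x x%:E = 0)%E.
Proof.
move=> i1.
have mN : measurable_fun setT (fun x : measurableTypeR R => - x : R) by exact: measurableT_comp.
have mE : measurable_fun setT (@EFin R) by apply/measurable_EFinP; exact: measurable_id.
have := @eq_law_integral R _ _ _ _ (@nu R) (@nu R) _ _ mid mN (@nu_opp R) EFin
   mE i1.
have fin := integrable_fin_num measurableT i1.
rewrite (_ : (\int[nu]_w (- w)%:E)%E = (- \int[nu]_w w%:E)%E); last first.
  by under eq_integral do rewrite EFinN; rewrite integralN//; exact: integrable_add_def.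
move: fin; case: (integral _ _ _) => // r _ /eqP; rewrite -EFinN eqe => /eqP h.
by congr EFin; lra.
Qed.

Lemma nu_variance_gt0 : (0 < \int[@nu R]_x (x ^+ 2)%:E)%E.
Proof.
rewrite lt_neqAle integral_ge0 ?andbT//; last by move=> x _; rewrite lee_fin sqr_ge0.
apply/negP => /eqP/esym h.
have msq : measurable_fun setT (fun x : measurableTypeR R => (x ^+ 2)%:E).
  by apply/measurable_EFinP; exact: measurable_funX.
have := (ae_eq_integral_abs (@nu R) measurableT msq).1.
under eq_integral do rewrite gee0_abs ?lee_fin ?sqr_ge0//.
move=> /(_ h)[N [mN N0 sub]].
have z0 : @nu R [set 0] = 0%E.
  have dom := @normal_prob_dominates R 0 1.
  by apply: ((null_content_dominatesP _ _).1 dom) => //; exact: lebesgue_measure_set1.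
have : @nu R (N `|` [set 0]) = 0%E by rewrite measureU0.
rewrite (_ : N `|` [set 0] = setT) ?probability_setT; first by move=> /eqP; rewrite eqe oner_eq0.
apply/seteqP; split=> // x _; have [Nx|Nx] := pselect (N x); [by left|right].
apply: contrapT => x0; apply/Nx/sub => /= /(_ I) /eqP; rewrite eqe sqrf_eq0.
by move=> /eqP.
Qed.

End gaussian_law.

Section gaussian_variance.
Context {R : realType} {d : measure_display} {T : measurableType d}.
Variable P : probability T R.
Implicit Types X Y : T -> R.

Let affine (m s : R) : measurableTypeR R -> R := fun z => m + s * z.

Let maffine m s : measurable_fun setT (affine m s).
Proof. by apply: measurable_funD => //; exact: measurable_funM. Qed.

Lemma gaussian_affine X : gaussian P X -> exists m s : R, 0 <= s /\
  forall A : set R, measurable A -> P (X @^-1` A) = nu (affine m s @^-1` A).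
Proof.
move=> [m [s [s0 law]]]; exists m, s; split=> // A mA; rewrite law//.
have [s00|sn0] := eqVneq s 0; last first.
  by rewrite normal_prob_affine// lt_neqAle eq_sym sn0.
rewrite diracE s00; have [mA'|mA'] := boolP (m \in A).
  rewrite (_ : _ @^-1` _ = setT) ?probability_setT//.
  by apply/seteqP; split=> // z _; rewrite /affine /= mul0r addr0 -inE.
rewrite (_ : _ @^-1` _ = set0) ?measure0//.
apply/seteqP; split=> // z; rewrite /affine /= mul0r addr0 => Am.
by move: mA'; rewrite notin_setE.
Qed.

Lemma centered_gaussian_scale X (v : R) : gaussian P X -> measurable_fun setT X ->
  intble P X -> null_mean P X -> (\int[P]_w (X w ^+ 2)%:E = v%:E)%E ->
  exists s : R, [/\ 0 <= s,
    ((s ^+ 2)%:E * \int[@nu R]_x (x ^+ 2)%:E = v%:E)%E &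
    forall A : set R, measurable A -> P (X @^-1` A) = nu (affine 0 s @^-1` A)].
Proof.
move=> /gaussian_affine[m [s [s0 law]]] mX iX X0 Xv.
have mE : measurable_fun setT (@EFin R) by apply/measurable_EFinP; exact: measurable_id.
have iA : (@nu R).-integrable setT (EFin \o affine m s).
  exact: (eq_law_integrable mX (maffine m s) law mE iX).
have A0 : (\int[@nu R]_z (affine m s z)%:E = 0)%E.
  by rewrite -(eq_law_integral mX (maffine m s) law mE iX).
have m0 : m = 0.
  have icst : (@nu R).-integrable setT (EFin \o cst m) by exact: finite_measure_integrable_cst.
  have [s00|sn0] := eqVneq s 0.
    move: A0; rewrite /affine s00.
    under eq_integral do rewrite mul0r addr0.
    by rewrite integral_cst//= probability_setT mule1 => -[].
  (* Integrability under [nu] is carried over from X, as the scale is nonzero. *)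
  have iz : (@nu R).-integrable setT EFin.
    rewrite (_ : EFin = fun z => ((s^-1)%:E * ((EFin \o affine m s) z - (EFin \o cst m) z))%E).
      by apply: integrableZl => //; exact: integrableB.
    by apply/funext => z /=; rewrite -EFinB -EFinM /affine addrAC subrr add0r mulKf.
  have isz : (@nu R).-integrable setT (fun z => (s%:E * z%:E)%E) by exact: integrableZl.
  move: A0; rewrite /affine; under eq_integral do rewrite EFinD EFinM.
  rewrite (integralD measurableT icst isz) (integralZl measurableT iz) nu_mean0// mule0 adde0.
  have -> : (\int[@nu R]_z (EFin \o cst m) z = m%:E)%E; last by case.
  rewrite (_ : EFin \o cst m = cst m%:E)// integral_cst//.
  by rewrite [X in (_ * X)%E](_ : _ = 1%E) ?mule1//; exact: probability_setT.
exists s; split=> //; last by rewrite -m0.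
have msq : measurable_fun setT (fun x : R => (x ^+ 2)%:E).
  by apply/measurable_EFinP; exact: measurable_funX.
have sq0 (x : R) : (0 <= (x ^+ 2)%:E)%E by rewrite lee_fin sqr_ge0.
have := eq_law_ge0 mX (maffine m s) law msq sq0; rewrite Xv => ->.
rewrite -ge0_integralZl//.
by apply: eq_integral => z _; rewrite /affine m0 add0r exprMn EFinM.
Qed.

(** Both laws are images of [nu] under scalings by s, t >= 0. The second moment of [nu] is positive:
    if it is finite, equal variances give s = t; if it were infinite, a finite variance would force
    s = t = 0. *)
Lemma gaussian_same_law X Y (v : R) : gaussian P X -> gaussian P Y ->
  measurable_fun setT X -> measurable_fun setT Y -> intble P X -> intble P Y ->
  null_mean P X -> null_mean P Y ->
  (\int[P]_w (X w ^+ 2)%:E = v%:E)%E -> (\int[P]_w (Y w ^+ 2)%:E = v%:E)%E ->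
  forall A : set R, measurable A -> P (X @^-1` A) = P (Y @^-1` A).
Proof.
move=> gX gY mX mY iX iY X0 Y0 Xv Yv A mA.
have [s [s0 sv ->//]] := centered_gaussian_scale gX mX iX X0 Xv.
have [t [t0 tv ->//]] := centered_gaussian_scale gY mY iY Y0 Yv.
suff -> : s = t by [].
have := @nu_variance_gt0 R; move: sv tv; case: (integral _ _ _) => [k| |]//.
  rewrite -!EFinM lte_fin => -[sv] [tv] k0.
  have : s ^+ 2 = t ^+ 2 by apply: (mulIf (lt0r_neq0 k0)); rewrite sv tv.
  by move=> /eqP; rewrite eqrXn2// => /eqP.
have inf (u : R) : 0 <= u -> ((u ^+ 2)%:E * +oo = v%:E)%E -> u = 0.
  move=> u0; have [//|un0] := eqVneq u 0.
  by rewrite gt0_muley// lte_fin exprn_gt0// lt_neqAle eq_sym un0.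
by move=> /(inf _ s0) -> /(inf _ t0) ->.
Qed.

End gaussian_variance.

Lemma abs_sin_le {R : realType} (x : R) : `|sin x| <= `|x|.
Proof.
wlog x0 : x / 0 <= x => [H|].
  have [/H//|x0] := leP 0 x.
  by rewrite -normrN -sinN -[leRHS]normrN; apply: H; rewrite oppr_ge0 ltW.
have [|c _] := @MVT_segment R sin cos 0 x x0 (fun z _ => is_derive_sin z).
  by apply: continuous_subspaceT; exact: continuous_sin.
rewrite sin0 !subr0 => ->; rewrite normrM ler_piMl//; exact: cos_max.
Qed.

Lemma trig_shifts {R : realType} (x y : R) :
  [/\ sin (y + x) - sin (y - x) = 2 * (sin x * cos y),
      cos (y - x) - cos (y + x) = 2 * (sin x * sin y),
      sin (y + x) + sin (y - x) = 2 * (sin y * cos x) &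
      cos (y - x) + cos (y + x) = 2 * (cos y * cos x)].
Proof. by rewrite !sinD !cosD sinN cosN; split; ring. Qed.

(** * A linear form orthogonal to some coordinates has zero mean on the events they generate *)

Section gaussian_projection.
Context {R : realType} {d : measure_display} {T : measurableType d}.
Variable P : probability T R.
Variables (I : finType) (X : I -> {RV P >-> R}) (C : I -> I -> R).
Hypothesis hX : centered_gaussian_field X (fun i j => (C i j)%:E).
Implicit Types a b u : I -> R.

Definition lin a (w : T) : R := \sum_i a i * X i w.

Let mX i : measurable_fun setT (X i). Proof. exact: measurable_funPT. Qed.

Lemma measurable_lin a : measurable_fun setT (lin a).
Proof. by apply: measurable_sum => i; apply: measurable_funM. Qed.

Lemma expectation_mul i j : (\int[P]_w (X i w * X j w)%:E = (C i j)%:E)%E.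
Proof.
have [_ E0 cov] := hX; rewrite -cov covariance.unlock (E0 i) (E0 j) expectation.unlock.
by apply: eq_integral => w _; congr EFin; rewrite /GRing.mul /= !subr0.
Qed.

Let intble_sqr i : intble P (fun w => X i w ^+ 2).
Proof.
apply/integrableP; split; first by apply/measurable_EFinP; exact: measurable_funX.
rewrite (eq_integral (fun w => (X i w * X i w)%:E)); first by rewrite expectation_mul ltry.
by move=> w _; rewrite /= ger0_norm ?sqr_ge0// expr2.
Qed.

Let intble_mul i j : intble P (fun w => X i w * X j w).
Proof.
apply: (@intble_le _ _ _ _ _ (fun w => X i w ^+ 2 + X j w ^+ 2)).
- exact: measurable_funM.
- move=> w; rewrite ler_norml.
  have := sqr_ge0 (X i w - X j w); have := sqr_ge0 (X i w + X j w); nra.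
- by apply: intbleD.
Qed.

Lemma intble_X i : intble P (X i).
Proof.
apply: (@intble_le _ _ _ _ _ (fun w => 1 + X i w ^+ 2)) => //.
  by move=> w; rewrite ler_norml; have := sqr_ge0 (X i w - 1); have := sqr_ge0 (X i w + 1); nra.
by apply: intbleD => //; exact: finite_measure_integrable_cst.
Qed.

Lemma null_mean_X i : null_mean P (X i).
Proof. by have [_ E0 _] := hX; rewrite /null_mean -(E0 i) expectation.unlock. Qed.

Lemma intble_lin a : intble P (lin a).
Proof. by apply: intble_sum => i; apply/intbleZ/intble_X. Qed.

Lemma null_mean_lin a : null_mean P (lin a).
Proof.
apply: null_mean_sum => i; first exact/intbleZ/intble_X.
by apply: null_meanZ; [exact: intble_X|exact: null_mean_X].
Qed.

Lemma expectation_lin_mul a b :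
  (\int[P]_w (lin a w * lin b w)%:E = (\sum_i \sum_j a i * b j * C i j)%:E)%E.
Proof.
have it i j : intble P (fun w => a i * b j * (X i w * X j w)) by exact: intbleZ.
transitivity (\int[P]_w (\sum_i \sum_j (a i * b j * (X i w * X j w))%:E))%E.
  apply: eq_integral => w _; rewrite /lin mulr_suml -sumEFin; apply: eq_bigr => i _.
  by rewrite mulr_sumr -sumEFin; apply: eq_bigr => j _; congr EFin; ring.
rewrite integral_sum//; last first.
  by move=> i; apply: integrable_sum => // j _; exact: it.
rewrite -sumEFin; apply: eq_bigr => i _; rewrite integral_sum//; last by move=> j; exact: it.
rewrite -sumEFin; apply: eq_bigr => j _.
under eq_integral do rewrite EFinM.
by rewrite integralZl// ?expectation_mul//; exact: intble_mul.
Qed.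

Lemma linD a b w : lin (fun i => a i + b i) w = lin a w + lin b w.
Proof. by rewrite /lin -big_split/=; apply: eq_bigr => i _; rewrite mulrDl. Qed.

Lemma linZ (k : R) a w : lin (fun i => k * a i) w = k * lin a w.
Proof. by rewrite /lin mulr_sumr; apply: eq_bigr => i _; rewrite mulrA. Qed.

Lemma lin_delta i w : lin (fun j => (j == i)%:R) w = X i w.
Proof.
rewrite /lin (bigD1 i)//= eqxx mul1r big1 ?addr0// => j ji.
by rewrite (negbTE ji) mul0r.
Qed.

Lemma eq_lin a b w : a =1 b -> lin a w = lin b w.
Proof. by move=> ab; apply: eq_bigr => i _; rewrite ab. Qed.

Variables (S : set I) (u : I -> R).
Hypothesis orth : forall i, S i -> \sum_j u j * C j i = 0.

Definition supported a : Prop := forall i, ~ S i -> a i = 0.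

Let orth_lin a : supported a -> \sum_i \sum_j u i * a j * C i j = 0.
Proof.
move=> aS; rewrite exchange_big/= big1// => j _.
have [Sj|Sj] := pselect (S j); last by rewrite big1// => i _; rewrite aS// mulr0 mul0r.
transitivity (a j * \sum_i u i * C i j); last by rewrite orth// mulr0.
by rewrite mulr_sumr; apply: eq_bigr => i _; ring.
Qed.

Let gaussian_lin a : gaussian P (lin a).
Proof. by have [g _ _] := hX; exact: g. Qed.

(* Both sides are Gaussian with the same variance, as u is orthogonal to a. *)
Let reflected (t : R) a : supported a -> forall A : set R, measurable A ->
  P (lin (fun i => t * u i + a i) @^-1` A) = P (lin (fun i => - t * u i + a i) @^-1` A).
Proof.
move=> aS.
have var (k : R) : (\int[P]_w (lin (fun i => k * u i + a i) w ^+ 2)%:E =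
    (k ^+ 2 * (\sum_i \sum_j u i * u j * C i j) + \sum_i \sum_j a i * a j * C i j)%:E)%E.
  under eq_integral do rewrite expr2; rewrite expectation_lin_mul; congr EFin.
  have sym i j : C i j = C j i.
    by apply: EFin_inj; rewrite -!expectation_mul; apply: eq_integral => w _; rewrite mulrC.
  have o1 := orth_lin aS.
  have o2 : \sum_i \sum_j a i * u j * C i j = 0.
    rewrite exchange_big/= -[RHS]o1; apply: eq_bigr => i _; apply: eq_bigr => j _.
    by rewrite sym; ring.
  transitivity (k ^+ 2 * (\sum_i \sum_j u i * u j * C i j) +
     k * (\sum_i \sum_j u i * a j * C i j) + k * (\sum_i \sum_j a i * u j * C i j) +
     \sum_i \sum_j a i * a j * C i j); last by rewrite o1 o2 mulr0 !addr0.
  rewrite !mulr_sumr -!big_split/=; apply: eq_bigr => i _.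
  rewrite !mulr_sumr -!big_split/=; apply: eq_bigr => j _; ring.
apply: (@gaussian_same_law _ _ _ P _ _ (t ^+ 2 * (\sum_i \sum_j u i * u j * C i j) +
   \sum_i \sum_j a i * a j * C i j)); rewrite ?var ?sqrrN//;
  by [exact: gaussian_lin|exact: measurable_lin|exact: intble_lin|exact: null_mean_lin].
Qed.

Let U := lin u.

Let mU : measurable_fun setT U. Proof. exact: measurable_lin. Qed.

Let iU : intble P U. Proof. exact: intble_lin. Qed.

Let intble_bounded (f : T -> R) : measurable_fun setT f -> (forall w, `|f w| <= 1) -> intble P f.
Proof.
move=> mf f1; apply: (@intble_le _ _ _ _ _ (fun=> 1)) => //.
exact: finite_measure_integrable_cst.
Qed.

Let null_mean_law (f : R -> R) (Y Z : T -> R) : measurable_fun setT f ->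
  (forall x, `|f x| <= 1) -> measurable_fun setT Y -> measurable_fun setT Z ->
  (forall A : set R, measurable A -> P (Y @^-1` A) = P (Z @^-1` A)) ->
  null_mean P (fun w => f (Y w) - f (Z w)).
Proof.
move=> mf f1 mY mZ law.
have iY : intble P (fun w => f (Y w)) by apply: intble_bounded => //; exact: measurableT_comp.
have iZ : intble P (fun w => f (Z w)) by apply: intble_bounded => //; exact: measurableT_comp.
have e := @eq_law_integral _ _ _ _ _ P P _ _ mY mZ law (EFin \o f)
  ((measurable_EFinP _ _).2 mf) iY.
rewrite /null_mean; under eq_integral do rewrite EFinB.
rewrite (integralB_EFin measurableT iY iZ) -e subee//.
exact: (integrable_fin_num measurableT iY).
Qed.

(** By the addition formulas each product is, up to a factor, the difference of one function taken
    at tU + Y and at -tU + Y, which have the same law by [reflected]. *)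
Let sin_trig (t : R) a : supported a ->
  null_mean P (fun w => sin (t * U w) * cos (lin a w)) /\
  null_mean P (fun w => sin (t * U w) * sin (lin a w)).
Proof.
move=> aS; have law := reflected t aS.
have ml (k : R) := measurable_lin (fun i => k * u i + a i).
have msin : measurable_fun setT (@sin R) by apply: continuous_measurable_fun; exact: continuous_sin.
have mcos : measurable_fun setT (@cos R) by apply: continuous_measurable_fun; exact: continuous_cos.
have E (k : R) w : lin (fun i => k * u i + a i) w = k * U w + lin a w by rewrite linD linZ.
have isin (k : R) : intble P (fun w => sin (lin (fun i => k * u i + a i) w)).
  by apply: intble_bounded => [|w]; [exact: measurableT_comp|exact: sin_max].
have icos (k : R) : intble P (fun w => cos (lin (fun i => k * u i + a i) w)).
  by apply: intble_bounded => [|w]; [exact: measurableT_comp|exact: cos_max].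
split.
  rewrite (_ : (fun w => _) = (fun w => 2^-1 *
     (sin (lin (fun i => t * u i + a i) w) - sin (lin (fun i => - t * u i + a i) w)))).
    by apply: null_meanZ; [exact: intbleB|exact: (null_mean_law msin (@sin_max R))].
  apply/funext => w; rewrite !E !(addrC _ (lin a w)) (mulNr t).
  by have [-> _ _ _] := trig_shifts (t * U w) (lin a w); field.
rewrite (_ : (fun w => _) = (fun w => - 2^-1 *
   (cos (lin (fun i => t * u i + a i) w) - cos (lin (fun i => - t * u i + a i) w)))).
  by apply: null_meanZ; [exact: intbleB|exact: (null_mean_law mcos (@cos_max R))].
apply/funext => w; rewrite !E !(addrC _ (lin a w)) (mulNr t).
have [_ e _ _] := trig_shifts (t * U w) (lin a w).
by lra.
Qed.

(** Divide sin(tU) by t and let t = 1/n tend to 0, with |U| as dominating function. *)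
Let limit_trig (g : T -> R) : measurable_fun setT g -> (forall w, `|g w| <= 1) ->
  (forall t : R, null_mean P (fun w => sin (t * U w) * g w)) ->
  null_mean P (fun w => U w * g w).
Proof.
move=> mg g1 h.
apply: (@null_mean_limit _ _ _ _ (fun n w =>
   n.+1%:R * (sin (n.+1%:R^-1 * U w) * g w)) _ (fun w => `|U w|)).
- move=> n; apply: measurable_funM => //; apply: measurable_funM => //.
  by apply: measurable_sin_fun; apply: measurable_funM.
- exact: measurable_funM.
- move=> w; under eq_fun do rewrite mulrA [_^-1 * _]mulrC.
  by apply: cvgMr_tmp; exact: cvg_scaled_sin.
- move=> n w; rewrite mulrA normrM -[leRHS]mulr1 ler_pM//.
  rewrite normrM ger0_norm//; apply: le_trans (ler_wpM2l _ (abs_sin_le _)) _ => //.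
  by rewrite normrM mulrA ger0_norm ?invr_ge0// divff ?mul1r// pnatr_eq0.
- exact: intble_abs.
- move=> n; apply: null_meanZ => //; apply: intble_bounded.
    by apply: measurable_funM => //; apply: measurable_sin_fun; apply: measurable_funM.
  by move=> w; rewrite normrM mulr_ile1// sin_max.
Qed.

Let trig_lin a : supported a ->
  null_mean P (fun w => U w * cos (lin a w)) /\ null_mean P (fun w => U w * sin (lin a w)).
Proof.
move=> aS; split; apply: limit_trig.
- by apply: measurable_cos_fun; exact: measurable_lin.
- by move=> w; exact: cos_max.
- by move=> t; exact: (sin_trig t aS).1.
- by apply: measurable_sin_fun; exact: measurable_lin.
- by move=> w; exact: sin_max.
- by move=> t; exact: (sin_trig t aS).2.
Qed.

Definition halfspaces (s : seq (I * R)) (w : T) : R :=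
  \prod_(p <- s) (X p.1 w <= p.2)%R%:R.

Let measurable_halfspaces s : measurable_fun setT (halfspaces s).
Proof.
apply: measurable_prod => p _.
rewrite (_ : (fun w => _) = \1_[set w | X p.1 w <= p.2]).
  apply: measurable_indic; rewrite -[X in measurable X]setTI.
  exact: measurable_fun_le.
apply/funext => w; rewrite indicE.
suff -> : (w \in [set w | X p.1 w <= p.2]) = (X p.1 w <= p.2) by [].
by apply/idP/idP; rewrite inE.
Qed.

Let halfspaces_le1 s w : `|halfspaces s w| <= 1.
Proof.
rewrite /halfspaces; elim: s => [|p s IH]; first by rewrite big_nil normr1.
rewrite big_cons normrM mulr_ile1//.
by case: (X p.1 w <= p.2); rewrite ?normr1 ?normr0.
Qed.

(** Half-spaces are added one at a time. Shifting a by b at i turns the induction hypothesis into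
    the vanishing of the Fourier transform in X_i, and [trig_null_halfline] adds the condition X_i
    <= t. The factor in [lin a] is kept throughout to allow this shift. *)
Let trig_halfspaces s a : (forall p, p \in s -> S p.1) -> supported a ->
  null_mean P (fun w => U w * halfspaces s w * cos (lin a w)) /\
  null_mean P (fun w => U w * halfspaces s w * sin (lin a w)).
Proof.
elim: s a => [|[i t] s IH] a sS aS.
  rewrite /halfspaces; have [h1 h2] := trig_lin aS.
  by split; [move: h1|move: h2]; apply: etrans; apply: eq_integral => w _;
    rewrite big_nil mulr1.
have Si : S i by apply: (sS (i, t)); rewrite mem_head.
pose k w := U w * halfspaces s w.
have ik : intble P k by apply: (@intble_bounded_mul _ _ _ _ _ _ 1).
have shift (b : R) : supported (fun j => a j + b * (j == i)%:R).
  move=> j Sj; rewrite aS// (_ : (j == i) = false) ?mulr0 ?addr0//.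
  by apply/eqP => ji; apply: Sj; rewrite ji.
have hs p : p \in s -> S p.1 by move=> ps; apply: sS; rewrite inE ps orbT.
have lE (b : R) w : lin (fun j => a j + b * (j == i)%:R) w = lin a w + b * X i w.
  by rewrite linD linZ lin_delta.
have ml (b : R) := measurable_lin (fun j => a j + b * (j == i)%:R).
have ic (b : R) : intble P (fun w => 2^-1 * (k w * cos (lin (fun j => a j + b * (j == i)%:R) w))).
  apply: intbleZ; apply: (@intble_bounded_mul _ _ _ _ _ _ 1) => //.
    exact: measurable_cos_fun.
  by move=> w; exact: cos_max.
have is' (b : R) : intble P (fun w => 2^-1 * (k w * sin (lin (fun j => a j + b * (j == i)%:R) w))).
  apply: intbleZ; apply: (@intble_bounded_mul _ _ _ _ _ _ 1) => //.
    exact: measurable_sin_fun.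
  by move=> w; exact: sin_max.
have nc (b : R) : null_mean P (fun w => 2^-1 * (k w * cos (lin (fun j => a j + b * (j == i)%:R) w))).
  apply: null_meanZ; last exact: (IH _ hs (shift b)).1.
  apply: (@intble_bounded_mul _ _ _ _ _ _ 1) => //; first exact: measurable_cos_fun.
  by move=> w; exact: cos_max.
have ns (b : R) : null_mean P (fun w => 2^-1 * (k w * sin (lin (fun j => a j + b * (j == i)%:R) w))).
  apply: null_meanZ; last exact: (IH _ hs (shift b)).2.
  apply: (@intble_bounded_mul _ _ _ _ _ _ 1) => //; first exact: measurable_sin_fun.
  by move=> w; exact: sin_max.
split.
  rewrite (_ : (fun w => _) = (fun w => k w * cos (lin a w) * (X i w <= t)%R%:R)); last first.
    by apply/funext => w; rewrite /k /halfspaces big_cons/=; ring.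
  apply: trig_null_halfline => //.
    apply: (@intble_bounded_mul _ _ _ _ _ _ 1) => //.
      by apply: measurable_cos_fun; exact: measurable_lin.
    by move=> w; exact: cos_max.
  move=> b; split.
    move: (null_meanD (ic b) (ic (- b)) (nc b) (nc (- b))); apply: etrans.
    apply: eq_integral => w _; congr EFin; rewrite !lE mulNr.
    by have [_ _ _ e] := trig_shifts (b * X i w) (lin a w); move/(congr1 ( *%R (k w))): e; lra.
  move: (null_meanB (is' b) (is' (- b)) (ns b) (ns (- b))); apply: etrans.
  apply: eq_integral => w _; congr EFin; rewrite !lE mulNr.
    by have [e _ _ _] := trig_shifts (b * X i w) (lin a w); move/(congr1 ( *%R (k w))): e; lra.
rewrite (_ : (fun w => _) = (fun w => k w * sin (lin a w) * (X i w <= t)%R%:R)); last first.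
  by apply/funext => w; rewrite /k /halfspaces big_cons/=; ring.
apply: trig_null_halfline => //.
  apply: (@intble_bounded_mul _ _ _ _ _ _ 1) => //.
    by apply: measurable_sin_fun; exact: measurable_lin.
  by move=> w; exact: sin_max.
move=> b; split.
  move: (null_meanD (is' b) (is' (- b)) (ns b) (ns (- b))); apply: etrans.
  apply: eq_integral => w _; congr EFin; rewrite !lE mulNr.
    by have [_ _ e _] := trig_shifts (b * X i w) (lin a w); move/(congr1 ( *%R (k w))): e; lra.
move: (null_meanB (ic (- b)) (ic b) (nc (- b)) (nc b)); apply: etrans.
apply: eq_integral => w _; congr EFin; rewrite !lE mulNr.
    by have [_ e _ _] := trig_shifts (b * X i w) (lin a w); move/(congr1 ( *%R (k w))): e; lra.
Qed.

Let cylinders : set (set T) := [set A | exists s : seq (I * R),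
  (forall p, p \in s -> S p.1) /\ A = [set w | forall p, p \in s -> X p.1 w <= p.2]].

Let halfspacesE s w : halfspaces s w = \1_[set w | forall p, p \in s -> X p.1 w <= p.2] w.
Proof.
rewrite indicE /halfspaces; elim: s => [|p s IH].
  by rewrite big_nil mem_set.
rewrite big_cons IH -natrM mulnb; congr (nat_of_bool _)%:R.
apply/andP/idP => [[h1 /set_mem h2]|/set_mem h].
  by apply/mem_set => q /=; rewrite inE => /orP[/eqP ->|/h2].
split; first by apply: h; rewrite mem_head.
by apply/mem_set => q qs; apply: h; rewrite inE qs orbT.
Qed.

Let cylinder_mean A : cylinders A -> (\int[P]_(w in A) (U w)%:E = 0)%E.
Proof.
move=> [s [sS ->]]; rewrite integral_mkcond.
have := (trig_halfspaces sS (a := fun=> 0) (fun _ _ => erefl)).1; apply: etrans.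
apply: eq_integral => w _; rewrite patchE.
have -> : lin (fun=> 0) w = 0 by rewrite /lin big1// => i _; rewrite mul0r.
rewrite cos0 mulr1 halfspacesE indicE; case: ifP => _; rewrite ?mulr1 ?mulr0//.
Qed.

Let cylinders_measurable A : cylinders A -> measurable A.
Proof.
move=> [s [_ ->]]; elim: s => [|p s IH].
  by rewrite (_ : [set _ | _] = setT)//; apply/seteqP; split.
rewrite (_ : [set _ | _] = [set w | X p.1 w <= p.2] `&`
   [set w | forall q, q \in s -> X q.1 w <= q.2]).
  apply: measurableI => //; rewrite -[X in measurable X]setTI; exact: measurable_fun_le.
apply/seteqP; split=> w /= h.
  by split=> [|q qs]; apply: h; rewrite ?mem_head// inE qs orbT.
by move=> q; rewrite inE => /orP[/eqP ->|]; [exact: h.1|exact: h.2].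
Qed.

Let cylindersI : setI_closed cylinders.
Proof.
move=> _ _ [s [sS ->]] [t [tS ->]]; exists (s ++ t); split.
  by move=> p; rewrite mem_cat => /orP[/sS|/tS].
apply/seteqP; split=> w /= h.
  by move=> p; rewrite mem_cat => /orP[]; [exact: h.1|exact: h.2].
by split=> p ps; apply: h; rewrite mem_cat ps ?orbT.
Qed.

Let null_class : set (set T) :=
  [set A | measurable A /\ (\int[P]_(w in A) (U w)%:E = 0)%E].

Let null_class_dynkin : dynkin null_class.
Proof.
split.
- by split=> //; exact: null_mean_lin.
- move=> A [mA A0]; split; first exact: measurableC.
  have := null_mean_lin u; rewrite /null_mean -(setvU A) integral_setU_EFin//; last first.
  - by rewrite disj_set2E setICl.
  - exact: measurable_funTS (measurable_lin u).
  - exact: measurableC.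
  by rewrite A0 adde0.
- move=> F tF hF; split; first by apply: bigcupT_measurable => n; exact: (hF n).1.
  rewrite integral_bigcup//.
  + by rewrite eseries0// => n _ _; exact: (hF n).2.
  + by move=> n; exact: (hF n).1.
  + apply: integrableS iU => //; apply: bigcupT_measurable => n; exact: (hF n).1.
Qed.

(** The pi-lambda theorem: intersections of half-spaces form a pi-system, and the measurable sets
    over which U has zero integral form a Dynkin system. *)
Lemma projection_null A : sigma_of S X A ->
  measurable A /\ (\int[P]_(w in A) (U w)%:E = 0)%E.
Proof.
move=> SA; suff : null_class A by [].
have sub : <<s cylinders >> `<=` null_class.
  rewrite -(setI_closed_g_dynkin_g_sigma_algebra cylindersI).
  apply: smallest_sub; first exact: null_class_dynkin.
  by move=> B cB; split; [exact: cylinders_measurable|exact: cylinder_mean].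
apply: sub; move: A SA; apply: smallest_sub; first exact: smallest_sigma_algebra.
move=> _ [i Si [B mB <-]]; rewrite setTI.
have sB : <<s @RGenOInfty.G R >> B.
  have <- : @measurable _ (measurableTypeR R) = <<s @RGenOInfty.G R >> by exact: RGenOInfty.measurableE.
  exact: mB.
move: B sB {mB}; apply: smallest_sub => [|_ [x ->]] /=.
  have := @sigma_algebra_image T R setT (X i) <<s cylinders >> (smallest_sigma_algebra _ _).
  by rewrite /image_set_system; under eq_set do rewrite setTI.
rewrite -setCitvl preimage_setC -setTD.
have [_ cC _] := @smallest_sigma_algebra T setT cylinders.
apply: cC; apply: sub_sigma_algebra; exists [:: (i, x)]; split.
  by move=> p; rewrite inE => /eqP ->.
apply/seteqP; split=> w /=; rewrite in_itv/=.
  by move=> h p; rewrite inE => /eqP ->.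
by move=> /(_ (i, x)); rewrite mem_head => /(_ isT).
Qed.

End gaussian_projection.

(** * Almost sure uniqueness of conditional expectations *)

Section conditional_expectation.
Context {R : realType} {d : measure_display} {T : measurableType d}.
Variable P : probability T R.

(** The event Z < Y belongs to the sigma-algebra, and Y - Z, positive on it, has zero integral over
    it. *)
Lemma cond_exp_le (G : set (set T)) (X Y Z : T -> R) :
  (forall A, <<s G>> A -> measurable A) ->
  is_cond_exp P <<s G>> X Y -> is_cond_exp P <<s G>> X Z ->
  {ae P, forall w, Y w <= Z w}.
Proof.
move=> Gm [mY iY eY] [mZ iZ eZ].
have mY' : measurable_fun setT (Y : g_sigma_algebraType G -> R).
  by move=> _ B mB; rewrite setTI; exact: mY.
have mZ' : measurable_fun setT (Z : g_sigma_algebraType G -> R).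
  by move=> _ B mB; rewrite setTI; exact: mZ.
have GA : <<s G>> [set w | Z w < Y w].
  have := @measurable_fun_ltr _ (g_sigma_algebraType G) R setT _ _ mZ' mY'
    measurableT [set true] (I : measurable [set true]).
  by rewrite setTI.
have mA := Gm _ GA.
suff PA : P [set w | Z w < Y w] = 0%E.
  by exists [set w | Z w < Y w]; split => // w /= /negP; rewrite -ltNge.
have [YA ZA] : P.-integrable [set w | Z w < Y w] (EFin \o Y) /\
  P.-integrable [set w | Z w < Y w] (EFin \o Z).
  by split; apply: integrableS measurableT mA (@subsetT _ _) _.
have int0 : (\int[P]_(w in [set w | (Z w < Y w)%R]) (Y w - Z w)%R%:E = 0)%E.
  under eq_integral do rewrite EFinB.
  rewrite (integralB_EFin mA YA ZA) /comp eY// eZ// subee//.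
  rewrite -eZ//; exact: (integrable_fin_num mA ZA).
have mD : measurable_fun [set w | Z w < Y w] (fun w => (Y w - Z w)%:E).
  exact: (measurable_int _ (integrableB mA YA ZA)).
have /(ae_eq_integral_abs P mA mD) : (\int[P]_(w in [set w | (Z w < Y w)%R]) `|(Y w - Z w)%R%:E| = 0)%E.
  rewrite -[RHS]int0; apply: eq_integral => w; rewrite inE /= => h.
  by rewrite ger0_norm// subr_ge0 ltW.
move=> [E [mE PE sub]]; apply: (@subset_measure0 _ _ _ P _ E) => // w h.
by apply: sub => /(_ h) /= [/eqP]; rewrite subr_eq0 gt_eqF.
Qed.

Lemma cond_exp_ae_unique (G : set (set T)) (X Y Z : T -> R) :
  (forall A, <<s G>> A -> measurable A) ->
  is_cond_exp P <<s G>> X Y -> is_cond_exp P <<s G>> X Z ->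
  {ae P, forall w, Y w = Z w}.
Proof.
move=> Gm hY hZ; have := cond_exp_le Gm hZ hY; apply: filterS2 (cond_exp_le Gm hY hZ) => w yz zy.
by apply/le_anti; rewrite yz zy.
Qed.

End conditional_expectation.

Section gaussian_conditional_expectation.
Context {R : realType} {d : measure_display} {T : measurableType d}.
Variable P : probability T R.
Variables (I : finType) (X : I -> {RV P >-> R}) (C : I -> I -> R).
Hypothesis hX : centered_gaussian_field X (fun i j => (C i j)%:E).

Lemma sigma_of_measurable (S : set I) A : sigma_of S X A -> measurable A.
Proof.
have orth i : S i -> \sum_j 0 * C j i = 0 by move=> _; rewrite big1// => j _; rewrite mul0r.
by case/(projection_null hX orth).
Qed.

Lemma gaussian_cond_exp (S : set I) (a b : I -> R) :
  (forall i, S i -> \sum_j (a j - b j) * C j i = 0) ->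
  (forall i, ~ S i -> b i = 0) ->
  is_cond_exp P (sigma_of S X) (lin X a) (lin X b).
Proof.
move=> orth bS; split.
- have mb : measurable_fun setT (lin X b : g_sigma_algebraType
      (\bigcup_(i in S) preimage_set_system setT (X i) measurable) -> R).
    apply: measurable_sum => i; have [Si|Si] := pselect (S i); last first.
      rewrite (_ : (fun _ => _) = fun=> 0)//; apply/funext => w.
      by rewrite bS ?mul0r.
    apply: measurable_funM => // _ B mB; rewrite setTI.
    by apply: sub_sigma_algebra; exists i => //; exists B => //; rewrite setTI.
  by move=> B mB; have := mb measurableT B mB; rewrite setTI.
- exact: (intble_lin hX).
- move=> A SA; have [mA] := projection_null hX orth SA.
  have iS c : P.-integrable A (EFin \o lin X c).
    by apply: integrableS (intble_lin hX c).
  have -> : (\int[P]_(w in A) (lin X a w)%:E =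
      \int[P]_(w in A) ((EFin \o lin X (fun i => (a i - b i)%R)) w + (EFin \o lin X b) w))%E.
    apply: eq_integral => w _; rewrite /= -EFinD -linD; congr EFin.
    by apply: eq_lin => i; rewrite subrK.
  by rewrite (integralD mA (iS _) (iS _)) => ->; rewrite add0e.
Qed.

End gaussian_conditional_expectation.

(** * Covariances of the scale-inhomogeneous field *)

Section box_radius.
Context {R : realType}.
Implicit Types (N : nat) (l : R).

(** Sites differ by integers, so truncating the half-width does not change the box; the two special
    values give all of V_N and the single site v. *)
Definition radius N l : nat :=
  if l == 0 then N else if l == 1 then 0 else Num.trunc (2^-1 * N%:R `^ (1 - l)).

Lemma linf_le_size N (x v : V N) : (linf x v <= N)%N.
Proof.
have h (i j : 'I_N.+1) : (dn i j <= N)%N by have := ltn_ord i; have := ltn_ord j; rewrite /dn; lia.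
by rewrite /linf geq_max !h.
Qed.

Lemma nbox_interior N (v w : V N) l :
  box_interior (nbox N (site v) l) (site w) <-> dom v (radius N l) w.
Proof.
rewrite /nbox /radius; case: ifP => [_|/eqP l0].
  by apply: box_interior_dom => // x; split=> _; [exact: linf_le_size|exists x].
case: ifP => [_|/eqP l1].
  apply: box_interior_dom => [x|_ ->]; last by exists v.
  rewrite leqn0; split=> [/site_inj ->|]; first by rewrite /linf /dn; lia.
  rewrite /linf /dn => h; congr site; apply: eq_site; lia.
apply: box_interior_dom => [x|x []//].
have r0 : 0 <= 2^-1 * N%:R `^ (1 - l) :> R by rewrite mulr_ge0// powR_ge0.
rewrite /linf geq_max !truncn_ge_nat// !dnE -!abs_coord.
have E (i j : nat) : `|i%:R - (Posz j)%:~R : R| = `|(Posz i - Posz j)%:~R| by rewrite rmorphB.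
rewrite !E; split=> [[_ /= [-> ->]]//|/andP[h1 h2]].
by split; [exists x|].
Qed.

Lemma radius_noninc N l l' : 0 <= l -> l < l' -> l' <= 1 ->
  (radius N l' <= radius N l)%N.
Proof.
move=> l0 ll' l'1; rewrite /radius.
have l'0 : l' == 0 = false by apply/gt_eqF; apply: le_lt_trans ll'.
have l1 : l == 1 = false by apply/lt_eqF; apply: lt_le_trans ll' _.
rewrite l'0 l1; have [//|l'1'] := eqVneq l' 1.
have l'lt : l' < 1 by rewrite lt_neqAle l'1' l'1.
case: N => [|N].
  by rewrite powR0 ?subr_eq0 1?eq_sym// mulr0 truncn0.
have half x : 0 <= x -> 2^-1 * x <= x :> R by move=> x0; lra.
have N1 : 1 <= N.+1%:R :> R by rewrite ler1n.
case: ifP => [_|/eqP/eqP l0'].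
  rewrite -[leqRHS](@natrK R); apply: le_truncn; apply: le_trans (half _ (powR_ge0 _ _)) _.
  by apply: ler1_powR => //; lra.
apply: le_truncn; apply: ler_wpM2l => //; apply: ler_powR => //; lra.
Qed.

End box_radius.

Section conditional_field.
Context {R : realType} {N : nat} {d : measure_display} {T : measurableType d}.
Variable P : probability T R.
Variables (X : V N -> {RV P >-> R}).
Hypothesis hX : centered_gaussian_field X
  (fun v w => (pi / 2 * gr (@inner N) v w)%:E).

(** For i outside D the function gr(., i) is harmonic in D, so its value at v equals its average
    over the exit distribution: phi_v minus the harmonic average is uncorrelated with phi_i. *)
Lemma harmonic_cond_exp (D : pred (V N)) (v : V N) : (forall x, D x -> inner x) ->
  is_cond_exp P (sigma_of [set w | ~ D w] X) (X v) (lin X (harm D v)).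
Proof.
move=> Di; have -> : X v = lin X (fun w => (w == v)%:R) :> (T -> R).
  by apply/funext => w; rewrite lin_delta.
apply: (gaussian_cond_exp hX) => [i /= /negP Di'|w /contrapT]; last exact: harm_in.
transitivity ((pi : R) / 2 * (gr (@inner N) v i - ext D (gr (@inner N) ^~ i) v)).
  rewrite mulrBr /ext mulr_sumr; under eq_bigr do rewrite mulrBl.
  rewrite sumrB (bigD1 v)//= eqxx mul1r big1 ?addr0 => [|j jv]; last by rewrite (negbTE jv) mul0r.
  by congr (_ - _); apply: eq_bigr => j _; rewrite mulrCA.
rewrite dynkin_formula// big1 ?addr0 ?subrr ?mulr0// => z _.
have [Dz|Dz] := boolP (D z); last by rewrite gr_outr// mul0r.
have := gr_pole (fun x : V N => id) i (Di _ Dz).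
have -> : z == i = false by apply: contraNF Di' => /eqP <-.
by move=> e; rewrite -opprB e oppr0 mulr0.
Qed.

End conditional_field.

Section scale_sequence.
Context {R : realType} (M : nat) (t : nat -> R).
Hypothesis ht : scales M t.

Lemma scales_gt0 : (0 < M)%N.
Proof. by have [t0 t1 _] := ht; case: M t1 => // /esym/eqP; rewrite t0 oner_eq0. Qed.

Lemma scales_le i j : (i <= j <= M)%N -> t i <= t j.
Proof.
have [_ _ lt] := ht; elim: j => [|j IH]; first by rewrite leqn0 => /andP[/eqP ->].
rewrite leq_eqVlt => /andP[/orP[/eqP -> //|ij] jM].
by apply: le_trans (IH _) (ltW (lt _ jM)); rewrite -ltnS ij ltnW.
Qed.

Lemma scales_itv i : (i <= M)%N -> 0 <= t i <= 1.
Proof. by move=> iM; have [<- <- _] := ht; rewrite !scales_le ?leq0n ?leqnn ?iM. Qed.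

End scale_sequence.

Section field_covariance.
Context {R : realType} (d : nat -> measure_display).
Variables (T : forall N : nat, measurableType (d N)).
Variables (P : forall N : nat, probability (T N) R).
Variables (phi : forall N : nat, V N -> {RV (P N) >-> R}).
Context {dW : measure_display} {TW : measurableType dW}.
Variables (PW : Z2 -> probability TW R) (W : nat -> TW -> Z2).
Hypothesis hW : forall v : Z2, simple_random_walk (PW v) W v.
Hypothesis hphi : is_gff phi PW W.
Variable cphi : forall N : nat, V N -> R -> T N -> R.
Hypothesis hcphi : are_cond_exps phi cphi.
Variables (M : nat) (sigma lambda : nat -> R).
Hypothesis hlambda : scales M lambda.
Implicit Types (N : nat).

Let gaussian_gr N : centered_gaussian_field (phi (N := N))
  (fun v w => (pi / 2 * gr (@inner N) v w)%:E).
Proof.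
have [h1 h2 h3] := hphi N; split=> // v w; rewrite h3; exact: green_gr.
Qed.

Lemma cphi_harmonic N (v : V N) (l : R) : 0 <= l <= 1 ->
  {ae P N, forall w, cphi v l w = lin (phi (N := N)) (harm (dom v (radius N l)) v) w}.
Proof.
move=> hl; have h := hcphi v hl.
have sE : sigma_alg phi v l = sigma_of [set w | ~ dom v (radius N l) w] (phi (N := N)).
  rewrite /sigma_alg; congr (sigma_of _ _); apply/seteqP.
  by split=> w /= nd h'; apply: nd; apply/nbox_interior.
rewrite sE in h.
have h' := harmonic_cond_exp (gaussian_gr N) v (@dom_inner N v (radius N l)).
exact: (cond_exp_ae_unique (@sigma_of_measurable _ _ _ _ _ _ _ (gaussian_gr N) _) h h').
Qed.

Definition scale_radius N (i : nat) : nat := radius N (lambda i).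

Definition field_coef N (v x : V N) : R := \sum_(i < M) sigma i.+1 *
  (harm (dom v (scale_radius N i.+1)) v x - harm (dom v (scale_radius N i)) v x).

Lemma psi_harmonic N (v : V N) :
  {ae P N, forall w, psi cphi M sigma lambda v w = lin (phi (N := N)) (field_coef v) w}.
Proof.
have : {ae P N, forall w, forall i : 'I_M.+1,
    cphi v (lambda i) w = lin (phi (N := N)) (harm (dom v (scale_radius N i)) v) w}.
  apply: filter_forall => i; apply: cphi_harmonic.
  by apply: (scales_itv hlambda); rewrite -ltnS.
apply: filterS => w h; rewrite /psi big_add1 big_mkord /lin.
under [RHS]eq_bigr do rewrite mulr_suml.
rewrite exchange_big/=; apply: eq_bigr => i _.
have := h (lift ord0 i); have := h (widen_ord (leqnSn M) i); rewrite /= /bump/= add1n => -> ->.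
rewrite /lin -sumrB mulr_sumr; apply: eq_bigr => x _; ring.
Qed.

Lemma measurable_psi N (v : V N) : measurable_fun setT (psi cphi M sigma lambda v).
Proof.
have mc i : (i <= M)%N -> measurable_fun setT (cphi v (lambda i)).
  move=> iM; have [_ + _] := hcphi v (scales_itv hlambda iM).
  by move=> /integrableP[/measurable_EFinP].
rewrite (_ : psi _ _ _ _ v = fun w => \sum_(i < M)
    sigma i.+1 * (cphi v (lambda i.+1) w - cphi v (lambda i) w)).
  apply: measurable_sum => i; apply: measurable_funM => //.
  by apply: measurable_funB; apply: mc => //; exact: ltnW.
by apply/funext => w; rewrite /psi big_add1 big_mkord.
Qed.

Lemma psi_covariance N (v v' : V N) :
  ('E_(P N)[fun w => (psi cphi M sigma lambda v w * psi cphi M sigma lambda v' w)%R] =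
   (pi / 2 * fieldcov M sigma (scale_radius N) v v')%:E)%E.
Proof.
transitivity (\int[P N]_w (lin (phi (N := N)) (field_coef v) w *
   lin (phi (N := N)) (field_coef v') w)%R%:E)%E.
  rewrite expectation.unlock; apply: ae_eq_integral => //.
  - by apply/measurable_EFinP; apply: measurable_funM; exact: measurable_psi.
  - by apply/measurable_EFinP; apply: measurable_funM; exact: measurable_lin.
  - apply: filterS2 (psi_harmonic v) (psi_harmonic v') => w e e' _ /=.
    by rewrite e e'.
rewrite (expectation_lin_mul (gaussian_gr N)); congr EFin.
have covE s s' : cov v s v' s' = \sum_x \sum_y
    harm (dom v s) v x * harm (dom v' s') v' y * gr (@inner N) x y :> R.
  rewrite /cov /ext; apply: eq_bigr => x _; rewrite mulr_sumr.
  by apply: eq_bigr => y _; rewrite mulrA.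
transitivity (pi / 2 * \sum_x \sum_y field_coef v x * field_coef v' y * gr (@inner N) x y).
  rewrite mulr_sumr; apply: eq_bigr => x _; rewrite mulr_sumr; apply: eq_bigr => y _.
  by ring.
congr (_ * _); rewrite /fieldcov.
under eq_bigr => x _ do under eq_bigr => y _ do rewrite /field_coef mulr_suml mulr_suml.
under eq_bigr => x _ do rewrite exchange_big/=.
rewrite exchange_big/=; apply: eq_bigr => i _.
under eq_bigr => x _ do under eq_bigr => y _ do rewrite mulr_sumr mulr_suml.
under eq_bigr => x _ do rewrite exchange_big/=.
rewrite exchange_big/=; apply: eq_bigr => j _.
rewrite /incr2 !covE -!sumrB -big_split/= mulr_sumr; apply: eq_bigr => x _.
rewrite -!sumrB -big_split/= mulr_sumr; apply: eq_bigr => y _.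
by ring.
Qed.

Lemma gibbs_total N (beta : R) (w : T N) :
  \sum_v gibbs cphi M sigma lambda beta w v = 1.
Proof.
rewrite /gibbs -mulr_suml divff// gt_eqF//.
rewrite (bigD1 (ord0, ord0))//= ltr_pwDl ?expR_gt0//.
by apply: sumr_ge0 => v _; exact: expR_ge0.
Qed.

End field_covariance.

(** * Positivity of the total variance *)

Section effective_variance.
Context {R : realType} (M : nat) (sigma lambda : nat -> R).
Hypothesis hsigma : forall i : nat, (1 <= i <= M)%N -> 0 < sigma i.
Hypothesis hlambda : scales M lambda.

Let sg := step_fun M sigma lambda.

Let measurable_sg : measurable_fun setT sg.
Proof.
have mb (B : set R) (b : R -> bool) : measurable B -> (forall x, b x <-> B x) ->
    measurable_fun setT (fun x => (b x)%:R : R).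
  move=> mB bB; rewrite (_ : (fun _ => _) = \1_B); first exact: measurable_indic.
  apply/funext => x; rewrite indicE; congr (nat_of_bool _)%:R.
  by apply/idP/idP => [/bB/mem_set|/set_mem/bB].
apply: measurable_funD.
  by apply: measurable_funM => //; apply: (mb [set 0]) => // x; split=> [/eqP|->].
apply: measurable_sum => i; apply: measurable_funM => //.
apply: (mb `]lambda i.-1, lambda i]%classic (fun x => lambda i.-1 < x <= lambda i)) => [|x] /=; first exact: measurable_itv.
by rewrite in_itv.
Qed.

Let sg_ge (s : R) : 0 <= sg s.
Proof.
have M0 := scales_gt0 hlambda.
rewrite /sg /step_fun addr_ge0//; first by rewrite mulr_ge0// ltW// hsigma// M0.
rewrite big_nat_cond; apply: sumr_ge0 => i; rewrite andbT ltnS => iM.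
by rewrite mulr_ge0// ltW// hsigma.
Qed.

Let sg_le (s : R) : sg s <= sigma 1%N + \sum_(1 <= i < M.+1) sigma i.
Proof.
have M0 := scales_gt0 hlambda; have b01 (b : bool) : b%:R <= 1 :> R by case: b.
rewrite lerD//; first by rewrite ler_piMr// ltW// hsigma// M0.
rewrite ler_sum_nat// => i iM; rewrite ler_piMr// ltW// hsigma//.
Qed.

Lemma J2_gt0 : 0 < J2 sg 0 1.
Proof.
have M0 := scales_gt0 hlambda; have s1 : 0 < sigma 1%N by rewrite hsigma// M0.
have l1 : 0 < lambda 1%N by have [<- _ ->] := hlambda.
have l1' : lambda 1%N <= 1 by have /andP[] := scales_itv hlambda M0.
have msq (D : set R) : measurable_fun D (fun s => (sg s ^+ 2)%:E).
  by apply/measurable_EFinP; apply: measurable_funX; apply: measurable_funTS.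
have sub : (`]0, lambda 1%N] : set R) `<=` `[0, 1].
  by move=> x /=; rewrite !in_itv/= => /andP[/ltW -> h]; exact: le_trans h l1'.
(* [J2] takes the [fine] part of an integral, which would be 0 for an infinite one; finiteness comes
   first. *)
have int : (@lebesgue_measure R).-integrable `[0, 1]%classic (fun s => (sg s ^+ 2)%:E).
  apply: measurable_bounded_integrable => //.
  - have : (lebesgue_measure (`[0%R, 1%R] : set R) < +oo)%E; last exact.
    by rewrite lebesgue_measure_itv/= lte_fin ltr01 oppr0 adde0 ltry.
  - by apply: measurable_funX; apply: measurable_funTS.
  - exists ((sigma 1%N + \sum_(1 <= i < M.+1) sigma i) ^+ 2); split; rewrite ?num_real// => x hx y _ /=.
    apply: le_trans (ltW hx); rewrite ger0_norm ?sqr_ge0// lerXn2r ?nnegrE//.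
    exact: le_trans (sg_ge y) (sg_le y).
rewrite /J2 /Rintegral -lte_fin fineK; last exact: (integrable_fin_num _ int).
apply: (@lt_le_trans _ _ (\int[lebesgue_measure]_(s in `]0%R, lambda 1%N]) (sigma 1%N ^+ 2)%:E)%E).
  rewrite integral_cst//; apply: mule_gt0; first by rewrite lte_fin exprn_gt0.
  have : (0 < lebesgue_measure (`]0%R, lambda 1%N] : set R))%E; last exact.
  by rewrite lebesgue_measure_itv/= lte_fin l1 oppr0 adde0 lte_fin.
apply: (@le_trans _ _ (\int[lebesgue_measure]_(s in `]0%R, lambda 1%N]) (sg s ^+ 2)%:E)%E);
  last by apply: ge0_subset_integral; rewrite ?lee_fin//; [exact: measurable_itv..|exact: msq|move=> x _; rewrite lee_fin sqr_ge0].
apply: ge0_le_integral => //.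
- by move=> x _; rewrite lee_fin sqr_ge0.
- exact: msq.
move=> x; rewrite /= in_itv/= => xl; rewrite lee_fin lerXn2r ?nnegrE ?sg_ge// ?(ltW s1)//.
rewrite /sg /step_fun big_ltn//= addrCA; have [-> _ _] := hlambda.
rewrite xl mulr1 lerDl addr_ge0//; first by rewrite mulr_ge0// ltW.
rewrite big_nat_cond; apply: sumr_ge0 => i; rewrite andbT ltnS => /andP[i1 iM].
by rewrite mulr_ge0// ltW// hsigma// iM (ltnW i1).
Qed.

End effective_variance.

(** * Uniform approximate ultrametricity of the overlaps *)

Section overlap_asymptotics.
Context {R : realType} (d : nat -> measure_display).
Variables (T : forall N : nat, measurableType (d N)).
Variables (P : forall N : nat, probability (T N) R).
Variables (phi : forall N : nat, V N -> {RV (P N) >-> R}).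
Context {dW : measure_display} {TW : measurableType dW}.
Variables (PW : Z2 -> probability TW R) (W : nat -> TW -> Z2).
Hypothesis hW : forall v : Z2, simple_random_walk (PW v) W v.
Hypothesis hphi : is_gff phi PW W.
Variable cphi : forall N : nat, V N -> R -> T N -> R.
Hypothesis hcphi : are_cond_exps phi cphi.
Variables (M : nat) (sigma lambda : nat -> R).
Hypothesis hsigma : forall i : nat, (1 <= i <= M)%N -> 0 < sigma i.
Hypothesis hlambda : scales M lambda.
Variable C0 : R.
Hypothesis C0_gt0 : 0 < C0.

Lemma overlap_ultrametric (e : R) : 0 < e -> exists N0 : nat, forall N : nat,
  (N0 <= N)%N -> forall v1 v2 v3 : V N,
  Num.min (overlap P cphi M sigma lambda C0 v1 v3) (overlap P cphi M sigma lambda C0 v2 v3)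
    - overlap P cphi M sigma lambda C0 v1 v2 <= e.
Proof.
move=> e0; have J0 := J2_gt0 hsigma hlambda; set J := J2 _ _ _ in J0.
(* Once ln N >= B, the covariance defect divided by J ln N is at most e. *)
pose B := (pi / 2 * defect M sigma) / e / J : R.
exists (Num.trunc (expR B)).+1 => N hN v1 v2 v3.
have lnB : B <= ln N%:R.
  rewrite -[leLHS]expRK ler_ln ?posrE ?expR_gt0//; last by rewrite ltr0n; lia.
  by apply: ltW; apply: lt_le_trans (truncnS_gt _) _; rewrite ler_nat.
have lnN : 0 <= ln N%:R :> R by rewrite ln_ge0// ler1n; lia.
pose L := J * ln N%:R + C0; have L0 : 0 < L by rewrite ltr_wpDl// mulr_ge0// ltW.
have p0 : 0 <= (pi : R) / 2 by have := pi_ge0 R; lra.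
have ovE (v v' : V N) : overlap P cphi M sigma lambda C0 v v' =
    pi / 2 * fieldcov M sigma (scale_radius lambda N) v v' / L.
  by rewrite /overlap (psi_covariance hW hphi hcphi).
have s0 i : (i < M)%N -> 0 < sigma i.+1 by move=> iM; exact: hsigma.
have sn i : (i < M)%N -> (scale_radius lambda N i.+1 <= scale_radius lambda N i)%N.
  move=> iM; have [_ _ lt] := hlambda.
  have /andP[l0 _] := scales_itv hlambda (ltnW iM); have /andP[_ l1] := scales_itv hlambda iM.
  exact: radius_noninc l0 (lt _ iM) l1.
have := fieldcov_ultrametric s0 sn v1 v2 v3.
rewrite !ovE -minr_pMl ?invr_ge0 ?(ltW L0)// -minr_pMr// -mulrBl -mulrBr => h.
rewrite ler_pdivrMr//; apply: le_trans (ler_wpM2l p0 h) _.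
have : B * J <= ln N%:R * J by rewrite ler_pM2r.
rewrite /B divfK ?gt_eqF// ler_pdivrMr// => h'; apply: le_trans h' _.
rewrite mulrC ler_pM2l// /L [J * _]mulrC lerDl ltW//.
Qed.

End overlap_asymptotics.

(** * Gibbs averages of the ultrametricity violation *)

Section violation.
Context {R : realType}.

Definition pair_index (i j : 'I_3) (ij : (i < j)%N) : 'I_#|upper_pairs 3| :=
  @enum_rank_in _ (i, j) (upper_pairs 3) ij (i, j).

Lemma offdiagE (A : 'M[R]_3) (i j : 'I_3) (ij : (i < j)%N) : offdiag A 0 (pair_index ij) = A i j.
Proof. by rewrite mxE enum_rankK_in. Qed.

Let r1 : 'I_3 := @Ordinal 3 0 isT.
Let r2 : 'I_3 := @Ordinal 3 1 isT.
Let r3 : 'I_3 := @Ordinal 3 2 isT.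

Definition violation (X : 'rV[R]_#|upper_pairs 3|) : R :=
  Num.max 0 (Num.min (X 0 (@pair_index r1 r3 isT)) (X 0 (@pair_index r2 r3 isT))
    - X 0 (@pair_index r1 r2 isT)).

Lemma continuous_violation : continuous violation.
Proof.
have c k x : {for x, continuous (fun X : 'rV[R]_#|upper_pairs 3| => X 0 k)}.
  exact: coord_continuous.
move=> x.
pose m : 'rV[R]_#|upper_pairs 3| -> R^o :=
  (fun X => X 0 (@pair_index r1 r3 isT)) \min (fun X => X 0 (@pair_index r2 r3 isT)).
have cm : {for x, continuous m} by apply: continuous_min; exact: c.
pose f : 'rV[R]_#|upper_pairs 3| -> R^o := fun X => m X - X 0 (@pair_index r1 r2 isT).
have cf : {for x, continuous f} by apply: continuousB => //; exact: (c _ x).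
have c0 : {for x, continuous (fun=> 0 : R^o)} by move=> ? ?; exact: cst_continuous.
exact: (continuous_max c0 cf).
Qed.

Lemma violation_ge0 X : 0 <= violation X.
Proof. by rewrite /violation le_max lexx. Qed.

Lemma violationE (A : 'M[R]_3) :
  violation (offdiag A) = Num.max 0 (Num.min (A r1 r3) (A r2 r3) - A r1 r2).
Proof. by rewrite /violation !offdiagE. Qed.

End violation.

Section gibbs_bound.
Context {R : realType} (d : nat -> measure_display).
Variables (T : forall N : nat, measurableType (d N)).
Variables (P : forall N : nat, probability (T N) R).
Variable cphi : forall N : nat, V N -> R -> T N -> R.
Variables (M : nat) (sigma lambda : nat -> R) (beta : R).
Hypothesis mpsi : forall N (v : V N), measurable_fun setT (psi cphi M sigma lambda v).

Let g N (w : T N) (v : V N) : R := gibbs cphi M sigma lambda beta w v.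

Let Z N (w : T N) : R := \sum_(u : V N) expR (beta * psi cphi M sigma lambda u w).

Let Z_gt0 N (w : T N) : 0 < Z w.
Proof.
rewrite /Z (bigD1 (ord0, ord0))//= ltr_pwDl ?expR_gt0//.
by apply: sumr_ge0 => v _; exact: expR_ge0.
Qed.

Lemma gibbs_ge0 N (w : T N) v : 0 <= g w v.
Proof. by apply: mulr_ge0; [exact: expR_ge0|rewrite invr_ge0; apply/ltW/Z_gt0]. Qed.

Lemma measurable_gibbs N (v : V N) : measurable_fun setT (g (N := N) ^~ v).
Proof.
(* The quotient is written as the exponential of a difference, a composition of measurable
   functions. *)
rewrite (_ : (g (N := N)) ^~ v = fun w => expR (beta * psi cphi M sigma lambda v w - ln (Z w))).
  apply: measurableT_comp => //; apply: measurable_funB; first by (apply: measurable_funM => //; exact: mpsi).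
  apply: measurableT_comp => //; apply: measurable_sum => u.
  by apply: measurableT_comp => //; (apply: measurable_funM => //; exact: mpsi).
by apply/funext => w; rewrite expRD expRN lnK// posrE.
Qed.

Lemma gibbs_tuple_total N s (w : T N) :
  \sum_(v : s.-tuple (V N)) \prod_(l < s) g w (tnth v l) = 1.
Proof.
transitivity (\prod_(l < s) \sum_v g w v).
  rewrite bigA_distr_bigA/= (reindex (@tuple_of_finfun _ s))/=.
    by apply: eq_bigr => f _; apply: eq_bigr => l _; rewrite tnth_mktuple.
  by exists (@finfun_of_tuple _ s) => x _; rewrite ?tuple_of_finfunK ?finfun_of_tupleK.
by rewrite big1// => l _; exact: gibbs_total.
Qed.

Lemma gibbs_average_le N s (f : s.-tuple (V N) -> R) (e : R) :
  (forall v, 0 <= f v <= e) ->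
  (0 <= gibbs_average P cphi M sigma lambda beta f <= e%:E)%E.
Proof.
move=> fe; rewrite /gibbs_average expectation.unlock; apply/andP; split.
  apply: integral_ge0 => w _; rewrite lee_fin sumr_ge0// => v _.
  rewrite mulr_ge0//; last by have /andP[] := fe v.
  by apply: prodr_ge0 => l _; exact: gibbs_ge0.
have := expectation_cst (P N) e; rewrite expectation.unlock => <-.
apply: ge0_le_integral => //.
- move=> w _; rewrite lee_fin sumr_ge0// => v _.
  rewrite mulr_ge0//; last by have /andP[] := fe v.
  by apply: prodr_ge0 => l _; exact: gibbs_ge0.
- apply/measurable_EFinP; apply: measurable_sum => v; apply: measurable_funM => //.
  by apply: measurable_prod => l _; exact: measurable_gibbs.
- exact/measurable_EFinP.
- move=> w _; rewrite /= lee_fin.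
  have -> : e = \sum_(v : s.-tuple (V N)) (\prod_(l < s) g w (tnth v l)) * e.
    by rewrite -mulr_suml gibbs_tuple_total mul1r.
  apply: ler_sum => v _; have /andP[_ fv] := fe v; apply: ler_pM => //.
    by apply: prodr_ge0 => l _; exact: gibbs_ge0.
  by have /andP[] := fe v.
Qed.

End gibbs_bound.

Lemma homo_ltn_ge (f : nat -> nat) : {homo f : i j / (i < j)%N} -> forall n, (n <= f n)%N.
Proof. by move=> hf; elim=> // n IH; apply: leq_ltn_trans IH (hf _ _ (ltnSn n)). Qed.

Lemma violation_average_eq0 (R : realType) (d : nat -> measure_display)
  (T : forall N : nat, measurableType (d N)) (P : forall N : nat, probability (T N) R)
  (phi : forall N : nat, V N -> {RV (P N) >-> R})
  (dW : measure_display) (TW : measurableType dW)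
  (PW : Z2 -> probability TW R) (W : nat -> TW -> Z2)
  (cphi : forall N : nat, V N -> R -> T N -> R)
  (M : nat) (sigma lambda : nat -> R) (C0 beta : R)
  (H : completeNormedModType R) (ip : {dot H for idfun}) (x : R)
  (dS : measure_display) (S : measurableType dS) (PS : probability S R)
  (mu : {RV PS >-> pprobability (borel H) R}) :
  (forall v : Z2, simple_random_walk (PW v) W v) ->
  is_gff phi PW W -> are_cond_exps phi cphi ->
  (forall i : nat, (1 <= i <= M)%N -> 0 < sigma i) -> scales M lambda -> 0 < C0 ->
  subsequential_limit P cphi M sigma lambda C0 beta ip x mu ->
  replica_average mu (fun rho : 3.-tuple (borel H) =>
    violation (offdiag (replica_array ip x rho))) = 0%E.
Proof.
move=> hW hphi hcphi hsigma hlambda hC0 [_ [Nn [hNn lim]]].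
have {}lim := lim 3%N violation (continuous_subspaceT (@continuous_violation R)).
have mpsi N (v : V N) := measurable_psi hcphi sigma hlambda v.
set A := replica_average _ _ in lim *.
have A0 : (0 <= A)%E.
  by apply: integral_ge0 => w _; apply: integral_ge0 => rho _; rewrite lee_fin violation_ge0.
apply/eqP; rewrite eq_le A0 andbT; apply/lee_addgt0Pr => e e0; rewrite add0e.
have [N0 hN0] := overlap_ultrametric hW hphi hcphi hsigma hlambda hC0 e0.
apply: (cvge_le _ lim); exists N0 => // n /= nN.
have hn : (N0 <= Nn n)%N by apply: leq_trans nN (homo_ltn_ge hNn n).
have bound (v : 3.-tuple (V (Nn n))) :
    0 <= violation (offdiag (overlap_array P cphi M sigma lambda C0 v)) <= e.
  by rewrite violation_ge0 violationE !mxE ge_max (ltW e0)/=; exact: hN0.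
by have /andP[] := gibbs_average_le P beta mpsi bound.
Qed.

(** * Replicas of a random measure *)

Section random_probabilities.
Context {R : realType} {dS d : measure_display}.
Context {S : measurableType dS} {T : measurableType d}.

(** The sigma-algebra on probability measures is generated by the evaluations at measurable sets. *)
Lemma measurable_pprobability (q : S -> pprobability T R) :
  (forall U, measurable U -> measurable_fun setT (fun w => q w U)) ->
  measurable_fun setT q.
Proof.
move=> mq; apply: (measurability (@pset _ _ _ : set (set (pprobability T R)))) => //.
move=> _ [_ [r r01] [U mU <-]] <-.
rewrite /mset /preimage/=; apply: emeasurable_fun_infty_o => //; exact: mq.
Qed.

Variable q : S -> pprobability T R.
Hypothesis mq : measurable_fun setT q.

Lemma measurable_prob_eval (U : set T) : measurable U ->
  measurable_fun setT (fun w => q w U).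
Proof. exact: (measurable_kernel (kprobability mq)). Qed.

Lemma measurable_prob_integral (k : S * T -> \bar R) :
  (forall z, (0 <= k z)%E) -> measurable_fun setT k ->
  measurable_fun setT (fun w => \int[q w]_y k (w, y))%E.
Proof.
move=> k0 mk; exact: (measurable_fun_integral_finite_kernel k (kprobability mq)).
Qed.

Lemma measurable_prob_section (A : set (S * T)) : measurable A ->
  measurable_fun setT (fun w => q w (xsection A w)).
Proof.
move=> mA.
exact: (measurable_fun_xsection_finite_kernel (kprobability mq) (mem_set mA)).
Qed.

End random_probabilities.

Section power_measure.
Context {R : realType} {dS d : measure_display}.
Context {S : measurableType dS} {T : measurableType d}.

(** The measure of a set is the integral over the first coordinate x of the measures of its
    sections, which form a measurable function of the enlarged parameter (w, x). *)
Lemma measurable_power (q : S -> pprobability T R) (n : nat) : measurable_fun setT q ->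
  measurable_fun setT (fun w => power (q w) n : pprobability (n.-tuple T) R).
Proof.
move=> mq; elim: n => [|n IH]; first exact: measurable_cst.
apply: measurable_pprobability => U mU.
pose B := (@tuple_cons d T n) @^-1` U.
have mB : measurable B by rewrite -[B]setTI; exact: measurable_tuple_cons.
pose p (z : S * T) : pprobability (n.-tuple T) R := power (q z.1) n.
have mp : measurable_fun setT p by exact: (measurableT_comp IH).
pose A : set ((S * T) * n.-tuple T) := [set z | B (z.1.2, z.2)].
have mA : measurable A.
  rewrite -[A]setTI; apply: (measurable_fun_pair (f := fun z => z.1.2) (g := snd)) => //.
  exact: measurableT_comp.
have mk := measurable_prob_section mp mA.
apply: (eq_measurable_fun (fun w => \int[q w]_x (p (w, x) (xsection A (w, x))))%E).
  move=> w _; rewrite /= /pushforward /product_measure1; apply: eq_integral => x _.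
  suff -> : xsection A (w, x) = xsection B x by [].
  by apply/seteqP; split=> y; rewrite /xsection/= !inE.
exact: (measurable_prob_integral mq (k := fun z => p z (xsection A z))).
Qed.

Lemma measurable_all_tnth (E : set T) (n : nat) : measurable E ->
  measurable [set rho : n.-tuple T | forall i, E (tnth rho i)].
Proof.
move=> mE; rewrite (_ : [set _ | _] = \bigcap_(i in [set: 'I_n]) ((@tnth n T)^~ i @^-1` E)).
  apply: fin_bigcap_measurable => // i _; rewrite -[X in measurable X]setTI.
  exact: (measurable_tnth i).
by apply/seteqP; split=> rho h i; [move=> _; exact: h|exact: (h i I)].
Qed.

Lemma power_all (p : probability T R) (E : set T) (n : nat) : measurable E -> p E = 1%E ->
  power p n [set rho | forall i, E (tnth rho i)] = 1%E.
Proof.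
move=> mE pE; elim: n => [|n IH].
  have h : [set rho : 0.-tuple T | forall i, E (tnth rho i)] [tuple] by move=> [].
  by rewrite /= diracE mem_set.
have mall := @measurable_all_tnth E n mE.
rewrite /= /pushforward (_ : _ @^-1` _ = E `*` [set rho | forall i, E (tnth rho i)]).
  by rewrite product_measure1E//; apply: etrans (congr2 mule pE IH) _; rewrite mule1.
apply/seteqP; split=> -[x rho] /=.
  move=> h; split; first exact: (h ord0).
  by move=> i; have := h (lift ord0 i); rewrite tnthS.
move=> [Ex h] i; case: (unliftP ord0 i) => [j ->|->]; rewrite ?tnthS //.
Qed.

End power_measure.

Lemma dense_sequence (R : realType) (H : completeNormedModType R) (D : set H) :
  countable D -> dense D -> exists a : nat -> H, forall (x : H) (e : R), 0 < e ->
    exists n, `|x - a n| < e.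
Proof.
move=> /countable_injP[f injf] dD.
pose a n := xget 0 [set x | D x /\ f x = n].
exists a => x e e0.
have [y [yx Dy]] : ball x e `&` D !=set0.
  apply: dD; [exists x; exact: ballxx|exact: ball_open].
exists (f y); have [Da fa] := @xgetI H 0 [set x | D x /\ f x = f y] y (conj Dy erefl).
have -> : a (f y) = y by apply: injf => //; rewrite inE.
by move: yx; rewrite -ball_normE.
Qed.

(** * Measurability of distances and inner products *)

Section hilbert_measurability.
Context {R : realType} (H : completeNormedModType R).

Lemma measurable_borel_norm (y : H) :
  measurable_fun setT (fun x : borel H => `|(x : H) - y|).
Proof.
apply: (measurability _ (RGenOInfty.measurableE R)) => //= _ [_ [r ->] <-].
rewrite setTI; apply: sub_sigma_algebra.
have c : continuous (fun x : H => `|x - y|).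
  by move=> x; apply: cvg_norm; apply: cvgB; [exact: cvg_id|exact: cvg_cst].
apply: (@open_comp _ _ (fun x : H => `|x - y|)) => [x _|]; [exact: c|exact: interval_open].
Qed.

Hypothesis separable : exists D : set H, countable D /\ dense D.

(** The product of two Borel sigma-algebras need not contain all open sets of the product.
    Separability writes the set of pairs at distance less than r as a countable union of products of
    balls around a dense sequence. *)
Lemma measurable_borel_dist :
  measurable_fun setT (fun z : borel H * borel H => `|(z.1 : H) - (z.2 : H)|).
Proof.
have [D [cD dD]] := separable; have [a ha] := dense_sequence cD dD.
apply: (measurability _ (RGenInftyO.measurableE R)) => //= _ [_ [r ->] <-].
rewrite setTI.
rewrite (_ : _ @^-1` _ = \bigcup_n \bigcup_k
   ([set x : borel H | `|(x : H) - a n| < k.+1%:R^-1] `*`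
    [set y : borel H | `|(y : H) - a n| < r - k.+1%:R^-1])).
  have mb (n : nat) (s : R) : measurable [set x : borel H | `|(x : H) - a n| < s].
    have := @measurable_fun_ltr _ (borel H) R setT _ _ (measurable_borel_norm (a n))
      (measurable_cst s) measurableT [set true] I.
    by rewrite setTI.
  by apply: bigcupT_measurable => n; apply: bigcupT_measurable => k; exact: measurableX.
apply/seteqP; split=> -[x y] /=; rewrite in_itv/=.
  change (`|(x : H) - (y : H)| < r -> exists2 n, True & exists2 k, True &
    `|(x : H) - a n| < k.+1%:R^-1 /\ `|(y : H) - a n| < r - k.+1%:R^-1).
  move: (x : H) (y : H) => {x y} x y xy.
  have [k hk] : exists k : nat, k.+1%:R^-1 < (r - `|x - y|) / 2.
    have e0 : 0 < (r - `|x - y|) / 2 by lra.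
    have [k] := ltr_add_invr e0; rewrite add0r; by exists k.
  have k0 : 0 < k.+1%:R^-1 :> R by rewrite invr_gt0.
  have [n hn] := ha x _ k0; exists n => //; exists k => //; split=> //=.
  have := ler_distD x y (a n); rewrite (distrC y x); move: (k.+1%:R^-1) hn hk {k0} => t; lra.
move=> [n _ [k _]].
change (`|(x : H) - a n| < k.+1%:R^-1 /\ `|(y : H) - a n| < r - k.+1%:R^-1 ->
  `|(x : H) - (y : H)| < r).
move: (x : H) (y : H) => {x y} x y; move: (k.+1%:R^-1) => t [h1 h2].
have := ler_distD (a n) x y; rewrite (distrC (a n) y); lra.
Qed.

Variable ip : {dot H for idfun}.
Hypothesis hip : forall x : H, `|x| ^+ 2 = ip x x.

(** Polarisation reduces measurability of [ip] to that of distances; the differences with 0 match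
    the form of [measurable_borel_norm]. *)
Lemma ip_polar (x y : H) : ip x y = 2^-1 * (`|x - 0| ^+ 2 + `|y - 0| ^+ 2 - `|x - y| ^+ 2).
Proof.
rewrite !subr0 !hip linearBl/= !linearBr/=.
have -> : ip y x = ip x y by rewrite hermC expr0 mul1r.
by field.
Qed.

Lemma measurable_ip : measurable_fun setT (fun z : borel H * borel H => ip (z.1 : H) (z.2 : H)).
Proof.
under eq_fun do rewrite ip_polar.
have m0 := measurable_borel_norm 0.
apply: measurable_funM => //; apply: measurable_funB; last by (apply: measurable_funX; exact: measurable_borel_dist).
apply: measurable_funD; apply: measurable_funX.
  exact: (measurableT_comp m0 measurable_fst).
exact: (measurableT_comp m0 measurable_snd).
Qed.

End hilbert_measurability.

Lemma probability_eq1_sub (R : realType) (d : measure_display) (T : measurableType d)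
  (p : probability T R) (A B C : set T) : measurable A -> measurable B -> measurable C ->
  p A = 1%E -> p B = 1%E -> A `&` B `<=` C -> p C = 1%E.
Proof.
move=> mA mB mC pA pB ABC; have pAC : p (~` A) = 0%E by rewrite probability_setC// pA subee.
have pBC : p (~` B) = 0%E by rewrite probability_setC// pB subee.
have pABC : p (~` A `|` ~` B) = 0%E.
  apply/eqP; rewrite -measure_le0; apply: le_trans (measureU2 _ _ _) _.
  - exact: measurableC.
  - exact: measurableC.
  - by rewrite [X in (X + _)%E]pAC [X in (_ + X)%E]pBC adde0.
have pC : p (~` C) = 0%E.
  apply: (subset_measure0 _ _ _ pABC); [exact: measurableC|
    by apply: measurableU; exact: measurableC|by rewrite -setCI; exact: subsetC].
by rewrite -[C]setCK probability_setC ?pC ?sube0//; exact: measurableC.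
Qed.

Section random_measure.
Context {R : realType} {H : completeNormedModType R}.
Context {dS : measure_display} {S : measurableType dS}.
Variables (PS : probability S R) (mu : {RV PS >-> pprobability (borel H) R}).

Let mpow n : measurable_fun setT (fun w => power (mu w) n : pprobability (n.-tuple (borel H)) R).
Proof. apply: measurable_power; exact: measurable_funPT. Qed.

Lemma replica_prob_eq1 n (B : set (n.-tuple (borel H))) : measurable B ->
  {ae PS, forall w, power (mu w) n B = 1%E} -> replica_prob mu B = 1%E.
Proof.
move=> mB ae1; have e : ('E_PS[cst (1%R : R)] = 1%:E)%E by exact: expectation_cst.
rewrite -[RHS]e expectation.unlock; apply: ae_eq_integral => //.
  exact: (measurable_prob_eval (@mpow n) mB).
  exact/measurable_EFinP.
by move: ae1; apply: filterS => w h _; exact: h.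
Qed.

(** A non-negative function with zero integral vanishes almost everywhere: first over the random
    measure, then over the replicas given it. *)
Lemma replica_average_null n (f : n.-tuple (borel H) -> R) : measurable_fun setT f ->
  (forall rho, 0 <= f rho) -> replica_average mu f = 0%E ->
  {ae PS, forall w, power (mu w) n [set rho | f rho = 0] = 1%E}.
Proof.
move=> mf f0 int0.
have mF : measurable_fun setT (fun w => \int[power (mu w) n]_rho (f rho)%:E)%E.
  apply: (measurable_prob_integral (@mpow n) (k := fun z => (f z.2)%:E)).
    by move=> z; rewrite lee_fin.
  by apply/measurable_EFinP; exact: measurableT_comp.
have : (\int[PS]_w `|\int[power (mu w) n]_rho (f rho)%:E| = 0)%E.
  rewrite -[RHS]int0; apply: eq_integral => w _; rewrite gee0_abs//.
  by apply: integral_ge0 => rho _; rewrite lee_fin.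
move=> /(ae_eq_integral_abs PS measurableT mF); apply: filterS => w /(_ I) /= F0.
have : (\int[power (mu w) n]_rho `|(f rho)%:E| = 0)%E.
  by rewrite -[RHS]F0; apply: eq_integral => rho _; rewrite gee0_abs// lee_fin.
have mf' : measurable_fun setT (EFin \o f) by exact/measurable_EFinP.
move=> /(ae_eq_integral_abs (power (mu w) n) measurableT mf') [E [mE PE sub]].
have mB : measurable [set rho | f rho = 0].
  have := mf measurableT [set 0] (measurable_set1 0); by rewrite setTI.
apply: (@probability_eq1_sub _ _ _ _ (~` E) setT) => //.
- exact: measurableC.
- by apply: etrans (probability_setC _ mE) _; rewrite PE sube0.
- exact: probability_setT.
move=> rho [nE _]; apply: contrapT => nf; apply: nE; apply: sub => /(_ I) /= [].
exact: nf.
Qed.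

End random_measure.

(** * Ultrametricity of the replicas, for overlaps and for distances *)

Section replica_ultrametricity.
Context {R : realType} {H : completeNormedModType R} (ip : {dot H for idfun}).
Hypothesis hH : is_separable_hilbert ip.
Variable x : R.
Context {dS : measure_display} {S : measurableType dS}.
Variables (PS : probability S R) (mu : {RV PS >-> pprobability (borel H) R}).

Let coord n (i : 'I_n) (rho : n.-tuple (borel H)) : H := tnth rho i.

Lemma measurable_replica_array n (i j : 'I_n) :
  measurable_fun setT (fun rho : n.-tuple (borel H) => replica_array ip x rho i j).
Proof.
under eq_fun do rewrite mxE; apply: measurable_funD => //.
apply: (measurableT_comp (measurable_ip hH.2 hH.1)
  (g := fun rho : n.-tuple (borel H) => (tnth rho i, tnth rho j))).
by apply/measurable_fun_pairP; split; exact: measurable_tnth.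
Qed.

Lemma measurable_replica_dist n (i j : 'I_n) :
  measurable_fun setT (fun rho : n.-tuple (borel H) => `|coord i rho - coord j rho|).
Proof.
apply: (measurableT_comp (measurable_borel_dist hH.2)
  (g := fun rho : n.-tuple (borel H) => (tnth rho i, tnth rho j))).
by apply/measurable_fun_pairP; split; exact: measurable_tnth.
Qed.

Let r1 : 'I_3 := @Ordinal 3 0 isT.
Let r2 : 'I_3 := @Ordinal 3 1 isT.
Let r3 : 'I_3 := @Ordinal 3 2 isT.

Let overlaps : set (3.-tuple (borel H)) := [set rho |
  let A := replica_array ip x rho in Num.min (A r1 r3) (A r2 r3) <= A r1 r2].

Let norms : set (3.-tuple (borel H)) := [set rho |
  `|coord r1 rho - coord r2 rho| <=
    Num.max `|coord r1 rho - coord r3 rho| `|coord r2 rho - coord r3 rho|].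

Let F (rho : 3.-tuple (borel H)) : R := violation (offdiag (replica_array ip x rho)).

Let overlaps_violation : overlaps = [set rho | F rho = 0].
Proof.
apply/seteqP; split=> rho; rewrite /overlaps /F /= violationE.
  by rewrite -subr_le0 => h; rewrite (max_l h).
by move=> e; rewrite -subr_le0 -[leRHS]e le_max lexx orbT.
Qed.

Let measurable_F : measurable_fun setT F.
Proof.
rewrite (_ : F = fun rho => let A := replica_array ip x rho in
    Num.max 0 (Num.min (A r1 r3) (A r2 r3) - A r1 r2)).
  have mA := @measurable_replica_array 3.
  by apply: measurable_maxr => //; apply: measurable_funB => //; exact: measurable_minr.
by apply/funext => rho; rewrite /F violationE.
Qed.

Let measurable_overlaps : measurable overlaps.
Proof.
rewrite overlaps_violation.
by have := measurable_F measurableT (measurable_set1 0); rewrite setTI.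
Qed.

Let measurable_norms : measurable norms.
Proof.
rewrite /norms -[X in measurable X]setTI; apply: measurable_fun_le => //.
  exact: measurable_replica_dist.
by apply: measurable_maxr; exact: measurable_replica_dist.
Qed.

Let sphere : set (borel H) := [set rho | `|(rho : H)| = Num.sqrt x].

Let measurable_sphere : measurable sphere.
Proof.
have := @measurable_borel_norm R H 0 measurableT _ (measurable_set1 (Num.sqrt x)).
rewrite setTI; congr measurable; apply/seteqP; split=> y; rewrite /sphere /=;
  by rewrite (subr0 (y : H)).
Qed.

Let sphere_overlaps_norms :
  overlaps `&` [set rho | forall i, sphere (tnth rho i)] `<=` norms.
Proof.
move=> rho [/= + sph].
(* On a common sphere the distance is a decreasing function of the inner product, so the two
   inequalities correspond. *)
have dist (i j : 'I_3) : `|coord i rho - coord j rho| ^+ 2 =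
    2 * Num.sqrt x ^+ 2 - 2 * ip (coord i rho) (coord j rho).
  have := ip_polar hH.1 (coord i rho) (coord j rho); rewrite !subr0.
  have -> : `|coord i rho| = Num.sqrt x by exact: sph.
  have -> : `|coord j rho| = Num.sqrt x by exact: sph.
  by lra.
have mono (i j : 'I_3) : ip (coord i rho) (coord j rho) <= ip (coord r1 rho) (coord r2 rho) ->
    `|coord r1 rho - coord r2 rho| <= `|coord i rho - coord j rho|.
  by move=> h; rewrite -(@ler_pXn2r _ 2)// ?nnegrE// !dist; lra.
rewrite /overlaps /norms /= !mxE /= !mulr0 !addr0 ge_min le_max => /orP[] h; apply/orP.
  by left; exact: (mono r1 r3 h).
by right; exact: (mono r2 r3 h).
Qed.

Lemma replica_ultrametricity :
  {ae PS, forall w, mu w sphere = 1%E} -> replica_average mu F = 0%E ->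
  replica_prob mu overlaps = 1%E /\ replica_prob mu norms = 1%E.
Proof.
move=> ae_sphere F0.
have ae_overlaps : {ae PS, forall w, power (mu w) 3 overlaps = 1%E}.
  rewrite overlaps_violation; apply: replica_average_null => // rho.
  exact: violation_ge0.
split; first exact: (replica_prob_eq1 measurable_overlaps ae_overlaps).
apply: (replica_prob_eq1 measurable_norms).
apply: filterS2 ae_sphere ae_overlaps => w s1 o1.
apply: (probability_eq1_sub measurable_overlaps (@measurable_all_tnth _ _ _ 3 measurable_sphere)
  measurable_norms o1 _ sphere_overlaps_norms).
exact: power_all.
Qed.

End replica_ultrametricity.

Unset Implicit Arguments.
Set Strict Implicit.

Theorem corollary7p1 (R : realType)
  (* the simple random walk on Z^2 *)
  (dW : measure_display) (TW : measurableType dW)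
  (PW : Z2 -> probability TW R) (W : nat -> TW -> Z2)
  (hW : forall v : Z2, simple_random_walk (PW v) W v)
  (* the Gaussian free fields and their conditional expectations *)
  (d : nat -> measure_display) (T : forall N : nat, measurableType (d N))
  (P : forall N : nat, probability (T N) R)
  (phi : forall N : nat, V N -> {RV (P N) >-> R})
  (hphi : is_gff phi PW W)
  (cphi : forall N : nat, V N -> R -> T N -> R)
  (hcphi : are_cond_exps phi cphi)
  (* the scale-inhomogeneous field *)
  (M : nat) (sigma lambda : nat -> R)
  (hsigma : forall i : nat, (1 <= i <= M)%N -> 0 < sigma i)
  (hlambda : scales M lambda)
  (* the effective parameters *)
  (m : nat) (sbar lbar : nat -> R)
  (hbar : effective (step_fun M sigma lambda) m sbar lbar)
  (C0 : R) (hC0 : overlap_constant phi cphi M sigma lambda C0)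
  (beta : R) (hbeta : noncritical m sbar beta)
  (* the limiting random measure *)
  (H : completeNormedModType R) (ip : {dot H for idfun})
  (hH : is_separable_hilbert ip)
  (dS : measure_display) (S : measurableType dS) (PS : probability S R)
  (mu : {RV PS >-> pprobability (borel H) R}) :
  let x := effective_x (step_fun M sigma lambda) lbar
             (l_beta m sbar beta).-1 in
  let r1 : 'I_3 := @Ordinal 3 0 isT in
  let r2 : 'I_3 := @Ordinal 3 1 isT in
  let r3 : 'I_3 := @Ordinal 3 2 isT in
  let ultrametric_overlaps :=
    replica_prob mu [set rho : 3.-tuple (borel H) |
      let A := replica_array ip x rho in
      Num.min (A r1 r3) (A r2 r3) <= A r1 r2] = 1%E in
  let ultrametric_norm :=
    replica_prob mu [set rho : 3.-tuple (borel H) |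
      `|(tnth rho r1 : H) - (tnth rho r2 : H)| <=
        Num.max `|(tnth rho r1 : H) - (tnth rho r3 : H)|
                `|(tnth rho r2 : H) - (tnth rho r3 : H)|] = 1%E in
  subsequential_limit P cphi M sigma lambda C0 beta ip x mu ->
  ultrametric_overlaps /\ (ultrametric_overlaps <-> ultrametric_norm).
Proof.
move=> x r1 r2 r3 overlaps norms lim.
have null := violation_average_eq0 hW hphi hcphi hsigma hlambda hC0.1 lim.
have [h1 h2] := replica_ultrametricity hH lim.1 null.
split; first exact: h1.
split=> _; [exact: h2|exact: h1].
Qed.
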